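(* Let $\mu$ be an ergodic $\mathfrak{S}^{\mathbb{N}}$-invariant Borel probability measure on the set of all graphs with vertex set $\mathbb{N}$ that is concentrated on the set of universal homogeneous countable graphs. Then there exists a universal generalized measurable graph $(X,m,\omega)$ such that $\mu=M(X,m,\omega)$.
   Context: Graphs are undirected, without loops or multiple edges. Graphs with vertex set $\mathbb{N}$ are identified with their adjacency matrices, i.e. infinite symmetric $\{0,1\}$-matrices with zero diagonal, with the weak (product) topology and its Borel $\sigma$-field. $\mathfrak{S}^{\mathbb{N}}$ is the group of all permutations of $\mathbb{N}$, acting by simultaneous permutation of rows and columns. A countable graph $\Gamma$ is universal (homogeneous) if every finite graph embeds in $\Gamma$ as an induced subgraph and every isomorphism between two finite induced subgraphs of $\Gamma$ extends to an automorphism of $\Gamma$. A generalized measurable graph is a triple $(X,m,\omega)$ where $(X,m)$ is a standard Lebesgue space with continuous (atomless) probability measure $m$, and $\omega$ is a symmetric $(m\times m)$-measurable function on $X\times X$ with values in $[0,1]$. It is called universal if for all positive integers $n,l$ and almost all (with respect to the product measure) pairs of tuples $(x_1,\dots,x_n)$, $(y_1,\dots,y_l)$ of points of $X$, $$m\Big\{z\in X:\ \prod_{i,j}\omega(x_i,z)\,(1-\omega(y_j,z))>0\Big\}>0 .$$ The measure $M(X,m,\omega)$ generated by $(X,m,\omega)$ is the distribution of the random graph on $\mathbb{N}$ obtained as follows: choose a sequence $x_1,x_2,\dots$ of independent points of $X$ with distribution $m$; then, given this sequence, independently for all pairs $i<j$, declare $\{i,j\}$ an edge with probability $\omega(x_i,x_j)$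 and a non-edge with probability $1-\omega(x_i,x_j)$. *)

(* Defs.v *)
From HB Require Import structures.
From mathcomp Require Import all_boot all_order all_algebra finmap.
From mathcomp Require Import all_classical all_reals all_analysis.

Set Implicit Arguments.
Unset Strict Implicit.
Unset Printing Implicit Defensive.

Import Order.TTheory GRing.Theory Num.Theory.

Local Open Scope classical_set_scope.
Local Open Scope ring_scope.

(* Adjacency matrices, with the product of the discrete topologies on [bool];
   [graph] carries the subspace topology. *)
Definition is_adjacency : set {ptws nat * nat -> bool} :=
  [set a | (forall i j, a (i, j) = a (j, i)) /\ (forall i, a (i, i) = false)].

Definition graph := set_type is_adjacency.

HB.instance Definition _ := Topological.on graph.

Definition edge (G : graph) (i j : nat) : bool := set_val G (i, j).

Lemma empty_adjacency : (fun=> false) \in is_adjacency.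
Proof. by rewrite inE; split. Qed.

HB.instance Definition _ := isPointed.Build graph (SigSub empty_adjacency).

(* The graphs on [nat] with their Borel sigma-field. *)
Notation borel_graph := (g_sigma_algebraType (@open graph)).

Lemma relabel_subproof (s : nat -> nat) (G : graph) :
  (fun p => edge G (s p.1) (s p.2)) \in is_adjacency.
Proof.
case: G => a ha; have := ha; rewrite !inE => -[sa ia].
by split=> [i j|i]; rewrite /edge /=; [exact: sa|exact: ia].
Qed.

Definition relabel (s : nat -> nat) (G : graph) : graph :=
  SigSub (relabel_subproof s G).

Definition universal_homogeneous (G : graph) : Prop :=
  (forall (T : finType) (e : rel T), symmetric e -> irreflexive e ->
     exists2 f : T -> nat, injective f &
       forall u v, edge G (f u) (f v) = e u v) /\
  (forall (A B : set nat) (f : nat -> nat),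
     finite_set A -> set_bij A B f ->
     (forall i j, A i -> A j -> edge G (f i) (f j) = edge G i j) ->
     exists h : nat -> nat,
       [/\ bijective h,
           forall i j, edge G (h i) (h j) = edge G i j &
           forall i, A i -> h i = f i]).

Section invariant_measures.
Context {R : realType}.
Variable mu : probability borel_graph R.

Definition perm_invariant : Prop :=
  forall (s : nat -> nat), bijective s ->
  forall A : set borel_graph, measurable A -> mu (relabel s @^-1` A) = mu A.

(* Invariance of [A] is meant modulo [mu]-null sets. For the action of the
   uncountable group of all permutations this matters: if [mu] is concentrated
   on one orbit (e.g. that of the universal graph), then every strictly
   invariant event has probability 0 or 1. *)
Definition perm_ergodic : Prop :=
  forall A : set borel_graph, measurable A ->
  (forall s : nat -> nat, bijective s -> mu ((relabel s @^-1` A) `+` A) = 0%E) ->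
  mu A = 0%E \/ mu A = 1%E.

End invariant_measures.

Section lebesgue_spaces.
Context {R : realType}.

Definition iso_mod0 d1 (X1 : measurableType d1) d2 (X2 : measurableType d2)
    (m1 : set X1 -> \bar R) (m2 : set X2 -> \bar R) : Prop :=
  exists (A1 : set X1) (A2 : set X2) (f : X1 -> X2) (g : X2 -> X1),
    [/\ measurable A1, measurable A2, m1 (~` A1) = 0%E & m2 (~` A2) = 0%E] /\
    [/\ forall x, A1 x -> A2 (f x) /\ g (f x) = x,
        forall y, A2 y -> A1 (g y) /\ f (g y) = y,
        measurable_fun A1 f,
        measurable_fun A2 g &
        forall B, measurable B -> m1 (A1 `&` f @^-1` B) = m2 B].

(* Lebesgue-Rokhlin probability spaces: complete, and isomorphic mod 0 to the
   completion of a Borel probability measure on the line. *)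
Definition standard_lebesgue d (X : measurableType d) (m : probability X R) :
    Prop :=
  measure_is_complete m /\
  exists nu : probability (measurableTypeR R) R,
    iso_mod0 m (@completed_measure_extension _ _ _ nu).

Definition atomless d (X : measurableType d) (m : probability X R) : Prop :=
  forall A, measurable A -> (0 < m A)%E ->
  exists B, [/\ measurable B, B `<=` A, (0 < m B)%E & (m B < m A)%E].

(* Measurability with respect to the completion of [mu]. *)
Definition completed_measurable_fun d (T : measurableType d)
    (mu : {measure set T -> \bar R}) (f : T -> R) : Prop :=
  measurable_fun [set: caratheodory_type (mu^*)%mu] f.

Definition generalized_measurable_graph d (X : measurableType d)
    (m : probability X R) (w : X * X -> R) : Prop :=
  [/\ standard_lebesgue m,
      atomless m,
      forall x y, w (x, y) = w (y, x),
      forall p, 0 <= w p <= 1 &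
      completed_measurable_fun (m \x m)%E w].

End lebesgue_spaces.

Section product_power.
Context {R : realType} d (X : measurableType d) (m : probability X R).

Definition tuple_cons n (p : X * n.-tuple X) : n.+1.-tuple X :=
  [tuple of p.1 :: p.2].

Lemma measurable_tuple_cons n : measurable_fun [set: X * n.-tuple X] (@tuple_cons n).
Proof. exact: measurable_cons. Qed.

HB.instance Definition _ n := isMeasurableFun.Build _ _ _ _ (@tuple_cons n)
  (@measurable_tuple_cons n).

Fixpoint power_measure n : probability (n.-tuple X) R :=
  match n with
  | 0 => dirac [tuple]
  | n.+1 => distribution (m \x power_measure n)%E (@tuple_cons n)
  end.

(* If [m] is complete and [w] is measurable for the completion of [m \x m], then
   the set of [z] below is measurable for almost all pairs of tuples. *)
Definition universal_measurable_graph (w : X * X -> R) : Prop :=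
  forall n l : nat, (0 < n)%N -> (0 < l)%N ->
  \forall p \ae (power_measure n \x power_measure l)%E,
    (0 < m [set z | (0 < \prod_(i < n) \prod_(j < l)
       (w (tnth p.1 i, z) * (1 - w (tnth p.2 j, z))))%R])%E.

End product_power.

Section random_graph.
Context {R : realType} dO (Omega : measurableType dO) (P : probability Omega R).

(* [f] is almost surely equal to a version of the conditional probability of
   [E] given the sub-sigma-algebra [F]; equality is only almost sure because
   functions measurable for a completion are considered below. *)
Definition is_cond_prob (F : set (set Omega)) (E : set Omega)
    (f : Omega -> R) : Prop :=
  exists g : Omega -> R,
    [/\ preimage_set_system setT g measurable `<=` F,
        P.-integrable setT (EFin \o g),
        \forall t \ae P, f t = g t &
        forall B, F B -> P (E `&` B) = (\int[P]_(t in B) (g t)%:E)%E].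

Context d (X : measurableType d).

Definition mutually_independent (x : nat -> {RV P >-> X}) : Prop :=
  forall (J : {fset nat}) (A : nat -> set X), (forall i, measurable (A i)) ->
  P (\bigcap_(i in [set` J]) (x i @^-1` A i)) =
  (\prod_(i <- J) fine (P (x i @^-1` A i)))%:E.

Definition sigma_of_sequence (x : nat -> {RV P >-> X}) : set (set Omega) :=
  <<s \bigcup_i preimage_set_system setT (x i) measurable >>.

(* The edge indicators of [G] at the pairs [i < j] are, given the sequence [x],
   independent, with success probabilities [w (x i, x j)]. *)
Definition cond_independent_edges (w : X * X -> R) (x : nat -> {RV P >-> X})
    (G : {RV P >-> borel_graph}) : Prop :=
  forall (S : {fset nat * nat}) (b : nat * nat -> bool),
  (forall p, p \in S -> (p.1 < p.2)%N) ->
  is_cond_prob (sigma_of_sequence x)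
    [set t | forall p, p \in S -> edge (G t) p.1 p.2 = b p]
    (fun t => \prod_(p <- S)
       (if b p then w (x p.1 t, x p.2 t) else 1 - w (x p.1 t, x p.2 t))).

End random_graph.

(* [mu] is the measure generated by the graph [w] on the space [(X, m)]. The
   conditions below determine the distribution of [G]. *)
Definition generated_measure (R : realType) d (X : measurableType d)
    (m : probability X R) (w : X * X -> R) (mu : probability borel_graph R) :
    Prop :=
  exists dO (Omega : measurableType dO) (P : probability Omega R)
    (x : nat -> {RV P >-> X}) (G : {RV P >-> borel_graph}),
    [/\ forall i A, measurable A -> distribution P (x i) A = m A,
        mutually_independent x,
        cond_independent_edges w x G &
        forall A, measurable A -> mu A = distribution P G A].

(* Main.v *)
(* One graph [G] that is typical for [mu] determines [mu]: the densities of finite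
   patterns in the initial segments of size [4 ^ j] have successive differences
   with second moment [O(4 ^- j)], so they converge almost surely; the limit is
   invariant, hence by ergodicity it is the probability of the pattern under [mu].

   Weak regularity, applied to [G] restricted to each segment, splits the segment
   along a binary tree of classes. The masses of the classes and the densities
   between them converge along an ultrafilter. The limit masses cut the unit
   interval into cells, the limit densities define a step function on each level
   of the tree; the steps converge in mean square because their energies are
   bounded and nondecreasing, and the limit is the graph [w]. The counting lemma
   passes to the limit and gives every finite pattern the same probability in the
   random graph generated by [w] as under [mu].

   All random choices are read off a single uniform variable, which is split into
   a sequence of independent ones: the even terms are the points [x_i], the odd
   terms decide the edges.

   Almost every sample satisfies the extension property of the universal graph.
   If the sets of the definition of universality were null for a set of pairs of
   tuples of positive measure, then with positive probability no further vertex
   could extend the sampled tuples, a contradiction. *)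

Require Import Defs.
From HB Require Import structures.
From mathcomp Require Import all_boot all_order all_algebra finmap.
From mathcomp Require Import all_classical all_reals all_analysis.
From mathcomp Require Import measurable_realfun.
From mathcomp Require Import ring lra zify.

Set Implicit Arguments.
Unset Strict Implicit.
Unset Printing Implicit Defensive.

Import Order.TTheory GRing.Theory Num.Theory.
Import numFieldNormedType.Exports.

Local Open Scope ring_scope.

(** A regularity lemma usually stops at a level that is good for the given graph, and this level
    varies with the graph. Here the greedy refinement never stops: the squares of its cut norms have
    sum at most 1 over all levels together, so the bound survives the limit over the segments and
    forces the limiting cut norms to tend to 0. Segments of size [4 ^ j] make the standard
    deviations, of order [2 ^- j], summable. Patterns prescribe present edges only: such events are
    closed under intersection and generate the Borel sets, hence determine a measure. The space of
    vertices must be complete, and a Borel map need not be measurable between completions; it is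
    when it pulls null sets back to null sets, and the maps that split the uniform variable preserve
    the measure. The completed interval is both the space of vertices and the probability space of
    the sample. The sigma-algebra generated by a set of the independent variables is turned into a
    measurable type of its own, so that conditioning on these variables becomes integration over one
    further variable with the others fixed. *)

Lemma onem01 (R : numDomainType) (x : R) : 0 <= x <= 1 -> 0 <= 1 - x <= 1.
Proof. by move=> /andP[x0 x1]; rewrite subr_ge0 x1 lerBlDr lerDl. Qed.

Lemma mul01 (R : numDomainType) (x y : R) : 0 <= x <= 1 -> 0 <= y <= 1 -> 0 <= x * y <= 1.
Proof. by move=> /andP[x0 x1] /andP[y0 y1]; rewrite mulr_ge0// mulr_ile1. Qed.

Lemma prod01 (R : numDomainType) (I : Type) (s : seq I) (g : I -> R) :
  (forall i, 0 <= g i <= 1) -> 0 <= \prod_(i <- s) g i <= 1.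
Proof.
by move=> g01; elim: s => [|i s IH]; rewrite ?big_nil ?ler01 ?lexx// big_cons mul01.
Qed.

(** * Weak regularity and counting *)

(** Cauchy-Schwarz against a constant family, read off the nonnegative sum of the squares
    [(n * w i - s) ^+ 2]. *)
Lemma sqr_sum_le (R : realFieldType) (I : finType) (w : I -> R) :
  (\sum_i w i) ^+ 2 <= #|I|%:R * \sum_i w i ^+ 2.
Proof.
have [I0|I0] := posnP #|I|.
  rewrite !big1 ?expr0n ?mulr0 // => i _; have := card0_eq I0 i; by rewrite !inE.
set s := \sum_i w i; set n : R := #|I|%:R.
have n0 : 0 < n by rewrite ltr0n.
have : 0 <= \sum_i (n * w i - s) ^+ 2 by apply: sumr_ge0 => i _; exact: sqr_ge0.
rewrite [X in 0 <= X](_ : _ = n * (n * (\sum_i w i ^+ 2) - s ^+ 2)).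
  by rewrite pmulr_rge0// subr_ge0.
transitivity (\sum_i (n ^+ 2 * w i ^+ 2 + (- (2 * n * s) * w i + s ^+ 2))).
  by apply: eq_bigr => i _; ring.
by rewrite !big_split /= -!mulr_sumr sumr_const -/s -mulr_natl -/n; ring.
Qed.

Section regularity.
Variables (R : realFieldType) (V : finType) (A : V -> V -> R).
Hypothesis V_gt0 : (0 < #|V|)%N.
Hypothesis A01 : forall x y, 0 <= A x y <= 1.
Hypothesis A_sym : forall x y, A x y = A y x.
Local Notation N := (#|V|%:R : R).

Section labelling.
Variables (L : eqType) (l : V -> L).

Definition class_size (a : L) : nat := #|[pred x | l x == a]|.

(** If a class is empty the value is 0, because the inverse of 0 is 0; the bounds below thus hold
    for arbitrary labels. *)
Definition density (a b : L) : R :=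
  (\sum_(x | l x == a) \sum_(y | l y == b) A x y)
  / ((class_size a)%:R * (class_size b)%:R).

Lemma class_size_gt0 x : (0 < class_size (l x))%N.
Proof. by apply/card_gt0P; exists x; rewrite inE. Qed.

Lemma density01 a b : 0 <= density a b <= 1.
Proof.
apply/andP; split.
  rewrite /density divr_ge0 ?mulr_ge0//; apply: sumr_ge0 => x _.
  by apply: sumr_ge0 => y _; case/andP: (A01 x y).
have [e|e] := posnP (class_size a * class_size b).
  by rewrite /density -natrM e invr0 mulr0.
rewrite /density -natrM ler_pdivrMr ?ltr0n// mul1r natrM.
rewrite [leRHS](_ : _ = \sum_(x | l x == a) \sum_(y | l y == b) 1).
  by apply: ler_sum => x _; apply: ler_sum => y _; case/andP: (A01 x y).
by rewrite !sumr_const -[RHS]mulr_natl.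
Qed.

Lemma density_sym a b : density a b = density b a.
Proof.
rewrite /density exchange_big/= (mulrC (class_size a)%:R); congr (_ / _).
by apply: eq_bigr => x _; apply: eq_bigr => y _.
Qed.

(** The block averages are the conditional expectation of [A] on pairs of classes, so they pair with
    a function of the labels as [A] does. The average over a block is spread out and the sums are
    exchanged. *)
Lemma sum_density (g : L -> L -> R) :
  \sum_x \sum_y density (l x) (l y) * g (l x) (l y)
  = \sum_x \sum_y A x y * g (l x) (l y).
Proof.
pose c a : R := (class_size a)%:R.
have cV x : c (l x) != 0 by rewrite pnatr_eq0 -lt0n class_size_gt0.
have csum a (h : R) : \sum_(x | l x == a) h = c a * h.
  by rewrite sumr_const -mulr_natl.
transitivity (\sum_x \sum_y \sum_(x' | l x' == l x) \sum_(y' | l y' == l y)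
   A x' y' * (g (l x') (l y') / (c (l x') * c (l y')))).
  apply: eq_bigr => x _; apply: eq_bigr => y _.
  rewrite /density -/(c _) -/(c _) mulrAC -mulrA mulr_suml; apply: eq_bigr => x' /eqP->.
  by rewrite mulr_suml; apply: eq_bigr => y' /eqP->.
transitivity (\sum_x \sum_x' \sum_y \sum_y'
   if (l x' == l x) && (l y' == l y)
   then A x' y' * (g (l x') (l y') / (c (l x') * c (l y'))) else 0).
  apply: eq_bigr => x _; rewrite [RHS]exchange_big; apply: eq_bigr => y _ /=.
  rewrite [LHS]big_mkcond /=; apply: eq_bigr => x' _.
  case: eqP => e /=; last by rewrite big1.
  by rewrite [LHS]big_mkcond.
rewrite exchange_big; apply: eq_bigr => x' _ /=.
under eq_bigr do rewrite exchange_big.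
rewrite exchange_big; apply: eq_bigr => y' _ /=.
transitivity (\sum_(x | l x == l x') \sum_(y | l y == l y')
    A x' y' * (g (l x') (l y') / (c (l x') * c (l y')))).
  rewrite [RHS]big_mkcond; apply: eq_bigr => x _ /=; rewrite eq_sym.
  case: eqP => e /=; last by rewrite big1.
  by rewrite [RHS]big_mkcond; apply: eq_bigr => y _ /=; rewrite eq_sym.
rewrite csum csum; have := cV x'; have := cV y'; move: (c _) (c _) => u v u0 v0.
by field; apply/andP.
Qed.

End labelling.

Section nested_labellings.
Variables (L L' : eqType) (l : V -> L) (l' : V -> L') (pr : L' -> L).
Hypothesis nested : forall x, pr (l' x) = l x.
Local Notation w := (fun x y => density l (l x) (l y)).
Local Notation w' := (fun x y => density l' (l' x) (l' y)).

Lemma sum_density_refine (g : V -> V -> R) (h : L' -> L' -> R) :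
  (forall x y, g x y = h (l' x) (l' y)) ->
  \sum_x \sum_y A x y * g x y = \sum_x \sum_y w' x y * g x y.
Proof.
move=> gh; transitivity (\sum_x \sum_y A x y * h (l' x) (l' y)).
  by apply: eq_bigr => x _; apply: eq_bigr => y _; rewrite gh.
by rewrite -sum_density; apply: eq_bigr => x _; apply: eq_bigr => y _; rewrite gh.
Qed.

(** The coarse step function depends on the fine labels only, through [pr]. It therefore pairs with
    the fine densities as with [A], and the cross term is the energy of the coarse function. *)
Lemma density_pythagoras :
  \sum_x \sum_y (w' x y - w x y) ^+ 2
  = \sum_x \sum_y w' x y ^+ 2 - \sum_x \sum_y w x y ^+ 2.
Proof.
have e : \sum_x \sum_y w' x y * w x y = \sum_x \sum_y w x y ^+ 2.
  rewrite -(@sum_density_refine w (fun a b => density l (pr a) (pr b))); last first.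
    by move=> x y; rewrite !nested.
  by rewrite -sum_density.
rewrite -[RHS](_ : \sum_x \sum_y w' x y ^+ 2
  - (\sum_x \sum_y w' x y * w x y) *+ 2 + \sum_x \sum_y w x y ^+ 2 = _).
  rewrite -sumrMnl -sumrB -big_split/=; apply: eq_bigr => x _.
  rewrite -sumrMnl -sumrB -big_split/=; apply: eq_bigr => y _.
  by rewrite sqrrB.
rewrite e; ring.
Qed.

End nested_labellings.

Definition mean2 (F : V -> V -> R) : R := (\sum_x \sum_y F x y) / N ^+ 2.

Let N2_gt0 : 0 < N ^+ 2.
Proof. by rewrite exprn_gt0// ltr0n. Qed.

Definition discrepancy (L : eqType) (l : V -> L) (p : {set V} * {set V}) : R :=
  \sum_x \sum_y (A x y - density l (l x) (l y)) * ((x \in p.1)%:R * (y \in p.2)%:R).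

Definition worst (L : eqType) (l : V -> L) : {set V} * {set V} :=
  [arg max_(p > (finset.set0, finset.set0)) `|discrepancy l p|]%O.

Lemma worstP (L : eqType) (l : V -> L) p :
  `|discrepancy l p| <= `|discrepancy l (worst l)|.
Proof. by rewrite /worst; case: arg_maxP => // q _; apply. Qed.

(** For fixed [v] the form is linear in [u], so over the cube it is largest at the indicator of the
    points with positive coefficient. Then the same is done for [v]. *)
Lemma cut_functions (D : V -> V -> R) (c : R) :
  (forall S T : {set V},
     \sum_x \sum_y D x y * ((x \in S)%:R * (y \in T)%:R) <= c) ->
  forall u v : V -> R, (forall x, 0 <= u x <= 1) -> (forall x, 0 <= v x <= 1) ->
  \sum_x \sum_y D x y * (u x * v y) <= c.
Proof.
have vertex (h u : V -> R) : (forall x, 0 <= u x <= 1) ->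
    \sum_x h x * u x <= \sum_x h x * (x \in [set y | 0 < h y])%:R.
  move=> u01; apply: ler_sum => x _; rewrite inE.
  case: ltP => h0; rewrite ?mulr1 ?mulr0; have /andP[a b] := u01 x; nra.
move=> Dc u v u01 v01.
have e1 (p q : V -> R) : \sum_x \sum_y D x y * (p x * q y)
    = \sum_x (\sum_y D x y * q y) * p x.
  apply: eq_bigr => x _; rewrite mulr_suml; apply: eq_bigr => y _; ring.
have e2 (p q : V -> R) : \sum_x \sum_y D x y * (p x * q y)
    = \sum_y (\sum_x D x y * p x) * q y.
  rewrite exchange_big; apply: eq_bigr => y _; rewrite mulr_suml.
  apply: eq_bigr => x _; ring.
rewrite e1; apply: le_trans (vertex _ _ u01) _; rewrite -e1 e2.
by apply: le_trans (vertex _ _ v01) _; rewrite -e2; exact: Dc.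
Qed.

(* Greedy regularization: each round splits every class along both sides of a cut
   on which the current step function deviates most from [A]. *)
Fixpoint bits (r : nat) : V -> seq bool :=
  if r is r'.+1 then
    fun x => [:: x \in (worst (bits r')).2, x \in (worst (bits r')).1 & bits r' x]
  else fun=> [::].

Definition step r x y : R := density (bits r) (bits r x) (bits r y).

Definition cutnorm r : R := `|discrepancy (bits r) (worst (bits r))| / N ^+ 2.

Definition energy r : R := mean2 (fun x y => step r x y ^+ 2).

Lemma size_bits r x : size (bits r x) = r.*2.
Proof. by elim: r => //= r ->; rewrite doubleS. Qed.

(** New bits go in front, two per round, so dropping from the front coarsens a label. *)
Lemma drop_bits r d x : drop d.*2 (bits (d + r) x) = bits r x.
Proof. by elim: d => [|d IH]; rewrite ?drop0// addSn doubleS /= IH. Qed.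

Lemma step01 r x y : 0 <= step r x y <= 1.
Proof. exact: density01. Qed.

Lemma mean2_step r s : (r <= s)%N ->
  mean2 (fun x y => (step s x y - step r x y) ^+ 2) = energy s - energy r.
Proof.
move=> rs; rewrite /energy /mean2 -mulrBl; congr (_ / _).
apply: (@density_pythagoras _ _ _ _ (drop (s - r).*2)) => x.
  by have := drop_bits r (s - r) x; rewrite subnK.
Qed.

Lemma mean2_le1 (F : V -> V -> R) : (forall x y, F x y <= 1) -> mean2 F <= 1.
Proof.
move=> F1; rewrite /mean2 ler_pdivrMr// mul1r.
apply: (@le_trans _ _ (\sum_(x : V) \sum_(y : V) 1)).
  by apply: ler_sum => x _; apply: ler_sum.
by rewrite !sumr_const -mulrnA natrM expr2.
Qed.

Lemma energy_ge0 r : 0 <= energy r.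
Proof.
apply: divr_ge0; last exact: ltW.
apply: sumr_ge0 => x _.
by apply: sumr_ge0 => y _; exact: sqr_ge0.
Qed.

Lemma energy_le1 r : energy r <= 1.
Proof.
apply: mean2_le1 => x y; have /andP[s0 s1] := step01 r x y; exact: exprn_ile1.
Qed.

(** Both sides of the worst cut are unions of classes of the next round, so the next step function
    has the same sum over the cut as [A]. Cauchy-Schwarz bounds the squared deviation by the mean
    square of the change of the step function, which is the energy gained. *)
Lemma energy_increment r : cutnorm r ^+ 2 <= energy r.+1 - energy r.
Proof.
rewrite -(mean2_step (leqnSn r)) /cutnorm /mean2.
rewrite expr_div_n real_normK ?num_real// ler_pdivrMr ?exprn_gt0 ?ltr0n//.
set X := (X in _ <= X / _ * _).
rewrite [leRHS](_ : _ = N ^+ 2 * X); last first.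
  by field; rewrite pnatr_eq0 -lt0n.
set p := worst (bits r).
have -> : discrepancy (bits r) p = \sum_x \sum_y
   (step r.+1 x y - step r x y) * ((x \in p.1)%:R * (y \in p.2)%:R).
  (* The two newest bits record the two sides of the cut, the second side in front. *)
  have mem x : (x \in p.1) = nth false (bits r.+1 x) 1 /\ (x \in p.2) = nth false (bits r.+1 x) 0 by [].
  pose h a b : R := (nth false a 1)%:R * (nth false b 0)%:R.
  rewrite /discrepancy.
  under eq_bigr do (under eq_bigr do rewrite mulrBl; rewrite sumrB).
  under [RHS]eq_bigr do (under eq_bigr do rewrite mulrBl; rewrite sumrB).
  rewrite !sumrB; congr (_ - _).
  by rewrite (sum_density_refine (l' := bits r.+1) (h := h)).
rewrite pair_big /= (le_trans (sqr_sum_le _))//.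
rewrite [in X in X%:R * _]card_prod natrM -expr2 ler_wpM2l ?exprn_ge0//.
rewrite /X pair_big /=; apply: ler_sum => -[x y] _ /=.
rewrite exprMn ler_piMr ?sqr_ge0//.
by do 2 case: (_ \in _); rewrite ?(mulr0, mulr1, expr0n, expr1n)/= ?ler01 ?lexx.
Qed.

Lemma cutnorm_ge0 r : 0 <= cutnorm r.
Proof. by rewrite divr_ge0// ltW. Qed.

(** The energy increments telescope within the interval [0, 1]. The bound is the same for all
    graphs, whichever levels carry the large cut norms. *)
Lemma sum_cutnorm K : \sum_(r < K) cutnorm r ^+ 2 <= 1.
Proof.
apply: (@le_trans _ _ (energy K - energy 0)); last first.
  by have := energy_le1 K; have := energy_ge0 0; lra.
elim: K => [|K IH]; first by rewrite big_ord0 subrr.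
rewrite big_ord_recr/=; have := energy_increment K; lra.
Qed.

Lemma cutnorm_le1 r : cutnorm r <= 1.
Proof.
rewrite -(expr_le1 (n := 2))//; last exact: cutnorm_ge0.
apply: le_trans (sum_cutnorm r.+1); rewrite big_ord_recr/= lerDr.
by apply: sumr_ge0 => i _; exact: sqr_ge0.
Qed.

(** Maximality of the worst cut concerns sets. Applying [cut_functions] to the deviation and to its
    opposite extends it to the fractional weights that arise in the counting lemma. *)
Lemma cut_step r (u v : V -> R) :
  (forall x, 0 <= u x <= 1) -> (forall x, 0 <= v x <= 1) ->
  `|\sum_x \sum_y (A x y - step r x y) * (u x * v y)| <= cutnorm r * N ^+ 2.
Proof.
move=> u01 v01; rewrite /cutnorm divfK ?gt_eqF// ler_norml.
apply/andP; split.
  rewrite lerNl -sumrN; under eq_bigr do rewrite -sumrN.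
  under eq_bigr do under eq_bigr do rewrite -mulNr.
  apply: cut_functions => // S T.
  apply: le_trans (worstP (bits r) (S, T)).
  rewrite -normrN; apply: le_trans (ler_norm _).
  rewrite /discrepancy -sumrN; apply: ler_sum => x _; rewrite -sumrN.
  by apply: ler_sum => y _; rewrite mulNr.
apply: cut_functions => // S T.
by apply: le_trans (worstP (bits r) (S, T)); exact: ler_norm.
Qed.

End regularity.

(** * Homomorphism densities and the cut norm *)

Section counting.
Variables (R : realFieldType) (V : finType) (k : nat).
Implicit Types (f : {ffun 'I_k -> V}) (i j : 'I_k) (p q : 'I_k * 'I_k).

Definition hom_density (B : V -> V -> R) (S : seq ('I_k * 'I_k)) : R :=
  (\sum_(f : {ffun 'I_k -> V}) \prod_(p <- S) B (f p.1) (f p.2)) / #|V|%:R ^+ k.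

Definition upd f i x : {ffun 'I_k -> V} := [ffun j => if j == i then x else f j].

(** Resampling a coordinate: exchanging [x] with the old value of [f] at [i] is an involution of the
    pairs [(f, x)]. *)
Lemma sum_upd (F : {ffun 'I_k -> V} -> R) i :
  \sum_(f : {ffun 'I_k -> V}) \sum_x F (upd f i x) = #|V|%:R * \sum_(f : {ffun 'I_k -> V}) F f.
Proof.
rewrite pair_big /=.
pose s (q : {ffun 'I_k -> V} * V) := (upd q.1 i q.2, q.1 i).
have sK : involutive s.
  case=> f x; rewrite /s /= ffunE eqxx; congr (_, _).
  by apply/ffunP => j; rewrite !ffunE; case: eqP => [->|].
rewrite (reindex_inj (inv_inj sK)) /=.
transitivity (\sum_(q : {ffun 'I_k -> V} * V) F q.1).
  apply: eq_bigr => -[f x] _ /=; congr F.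
  by apply/ffunP => j; rewrite !ffunE; case: eqP => [->|].
rewrite -(pair_bigA _ (fun f (x : V) => F f)) mulr_sumr; apply: eq_bigr => f _ /=.
by rewrite sumr_const -[LHS]mulr_natl.
Qed.

(** No repetition, no loop and never a pair together with its reverse: every factor other than that
    of [(i, j)] then involves at most one of the coordinates [i] and [j]. *)
Definition simple_edges (S : seq ('I_k * 'I_k)) : bool :=
  uniq S && all (fun p => (p.1 < p.2)%N) S.

(** With all coordinates except [i] and [j] fixed, the weights split into a function of the value at
    [i] times a function of the value at [j], and the hypothesis on [D] applies. *)
Lemma weighted_cut (D : V -> V -> R) (c : R) p (Q : seq ('I_k * 'I_k))
    (M : 'I_k * 'I_k -> V -> V -> R) :
  (forall u v : V -> R, (forall x, 0 <= u x <= 1) -> (forall x, 0 <= v x <= 1) ->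
     `|\sum_x \sum_y D x y * (u x * v y)| <= c * #|V|%:R ^+ 2) ->
  (forall q x y, 0 <= M q x y <= 1) -> simple_edges (p :: Q) ->
  `|\sum_(f : {ffun 'I_k -> V}) D (f p.1) (f p.2) * \prod_(q <- Q) M q (f q.1) (f q.2)|
  <= c * #|V|%:R ^+ k.
Proof.
move=> Dc M01; case: p => i j /andP[/= /andP[pQ uQ] /andP[/= ij aQ]].
have [V0|V0] := posnP #|V|.
  rewrite big1 ?normr0 => [|f _]; last by have := card0_eq V0 (f i); rewrite !inE.
  by rewrite V0 expr0n (gtn_eqF (leq_ltn_trans (leq0n _) (ltn_ord i))) mulr0.
have N0 : 0 < #|V|%:R :> R by rewrite ltr0n.
set F := (F in \sum_(f : {ffun 'I_k -> V}) F f).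
suff : `|#|V|%:R ^+ 2 * \sum_(f : {ffun 'I_k -> V}) F f| <= #|V|%:R ^+ 2 * (c * #|V|%:R ^+ k).
  by rewrite normrM ger0_norm ?exprn_ge0// ler_pM2l// exprn_gt0.
(* The two factors [#|V|] pay for resampling the coordinates [j] and [i]. *)
rewrite expr2 -mulrA -(sum_upd F j) -(sum_upd _ i).
apply: le_trans (ler_norm_sum _ _ _) _.
apply: (@le_trans _ _ (\sum_(f : {ffun 'I_k -> V}) c * #|V|%:R ^+ 2)); last first.
  rewrite sumr_const card_ffun card_ord -[leLHS]mulr_natr natrX.
  by rewrite le_eqVlt; apply/orP; left; apply/eqP; ring.
apply: ler_sum => f _.
pose P01 := fun t : R => 0 <= t <= 1.
have prod01 (J : seq ('I_k * 'I_k)) C g : (forall q, P01 (g q)) ->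
    P01 (\prod_(q <- J | C q) g q).
  move=> g01; elim: J => [|q J IH]; first by rewrite big_nil /P01 ler01 lexx.
  rewrite big_cons; case: (C q) => //; have := g01 q; move: IH; rewrite /P01.
  by move=> /andP[u0 u1] /andP[v0 v1]; rewrite mulr_ge0// mulr_ile1.
(* Factors touching [j] go to [v]; all others go to [u], including those that touch neither [i] nor
   [j]. *)
pose hit q := (q.1 == j) || (q.2 == j).
pose u x := \prod_(q <- Q | ~~ hit q) M q (upd f i x q.1) (upd f i x q.2).
pose v y := \prod_(q <- Q | hit q) M q (upd f j y q.1) (upd f j y q.2).
have -> : \sum_x \sum_y F (upd (upd f i x) j y) = \sum_x \sum_y D x y * (u x * v y).
  apply: eq_bigr => x _; apply: eq_bigr => y _; rewrite /F /= !ffunE eqxx.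
  have -> : (i == j) = false by apply/negbTE; rewrite neq_ltn ij.
  rewrite eqxx; congr (_ * _); rewrite (bigID hit) [LHS]mulrC /=; congr (_ * _).
    apply: eq_bigr => q; rewrite {1}/hit negb_or => /andP[q1 q2].
    by rewrite [upd _ j _ _]ffunE (negbTE q1) [upd _ j _ q.2]ffunE (negbTE q2).
  rewrite big_seq_cond [RHS]big_seq_cond; apply: eq_bigr => q /andP[qQ hq].
  (* A factor touching both [i] and [j] would be the pair [(i, j)], which is not in [Q], or its
     reverse, which is not increasing. *)
  suff /andP[n1 n2] : (q.1 != i) && (q.2 != i).
    by rewrite !ffunE (negbTE n1) (negbTE n2).
  have q12 := allP aQ _ qQ; case/orP: hq => /eqP e; rewrite ?e.
    have ji : j != i by rewrite neq_ltn ij orbT.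
    rewrite ji /=; apply: contraTneq q12 => e2; rewrite e e2 -leqNgt; exact: ltnW.
  have ji : j != i by rewrite neq_ltn ij orbT.
  rewrite ji andbT; apply: contraNneq pQ => e1.
  by case: q e e1 qQ {q12} => a b /= -> ->.
by apply: Dc => x; apply: prod01 => q; exact: M01.
Qed.

(** A hybrid argument: [A] is exchanged for [B] one edge at a time, each time at cost [c]. *)
Lemma counting_lemma (A B : V -> V -> R) (c : R) (S : seq ('I_k * 'I_k)) :
  (0 < #|V|)%N ->
  (forall x y, 0 <= A x y <= 1) -> (forall x y, 0 <= B x y <= 1) ->
  (forall u v : V -> R, (forall x, 0 <= u x <= 1) -> (forall x, 0 <= v x <= 1) ->
     `|\sum_x \sum_y (A x y - B x y) * (u x * v y)| <= c * #|V|%:R ^+ 2) ->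
  simple_edges S -> `|hom_density A S - hom_density B S| <= (size S)%:R * c.
Proof.
move=> V0 A01 B01 ABc.
have N0 : 0 < #|V|%:R ^+ k :> R by rewrite exprn_gt0// ltr0n.
(* The weights [M] stand for the edges already treated; they may mix [A] and [B], which makes the
   induction go through. *)
suff gen S' Q (M : 'I_k * 'I_k -> V -> V -> R) :
    (forall q x y, 0 <= M q x y <= 1) -> simple_edges (S' ++ Q) ->
    `|\sum_(f : {ffun 'I_k -> V}) (\prod_(p <- S') A (f p.1) (f p.2) - \prod_(p <- S') B (f p.1) (f p.2))
       * \prod_(q <- Q) M q (f q.1) (f q.2)| <= (size S')%:R * c * #|V|%:R ^+ k.
  move=> sS; rewrite /hom_density -mulrBl normrM [X in _ * X]gtr0_norm ?invr_gt0//.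
  rewrite ler_pdivrMr// -sumrB.
  have := gen S [::] (fun _ => A) (fun _ => A01); rewrite cats0 => /(_ sS).
  by under eq_bigr do rewrite big_nil mulr1.
elim: S' Q M => [|p S' IH] Q M M01 sSQ.
  rewrite big1 ?normr0 => [|f _]; last by rewrite !big_nil subrr mul0r.
  by rewrite !mul0r.
(* The splitting is [A A' - B B' = (A - B) A' + B (A' - B')]: the first term has the weight [A] on
   [S'], the second the weight [B] on [p]. *)
pose M1 q := if q \in S' then A else M q.
pose M2 q := if q == p then B else M q.
have M101 q x y : 0 <= M1 q x y <= 1 by rewrite /M1; case: ifP.
have M201 q x y : 0 <= M2 q x y <= 1 by rewrite /M2; case: ifP.
have [uSQ aSQ] := andP sSQ.
have uS : uniq (S' ++ Q) by case/andP: uSQ.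
have pQ : p \notin Q by move: uSQ; rewrite /= mem_cat negb_or => /andP[/andP[]].
have dSQ q : q \in Q -> q \notin S'.
  by move: uS; rewrite cat_uniq => /and3P[_ /hasPn h _]; exact: h.
have s2 : simple_edges (S' ++ p :: Q).
  rewrite /simple_edges (perm_uniq (_ : perm_eq _ ((p :: S') ++ Q))).
    by rewrite uSQ; move: aSQ; rewrite /= !all_cat /= => /and3P[-> -> ->].
  by rewrite -cat1s perm_catCA.
have := IH (p :: Q) M2 M201 s2.
have := @weighted_cut (fun x y => A x y - B x y) c p (S' ++ Q) M1 ABc M101 sSQ.
set X := \sum_(f : {ffun 'I_k -> V}) _; set Y := \sum_(f : {ffun 'I_k -> V}) _.
set Z := \sum_(f : {ffun 'I_k -> V}) _.
have -> : Z = X + Y.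
  rewrite /X /Y /Z -big_split; apply: eq_bigr => f _ /=.
  rewrite !big_cons big_cat /= (_ : M2 p = B); last by rewrite /M2 eqxx.
  have -> : \prod_(q <- S') M1 q (f q.1) (f q.2) = \prod_(q <- S') A (f q.1) (f q.2).
    by apply: eq_big_seq => q qS; rewrite /M1 qS.
  have -> : \prod_(q <- Q) M1 q (f q.1) (f q.2) = \prod_(q <- Q) M q (f q.1) (f q.2).
    by apply: eq_big_seq => q qS; rewrite /M1 (negbTE (dSQ _ qS)).
  have -> : \prod_(q <- Q) M2 q (f q.1) (f q.2) = \prod_(q <- Q) M q (f q.1) (f q.2).
    apply: eq_big_seq => q qS; rewrite /M2; case: eqP => // e.
    by move: qS; rewrite e (negbTE pQ).
  ring.
move=> hX hY; apply: le_trans (ler_normD _ _) _.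
have -> : (size (p :: S'))%:R * c * #|V|%:R ^+ k =
  c * #|V|%:R ^+ k + (size S')%:R * c * #|V|%:R ^+ k.
  by rewrite /= -natr1; ring.
exact: lerD.
Qed.

End counting.

Local Open Scope classical_set_scope.
Local Open Scope ring_scope.

(** * Expectations of bounded functions *)

Section expectation_of_bounded_functions.
Context {R : realType} d (T : measurableType d) (P : probability T R).
Implicit Types f g : T -> R.

(** A class closed under the operations used, all of whose members are integrable: expectations can
    be computed in [R] without further side conditions. *)
Definition bmeas f := measurable_fun [set: T] f /\ exists M, forall x, `|f x| <= M.

Definition E f : R := \int[P]_x f x.

Lemma bmeas_integrable f : bmeas f -> P.-integrable [set: T] (EFin \o f).
Proof.
move=> [mf [M fM]].
apply: (@le_integrable _ _ _ P setT measurableT _ (EFin \o cst M)).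
- exact/measurable_EFinP.
- by move=> x _ /=; rewrite lee_fin (le_trans (fM x))// ler_norm.
- exact: finite_measure_integrable_cst.
Qed.

Lemma bmeas_cst (c : R) : bmeas (fun=> c).
Proof. by split; [exact: measurable_cst|exists `|c|]. Qed.

Lemma bmeas_indic (A : set T) : measurable A -> bmeas (\1_A : T -> R).
Proof.
move=> mA; split; first exact: measurable_indic.
by exists 1 => x; rewrite indicE; case: (_ \in _); rewrite ?normr1 ?normr0 ?ler01.
Qed.

Lemma bmeasD f g : bmeas f -> bmeas g -> bmeas (fun x => f x + g x).
Proof.
move=> [mf [M fM]] [mg [K gK]]; split; first exact: measurable_funD.
by exists (M + K) => x; rewrite (le_trans (ler_normD _ _))// lerD.
Qed.

Lemma bmeasM f g : bmeas f -> bmeas g -> bmeas (fun x => f x * g x).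
Proof.
move=> [mf [M fM]] [mg [K gK]]; split; first exact: measurable_funM.
by exists (M * K) => x; rewrite normrM ler_pM.
Qed.

Lemma bmeasB f g : bmeas f -> bmeas g -> bmeas (fun x => f x - g x).
Proof.
move=> bf bg; have := bmeasD bf (bmeasM (bmeas_cst (-1)) bg).
by under [X in bmeas X -> _]eq_fun do rewrite mulN1r.
Qed.

Lemma bmeas_norm f : bmeas f -> bmeas (fun x => `|f x|).
Proof.
move=> [mf [M fM]]; split; first exact: (measurableT_comp (@normr_measurable _ setT)).
by exists M => x; rewrite normr_id.
Qed.

Lemma bmeas_sqr f : bmeas f -> bmeas (fun x => f x ^+ 2).
Proof.
by move=> bf; under eq_fun do rewrite expr2; exact: bmeasM.
Qed.

Lemma bmeas_sum (I : Type) (s : seq I) (f : I -> T -> R) :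
  (forall i, bmeas (f i)) -> bmeas (fun x => \sum_(i <- s) f i x).
Proof.
move=> bf; elim: s => [|i s IH]; first by under eq_fun do rewrite big_nil; exact: bmeas_cst.
by under eq_fun do rewrite big_cons; exact: bmeasD.
Qed.

Lemma bmeas_prod (I : Type) (s : seq I) (f : I -> T -> R) :
  (forall i, bmeas (f i)) -> bmeas (fun x => \prod_(i <- s) f i x).
Proof.
move=> bf; elim: s => [|i s IH]; first by under eq_fun do rewrite big_nil; exact: bmeas_cst.
by under eq_fun do rewrite big_cons; exact: bmeasM.
Qed.

Lemma E_cst c : E (fun=> c) = c.
Proof.
rewrite /E Rintegral_cst// [X in fine X](_ : _ = 1%E) ?mulr1//.
exact: probability_setT.
Qed.

Lemma E_indic (A : set T) : measurable A -> E \1_A = fine (P A).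
Proof. by move=> mA; rewrite /E /Rintegral integral_indic// setIT. Qed.

Lemma ED f g : bmeas f -> bmeas g -> E (fun x => f x + g x) = E f + E g.
Proof. by move=> bf bg; rewrite /E RintegralD//; exact: bmeas_integrable. Qed.

Lemma EB f g : bmeas f -> bmeas g -> E (fun x => f x - g x) = E f - E g.
Proof. by move=> bf bg; rewrite /E RintegralB//; exact: bmeas_integrable. Qed.

Lemma EZ c f : bmeas f -> E (fun x => c * f x) = c * E f.
Proof. by move=> bf; rewrite /E RintegralZl//; exact: bmeas_integrable. Qed.

Lemma E_sum (I : Type) (s : seq I) (f : I -> T -> R) :
  (forall i, bmeas (f i)) -> E (fun x => \sum_(i <- s) f i x) = \sum_(i <- s) E (f i).
Proof.
move=> bf; elim: s => [|i s IH].
  by rewrite big_nil; under eq_fun do rewrite big_nil; exact: E_cst.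
rewrite big_cons; under eq_fun do rewrite big_cons.
by rewrite ED// ?IH//; exact: bmeas_sum.
Qed.

Lemma E_le f g : bmeas f -> bmeas g -> (forall x, f x <= g x) -> E f <= E g.
Proof.
by move=> bf bg fg; apply: le_Rintegral => //; exact: bmeas_integrable.
Qed.

Lemma E_ge0 f : (forall x, 0 <= f x) -> 0 <= E f.
Proof. by move=> f0; apply: Rintegral_ge0. Qed.

Lemma E_EFin f : bmeas f -> (\int[P]_x (f x)%:E = (E f)%:E)%E.
Proof.
move=> bf; rewrite /E /Rintegral fineK//.
by apply: integrable_fin_num => //; exact: bmeas_integrable.
Qed.

Lemma E_ae_eq f g : bmeas f -> bmeas g -> (\forall x \ae P, f x = g x) -> E f = E g.
Proof.
move=> [mf _] [mg _] fg; rewrite /E /Rintegral; congr fine.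
apply: ae_eq_integral => //; [exact/measurable_EFinP|exact/measurable_EFinP|].
by apply: filterS fg => x /= ->.
Qed.

Lemma E_eq0_ae f : bmeas f -> (forall x, 0 <= f x) -> E f = 0 ->
  \forall x \ae P, f x = 0.
Proof.
move=> bf f0 Ef; have [mf _] := bf.
have /ae_eq_integral_abs : measurable_fun setT (EFin \o f) by exact/measurable_EFinP.
move=> /(_ P measurableT)[+ _].
have -> : (\int[P]_x `|(EFin \o f) x| = 0)%E.
  by under eq_integral do rewrite /= ger0_norm//; rewrite E_EFin// Ef.
by move=> /(_ erefl); apply: filterS => x /= /(_ I)[].
Qed.

Lemma E_cvg (f_ : nat -> T -> R) f (M : R) :
  (forall n, measurable_fun setT (f_ n)) -> measurable_fun setT f ->
  (forall n x, `|f_ n x| <= M) ->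
  (\forall x \ae P, f_ n x @[n --> \oo] --> f x) ->
  E (f_ n) @[n --> \oo] --> E f.
Proof.
move=> mf_ mf fM cf.
have := @dominated_convergence _ _ _ P setT measurableT
  (fun n => EFin \o f_ n) (EFin \o f) (EFin \o cst M).
case => //.
- by move=> n; exact/measurable_EFinP.
- exact/measurable_EFinP.
- by apply: filterS cf => x cx _; apply: cvg_EFin => //; exact: nearW.
- exact: finite_measure_integrable_cst.
- by apply: aeW => x n _ /=; rewrite lee_fin.
move=> If _ cI; rewrite /E /Rintegral.
by apply: fine_cvg; rewrite fineK//; exact: integrable_fin_num.
Qed.

(* AM-GM turns the square-summability with a geometric rate into the absolute
   summability of the expectations: [2 |x| <= 2^j x^2 + 2^-j]. *)
Lemma ae_summable (X : nat -> T -> R) (C : R) :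
  (forall j, bmeas (X j)) ->
  (forall j, E (fun x => X j x ^+ 2) <= C * 4^-1 ^+ j) ->
  \forall x \ae P, cvgn (series (fun j => `|X j x|)).
Proof.
move=> bX EX.
have bn j := bmeas_norm (bX j).
have C0 : 0 <= C.
  have := EX 0; rewrite expr0 mulr1; apply: le_trans.
  by apply: E_ge0 => x; exact: sqr_ge0.
have hj j : E (fun x => `|X j x|) <= (C + 1) * 2^-1 ^+ j.
  have p2 : 0 < 2 ^+ j :> R by rewrite exprn_gt0.
  have h2 : 2^-1 ^+ j = (2 ^+ j)^-1 :> R by rewrite exprVn.
  have b2 := bmeas_sqr (bX j).
  have bb : bmeas (fun x => 2 ^+ j * X j x ^+ 2).
    by apply: bmeasM => //; exact: bmeas_cst.
  apply: (@le_trans _ _ (E (fun x => 2 ^+ j * X j x ^+ 2 + 2^-1 ^+ j))).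
    apply: E_le; [exact: bn|apply: bmeasD; [exact: bb|exact: bmeas_cst]|].
    move=> x; rewrite -(real_normK (num_real (X j x))) h2.
    set a := `|_|; set b := _ ^+ j.
    have := sqr_ge0 (b * a - 1); have a0 : 0 <= a by exact: normr_ge0.
    rewrite -subr_ge0 => h; rewrite -(ler_pM2l p2) -/b mulrDr divff ?gt_eqF//.
    have ba : 0 <= b * a by rewrite mulr_ge0// ltW.
    nra.
  rewrite ED ?EZ ?E_cst//; last exact: bmeas_cst.
  rewrite mulrDl mul1r lerD2r.
  apply: (@le_trans _ _ (2 ^+ j * (C * 4^-1 ^+ j))); first by rewrite ler_pM2l.
  rewrite (_ : 4^-1 = 2^-1 * 2^-1 :> R); last by field.
  rewrite exprMn [leLHS](_ : _ = (2 ^+ j * 2^-1 ^+ j) * (C * 2^-1 ^+ j)); last by ring.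
  by rewrite h2 divff ?gt_eqF// mul1r.
(* By Tonelli this sum has a finite integral, hence is finite almost surely, and it bounds the
   partial sums. *)
pose S x := (\sum_(j <oo) `|X j x|%:E)%E.
have mj j : measurable_fun setT (fun x => `|X j x|%:E).
  by apply/measurable_EFinP; case: (bn j).
have mS : measurable_fun setT S.
  by apply: ge0_emeasurable_sum => // n x _ _; rewrite lee_fin.
have S0 x : (0 <= S x)%E by apply: nneseries_ge0 => n _ _; rewrite lee_fin.
have IS : (\int[P]_x S x < +oo)%E.
  rewrite /S integral_nneseries//.
  apply: (@le_lt_trans _ _ (\sum_(j <oo) ((C + 1) * 2^-1 ^+ j)%:E)%E).
    apply: lee_nneseries => [j _ _|j _]; first by apply: integral_ge0 => x _; rewrite lee_fin.
    by rewrite E_EFin// lee_fin.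
  rewrite (_ : (\sum_(j <oo) _)%E = (limn (series (geometric (C + 1) (2^-1 : R))))%:E); first by rewrite ltry.
  rewrite -EFin_lim; last by apply: is_cvg_geometric_series; rewrite ger0_norm ?invr_ge0// invf_lt1// ltr1n.
  congr (limn _); apply/funext => n; rewrite /= /series/= -sumEFin//.
have iS : P.-integrable setT S.
  apply/integrableP; split => //; under eq_integral do rewrite gee0_abs//.
  exact: IS.
have := integrable_ae measurableT iS.
apply: filterS => x /(_ I) Sx.
apply: nondecreasing_is_cvgn.
  by apply: nondecreasing_series => n _ _.
exists (fine (S x)) => _ [n _ <-].
rewrite -lee_fin fineK// /S /series/= -sumEFin.
by apply: nneseries_lim_ge => j _ _; rewrite lee_fin.
Qed.

Lemma ae_cvg0 (X : nat -> T -> R) (C : R) :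
  (forall j, bmeas (X j)) ->
  (forall j, E (fun x => X j x ^+ 2) <= C * 4^-1 ^+ j) ->
  \forall x \ae P, X j x @[j --> \oo] --> 0.
Proof.
move=> bX EX; have := ae_summable bX EX; apply: filterS => x cx.
by apply/norm_cvg0P; exact: cvg_series_cvg_0.
Qed.

Lemma ae_cvg (Y : nat -> T -> R) (C : R) :
  (forall j, bmeas (Y j)) ->
  (forall j, E (fun x => (Y j.+1 x - Y j x) ^+ 2) <= C * 4^-1 ^+ j) ->
  \forall x \ae P, cvgn (Y ^~ x).
Proof.
move=> bY EY.
have bX j : bmeas (fun x => Y j.+1 x - Y j x) by exact: bmeasB.
have := ae_summable bX EY; apply: filterS => x cx.
have := normed_cvg cx; set u := series _ => cu.
have -> : Y ^~ x = fun n => u n + Y 0 x.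
  by apply/funext => n; rewrite /u /series/= telescope_sumr// subrK.
by apply: is_cvgD => //; exact: is_cvg_cst.
Qed.

End expectation_of_bounded_functions.

Lemma ae_exists {R : realType} d (T : measurableType d) (P : probability T R)
    (Q : T -> Prop) : (\forall x \ae P, Q x) -> exists x, Q x.
Proof.
move=> aeQ; apply: contrapT => nQ.
have [A [mA A0 sA]] := aeQ.
have : P setT = 0%E.
  apply/eqP; rewrite -measure_le0 -A0; apply: le_measure; rewrite ?inE//.
  by move=> x _; apply: sA => /= Qx; apply: nQ; exists x.
by rewrite probability_setT => /eqP; rewrite onee_eq0.
Qed.

Lemma ae_forall_countable {R : realType} d (T : measurableType d) (P : probability T R)
    (I : countType) (Q : I -> T -> Prop) :
  (forall i, \forall x \ae P, Q i x) -> \forall x \ae P, forall i, Q i x.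
Proof.
move=> aeQ.
have : \forall x \ae P, forall n : nat, if choice.unpickle n is Some i then Q i x else True.
  apply: ae_foralln => n; case: choice.unpickle => [i|]; [exact: aeQ|exact: aeW].
by apply: filterS => x h i; have := h (choice.pickle i); rewrite choice.pickleK.
Qed.


(** * Upper limits as measurable functions defined everywhere *)

Section limn_sup_of_bounded_functions.
Context {R : realType}.

Lemma bounded_fun01 (u : nat -> R) : (forall n, 0 <= u n <= 1) -> bounded_fun (u : R^o^nat).
Proof.
move=> u01; exists 1; split; first by rewrite num_real.
move=> M M1 n _ /=; have /andP[v w] := u01 n.
by rewrite ger0_norm// (le_trans w)// ltW.
Qed.

Lemma limn_sup01 (u : nat -> R) : (forall n, 0 <= u n <= 1) -> 0 <= limn_sup u <= 1.
Proof.
move=> u01; rewrite limn_supE; last exact: bounded_fun01.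
have s01 n : 0 <= sups u n <= 1.
  have ub : ubound (sdrop u n) 1 by move=> _ [i _ <-]; case/andP: (u01 i).
  have un : sdrop u n (u n) by exists n => /=.
  apply/andP; split; last by apply: ge_sup => //; exists (u n).
  apply: (@le_trans _ _ (u n)); first by case/andP: (u01 n).
  by apply: ub_le_sup => //; exists 1.
have ne : range (sups u) !=set0 by exists (sups u 0); exists 0.
have lb : lbound (range (sups u)) 0 by move=> _ [n _ <-]; case/andP: (s01 n).
apply/andP; split; first exact: lb_le_inf.
apply: (@le_trans _ _ (sups u 0)); last by case/andP: (s01 0).
by apply: ge_inf; [exists 0|exists 0].
Qed.

Lemma measurable_limn_sup01 d (T : measurableType d) (f : nat -> T -> R) :
  (forall n, measurable_fun setT (f n)) -> (forall n x, 0 <= f n x <= 1) ->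
  measurable_fun setT (fun x => limn_sup (f ^~ x)).
Proof.
move=> mf f01; apply: measurable_fun_limn_sup => // [x _|x _].
- by exists 1 => _ [n _ <-]; case/andP: (f01 n x).
- by exists 0 => _ [n _ <-]; case/andP: (f01 n x).
Qed.

End limn_sup_of_bounded_functions.

(** * Densities in a typical graph *)

Section borel_structure.

(** Only present edges are prescribed, which makes these events closed under intersection; absent
    edges come from complements. *)
Definition present (S : seq (nat * nat)) : set borel_graph :=
  [set G | all (fun p => edge G p.1 p.2) S].

(** The values lie in a countable type, so that an open set will be a countable union of
    cylinders. *)
Definition window (n : nat) (G : graph) : seq bool :=
  [seq edge G p.1 p.2 | p <- allpairs pair (iota 0 n) (iota 0 n)].

Lemma window_eq n (G H : graph) i j : (i < n)%N -> (j < n)%N ->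
  window n G = window n H -> edge G i j = edge H i j.
Proof.
move=> ni nj /eq_in_map/(_ (i, j)); apply.
by apply/allpairsP; exists (i, j); rewrite !mem_iota.
Qed.

Lemma edge_continuous i j : continuous (fun G : graph => edge G i j).
Proof.
move=> G; apply: (@continuous_comp _ {ptws nat * nat -> bool} _ (set_val : graph -> _)
  (fun a => a (i, j))).
- exact: initial_continuous.
- exact: (@proj_continuous _ (fun=> bool) (i, j)).
Qed.

Lemma open_edge i j b : open [set G : graph | edge G i j = b].
Proof.
have /continuousP/(_ [set b]) : continuous (fun G : graph => edge G i j).
  exact: edge_continuous.
by apply; exact: discrete_open.
Qed.

Lemma measurable_edge i j b : measurable [set G : borel_graph | edge G i j = b].
Proof. by apply: sub_sigma_algebra; exact: open_edge. Qed.

Lemma measurable_present S : measurable (present S).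
Proof.
elim: S => [|p S IH]; first by rewrite (_ : present _ = setT)// -subTset.
rewrite (_ : present _ = [set G | edge G p.1 p.2 = true] `&` present S).
  by apply: measurableI => //; exact: measurable_edge.
by rewrite /present; apply/seteqP; split=> G /= => [/andP[-> ->]|[-> ->]].
Qed.

Lemma presentI S S' : present S `&` present S' = present (S ++ S').
Proof.
by rewrite /present; apply/seteqP; split=> G /=; rewrite all_cat => /andP.
Qed.

(** Otherwise there are graphs outside [U] that agree with [G] on larger and larger windows; they
    converge to [G] entry by entry, against openness. *)
Lemma open_window (U : set graph) (G : graph) : open U -> U G ->
  exists n, [set H | window n H = window n G] `<=` U.
Proof.
move=> [W oW <-] WG; apply: contrapT => no.
have bad n : exists H, window n H = window n G /\ ~ W (set_val H).
  apply: contrapT => h; apply: no; exists n => H /= e.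
  by apply: contrapT => nW; apply: h; exists H.
have [H HP] := choice bad.
have : (set_val \o H) @ \oo --> (set_val G : {ptws nat * nat -> bool}).
  apply/(@pointwise_cvgP _ bool) => -[i j] A /nbhs_singleton Ab.
  have : \forall n \near \oo, A (set_val (H n) (i, j)).
    near=> n; suff e : edge (H n) i j = edge G i j.
      by rewrite -[set_val _ _]/(edge (H n) i j) e.
    by apply: window_eq (proj1 (HP n)); near: n; exact: nbhs_infty_gt.
  by [].
move=> /(_ W); rewrite nbhsE /=.
case; first by exists W.
by move=> n _ /(_ n (leqnn n)); have [] := HP n.
Unshelve. all: end_near. Qed.

Local Notation edge_algebra := (g_sigma_algebraType (range present)).

Let measurable_edge_algebra i j b :
  measurable [set G : edge_algebra | edge G i j = b].
Proof.
have m : measurable [set G : edge_algebra | edge G i j = true].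
  apply: sub_sigma_algebra; exists [:: (i, j)] => //.
  by apply/seteqP; split=> G; rewrite /present /= andbT.
case: b => //; rewrite (_ : [set _ | _] = ~` [set G : edge_algebra | edge G i j = true]).
  exact: measurableC.
by apply/seteqP; split=> G /=; case: edge.
Qed.

(** Every open set is the union of the window cylinders that it contains, and these are countably
    many. *)
Lemma borel_graph_present : @measurable _ borel_graph = <<s range present >>.
Proof.
apply/seteqP; split; last first.
  apply: smallest_sub; first exact: sigma_algebra_measurable.
  by move=> _ [S _ <-]; exact: measurable_present.
apply: smallest_sub; first exact: smallest_sigma_algebra.
move=> U oU.
(* The second condition does not depend on [H]: each [F c] is a whole cylinder or empty. *)
pose F (c : nat * seq bool) : set edge_algebra :=
  [set H | window c.1 H = c.2 /\ [set H' | window c.1 H' = c.2] `<=` U].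
have -> : U = \bigcup_c F c.
  apply/seteqP; split=> [G UG|G [c _ [/= e]]]; last by apply.
  have [n nU] := open_window oU UG.
  by exists (n, window n G).
suff : measurable (\bigcup_c F c : set edge_algebra) by [].
apply: countable_bigcupT_measurable => // -[n c].
have [cU|ncU] := pselect ([set H' | window n H' = c] `<=` U); last first.
  rewrite (_ : F _ = set0); first exact: measurable0.
  by apply/seteqP; split=> // H [].
rewrite (_ : F _ = [set H | window n H = c]); last by apply/seteqP; split=> // H [].
rewrite /window; elim: (allpairs _ _ _) c {cU} => [|p s IH] [|b c].
- by rewrite (_ : [set _ | _] = setT) -?subTset.
- by rewrite (_ : [set _ | _] = set0) -?subset0.
- by rewrite (_ : [set _ | _] = set0) -?subset0.
- rewrite (_ : [set _ | _] = [set H : edge_algebra | edge H p.1 p.2 = b] `&`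
     [set H | [seq edge H q.1 q.2 | q <- s] = c]); first exact: measurableI.
  by apply/seteqP; split=> H /= => [[-> ->]|[-> ->]].
Qed.

Lemma measurable_to_borel_graph d (T : measurableType d) (f : T -> borel_graph) :
  (forall i j, measurable [set t | edge (f t) i j]) -> measurable_fun setT f.
Proof.
move=> mf; apply: measurability borel_graph_present _ => _ [_ [S _ <-] <-].
rewrite setTI; elim: S => [|p S IH]; first by rewrite (_ : _ @^-1` _ = setT)// -subTset.
rewrite (_ : _ @^-1` _ = [set t | edge (f t) p.1 p.2] `&` (f @^-1` present S)).
  exact: measurableI.
by rewrite /present; apply/seteqP; split=> t /= => [/andP[-> ->]|[-> ->]].
Qed.

Lemma borel_graph_measure_unique (R : realType) (P Q : probability borel_graph R) :
  (forall S, P (present S) = Q (present S)) ->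
  forall A, measurable A -> P A = Q A.
Proof.
move=> PQ A mA.
apply: (measure_unique (range present) (fun=> present [::])) => //.
- exact: borel_graph_present.
- by move=> _ _ [S _ <-] [S' _ <-]; rewrite presentI; exists (S ++ S').
- by apply/seteqP; split=> // G _; exists 0.
- by move=> _ [S _ <-]; exact: PQ.
- by move=> _; rewrite (le_lt_trans (probability_le1 _ (measurable_present _)))// ltry.
Qed.

Lemma measurable_relabel s : measurable_fun [set: borel_graph] (relabel s : borel_graph -> borel_graph).
Proof.
by apply: measurable_to_borel_graph => i j; exact: (measurable_edge (s i) (s j) true).
Qed.

End borel_structure.

(** The bijection found for the tails is followed by the transposition of [s x] and [y], which moves
    no element of [ys]. *)
Lemma extend_to_bijection (xs ys : seq nat) : uniq xs -> uniq ys -> size xs = size ys ->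
  exists2 s : nat -> nat, bijective s & [seq s x | x <- xs] = ys.
Proof.
elim: xs ys => [|x xs IH] [|y ys]//=.
  by exists id => //; exists id.
move=> /andP[xxs uxs] /andP[yys uys] [sz].
have [s [s' sK s'K] sxs] := IH _ uxs uys sz.
pose t z := if z == s x then y else if z == y then s x else z.
have tK : involutive t.
  move=> z; rewrite /t; case: (eqVneq z (s x)) => [->|zsx]; last first.
    case: (eqVneq z y) => [->|zy]; first by rewrite eqxx.
    by rewrite (negbTE zsx) (negbTE zy).
  by rewrite eqxx; case: eqVneq => // ->.
exists (t \o s); first by exists (s' \o t) => z /=; rewrite ?tK ?sK ?s'K.
rewrite /= {1}/t eqxx; congr (_ :: _); rewrite -[RHS]sxs.
apply/eq_in_map => z zxs; rewrite /= /t.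
have -> : (s z == s x) = false.
  by apply/negbTE; apply: contra xxs => /eqP/(can_inj sK) <-.
case: eqP => // e; move: yys; rewrite -sxs -e; by rewrite map_f.
Qed.

(** * Second moments of the sampled densities *)

Section typical_graph.
Context {R : realType} (mu : probability borel_graph R).
Hypothesis mu_invariant : perm_invariant mu.

Definition prob_present (D : seq (nat * nat)) : R := fine (mu (present D)).

Definition relabel_pairs (I : Type) (h : I -> nat) (D : seq (I * I)) : seq (nat * nat) :=
  [seq (h p.1, h p.2) | p <- D].

Lemma prob_present01 D : 0 <= prob_present D <= 1.
Proof.
have m := measurable_present D.
rewrite /prob_present -!lee_fin fineK ?fin_num_measure//.
by rewrite measure_ge0 probability_le1.
Qed.

(** Two injective placements of a finite pattern differ by a permutation of [nat], under which [mu]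
    is invariant. *)
Lemma prob_present_relabel (I : finType) (h h' : I -> nat) (D : seq (I * I)) :
  injective h -> injective h' ->
  prob_present (relabel_pairs h D) = prob_present (relabel_pairs h' D).
Proof.
move=> hi h'i.
have [||//|s bs hs] := @extend_to_bijection [seq h i | i <- enum I] [seq h' i | i <- enum I].
- by rewrite map_inj_uniq ?enum_uniq.
- by rewrite map_inj_uniq ?enum_uniq.
- by rewrite !size_map.
have shi i : s (h i) = h' i.
  move: hs; rewrite -map_comp => /eq_in_map/(_ i); apply; exact: mem_enum.
rewrite /prob_present -(mu_invariant bs) //; last exact: measurable_present.
congr (fine (mu _)); apply/funext => G; apply/propext.
rewrite /present /preimage /= /relabel_pairs !all_map.
by under eq_all => p do rewrite /= /relabel {1}/edge set_valE /= !shi.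
Qed.

Section sampling.
Variables (k : nat).
Local Notation ord := ('I_k).

(** The enumeration [a] serves the proof of invariance: for a permutation [s], the density along [s]
    in [G] is the density along the identity in [relabel s G]. *)
Definition sample_density (S : seq (ord * ord)) (n : nat) (a : nat -> nat) (G : graph) : R :=
  hom_density (fun x y : 'I_n => (edge G (a x) (a y))%:R) S.

Lemma sample_density01 S n a G : 0 <= sample_density S n a G <= 1.
Proof.
rewrite /sample_density /hom_density.
have t01 (f : 'I_k -> 'I_n) :
    0 <= \prod_(p <- S) ((edge G (a (f p.1)) (a (f p.2)))%:R : R) <= 1.
  by apply: prod01 => p; case: edge; rewrite lexx ler01.
apply/andP; split.
  by rewrite divr_ge0 ?exprn_ge0//; apply: sumr_ge0 => f _; case/andP: (t01 f).
have [e|e] := eqVneq ((#|'I_n|%:R : R) ^+ k) 0; first by rewrite e invr0 mulr0.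
rewrite ler_pdivrMr; last by rewrite lt_neqAle eq_sym e exprn_ge0.
rewrite mul1r (@le_trans _ _ (\sum_(f : {ffun ord -> 'I_n}) 1))//.
  by apply: ler_sum => f _; case/andP: (t01 f).
by rewrite sumr_const card_ffun card_ord natrX (card_ord k).
Qed.

Lemma prod_edges (S : seq (nat * nat)) G :
  \prod_(p <- S) (edge G p.1 p.2)%:R = \1_(present S) G :> R.
Proof.
rewrite indicE /=; have -> : (G \in present S) = all (fun p => edge G p.1 p.2) S.
  by apply/idP/idP; rewrite inE.
elim: S => [|p S IH]; first by rewrite big_nil.
by rewrite big_cons IH /= -mulnb natrM.
Qed.

Lemma sample_densityE S n a G : sample_density S n a G =
  (\sum_(f : {ffun ord -> 'I_n}) \1_(present (relabel_pairs (fun i => a (f i)) S)) G) / n%:R ^+ k.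
Proof.
rewrite /sample_density /hom_density card_ord; congr (_ / _).
by apply: eq_bigr => f _; rewrite -prod_edges big_map.
Qed.

Lemma bmeas_sample_density S n a : bmeas (sample_density S n a : borel_graph -> R).
Proof.
split; last by exists 1 => G; have /andP[u v] := sample_density01 S n a G; rewrite ger0_norm.
rewrite (funext (sample_densityE S n a)).
apply: measurable_funM; last exact: measurable_cst.
have [] := @bmeas_sum R _ borel_graph _ (index_enum {ffun ord -> 'I_n})
  (fun f => \1_(present (relabel_pairs (fun i => a (f i)) S))) => // f.
by apply: bmeas_indic; exact: measurable_present.
Qed.

Variables (S1 S2 : seq (ord * ord)) (n m n0 : nat) (a b : nat -> nat).
Hypotheses (n0_gt0 : (0 < n0)%N) (n0n : (n0 <= n)%N) (n0m : (n0 <= m)%N).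
Hypotheses (a_inj : injective a) (b_inj : injective b).

(** The two patterns are placed on the disjoint vertex sets below [k] and from [k] to
    [k + k - 1]. *)
Let h0 (i : ord + ord) : nat := match i with inl i => i | inr i => (k + i)%N end.
Let D : seq ((ord + ord) * (ord + ord)) :=
  [seq (inl p.1, inl p.2) | p <- S1] ++ [seq (inr p.1, inr p.2) | p <- S2].
Let hfg (f : {ffun ord -> 'I_n}) (g : {ffun ord -> 'I_m}) (i : ord + ord) : nat :=
  match i with inl i => a (f i) | inr i => b (g i) end.

Definition joint_prob : R := prob_present (relabel_pairs h0 D).

Let h0_inj : injective h0.
Proof.
case=> i [] j /= e; try by congr (_ _); apply/val_inj => /=; lia.
- by have := ltn_ord i; lia.
- by have := ltn_ord j; lia.
Qed.

(** The number of coincidences among the sampled vertices: inside the first sample, inside the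
    second, and between the two. *)
Let coll (f : {ffun ord -> 'I_n}) (g : {ffun ord -> 'I_m}) : R :=
  \sum_i \sum_j ((i != j) && (f i == f j))%:R
  + \sum_i \sum_j ((i != j) && (g i == g j))%:R
  + \sum_i \sum_j (a (f i) == b (g j))%:R.

(** Without a coincidence the placement is injective and invariance gives equality; with one, the
    difference of two probabilities is at most 1, hence at most the number of coincidences. *)
Let coll_bound f g :
  `|prob_present (relabel_pairs (hfg f g) D) - joint_prob| <= coll f g.
Proof.
have [i|] := boolP (injectiveb (hfg f g)).
  rewrite /joint_prob (prob_present_relabel D (injectiveP _ i) h0_inj) subrr normr0.
  by rewrite /coll !addr_ge0// !sumr_ge0// => ? _; rewrite sumr_ge0.
move=> /injectivePn[i [j ij e]].
apply: (@le_trans _ _ 1).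
  have /andP[u v] := prob_present01 (relabel_pairs (hfg f g) D).
  have /andP[u' v'] := prob_present01 (relabel_pairs h0 D).
  by rewrite ler_norml /joint_prob; lra.
have pos (I J : finType) (F : I -> J -> bool) : 0 <= \sum_i \sum_j (F i j)%:R :> R.
  by rewrite !sumr_ge0// => ? _; rewrite sumr_ge0.
have one (I J : finType) (F : I -> J -> bool) i' j' : F i' j' ->
    1 <= \sum_i \sum_j (F i j)%:R :> R.
  move=> Fij; rewrite (bigD1 i')//= (bigD1 j')//= Fij -addrA lerDl.
  by rewrite addr_ge0// ?sumr_ge0// => ? _; rewrite sumr_ge0.
rewrite /coll.
set s1 := \sum_i \sum_j _; set s2 := \sum_i \sum_j _; set s3 := \sum_i \sum_j _.
have p1 : 0 <= s1 := pos _ _ (fun i j => (i != j) && (f i == f j)).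
have p2 : 0 <= s2 := pos _ _ (fun i j => (i != j) && (g i == g j)).
have p3 : 0 <= s3 := pos _ _ (fun i j => a (f i) == b (g j)).
case: i j ij e => i [] j ij /= e.
- have : 1 <= s1 by apply: (one _ _ (fun i j => (i != j) && (f i == f j)) i j);
    rewrite (val_inj (a_inj e)) eqxx andbT; apply: contraNneq ij => ->.
  lra.
- have : 1 <= s3 by apply: (one _ _ (fun i j => a (f i) == b (g j)) i j); rewrite e.
  lra.
- have : 1 <= s3 by apply: (one _ _ (fun i j => a (f i) == b (g j)) j i); rewrite e.
  lra.
- have : 1 <= s2 by apply: (one _ _ (fun i j => (i != j) && (g i == g j)) i j);
    rewrite (val_inj (b_inj e)) eqxx andbT; apply: contraNneq ij => ->.
  lra.
Qed.

(** When the coordinate [i] is resampled, exactly one of its [#|V|] values agrees with [f j]. *)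
Let sum_eq_coord (V : finType) (i j : ord) : (0 < #|V|)%N ->
  \sum_(f : {ffun ord -> V}) ((i != j) && (f i == f j))%:R <= #|V|%:R ^+ k / #|V|%:R :> R.
Proof.
move=> V0; rewrite ler_pdivlMr ?ltr0n// mulrC.
case: (eqVneq i j) => [_|ij].
  by rewrite big1 ?mulr0 ?exprn_ge0.
rewrite -(sum_upd _ i) (@le_trans _ _ (\sum_(f : {ffun ord -> V}) 1))//; last first.
  by rewrite sumr_const card_ffun card_ord natrX.
have ji : (j == i) = false by rewrite eq_sym (negbTE ij).
apply: ler_sum => f _; rewrite (bigD1 (f j))//= !ffunE !eqxx ji eqxx.
by rewrite big1 ?addr0// => x xfj; rewrite !ffunE eqxx ji (negbTE xfj).
Qed.

Let sum_fixed_coord (N : nat) (c : nat -> nat) (v : nat) (i : ord) : (0 < N)%N ->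
  injective c ->
  \sum_(f : {ffun ord -> 'I_N}) (c (f i) == v)%:R <= N%:R ^+ k / N%:R :> R.
Proof.
move=> N0 ci; rewrite ler_pdivlMr ?ltr0n// mulrC -{1}(card_ord N).
rewrite -(sum_upd _ i) (@le_trans _ _ (\sum_(f : {ffun ord -> 'I_N}) 1))//; last first.
  by rewrite sumr_const card_ffun !card_ord natrX.
apply: ler_sum => f _; under eq_bigr do rewrite !ffunE eqxx.
have [/existsP[x /eqP xv]|/existsPn no] := boolP [exists x : 'I_N, c x == v].
  rewrite (bigD1 x)//= xv eqxx big1 ?addr0// => y yx.
  by case: eqP => // e; rewrite -xv in e; rewrite (val_inj (ci _ _ e)) eqxx in yx.
by rewrite big1 ?ler01// => x _; rewrite (negbTE (no x)).
Qed.

Let n_gt0 : (0 < n)%N. Proof. exact: leq_trans n0n. Qed.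
Let m_gt0 : (0 < m)%N. Proof. exact: leq_trans n0m. Qed.

(* The error bounds the probability that the sampled vertices are not distinct. *)
Lemma E_sample_density_mul :
  `|E mu (fun G => sample_density S1 n a G * sample_density S2 m b G) - joint_prob|
  <= 3 * k%:R ^+ 2 / n0%:R.
Proof.
have nk : 0 < n%:R ^+ k :> R by rewrite exprn_gt0// ltr0n.
have mk : 0 < m%:R ^+ k :> R by rewrite exprn_gt0// ltr0n.
have -> : E mu (fun G => sample_density S1 n a G * sample_density S2 m b G)
   = (\sum_(f : {ffun ord -> 'I_n}) \sum_(g : {ffun ord -> 'I_m})
      prob_present (relabel_pairs (hfg f g) D)) / (n%:R ^+ k * m%:R ^+ k).
  rewrite [LHS](_ : _ = E mu (fun G : borel_graph => (n%:R ^+ k * m%:R ^+ k)^-1 *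
     \sum_(f : {ffun ord -> 'I_n}) \sum_(g : {ffun ord -> 'I_m})
       \1_(present (relabel_pairs (hfg f g) D)) G)); last first.
    congr (E _ _); apply/funext => G; rewrite !sample_densityE mulrACA -invfM mulrC.
    congr (_ * _); rewrite mulr_suml; apply: eq_bigr => f _.
    rewrite mulr_sumr; apply: eq_bigr => g _.
    rewrite /relabel_pairs /D map_cat -!map_comp -presentI indicI.
    by congr (_ * _).
  have b1 f g : bmeas (\1_(present (relabel_pairs (hfg f g) D)) : borel_graph -> R).
    by apply: bmeas_indic; exact: measurable_present.
  rewrite EZ; last by apply: bmeas_sum => f; apply: bmeas_sum => g.
  rewrite mulrC; congr (_ / _); rewrite E_sum; last by move=> f; exact: bmeas_sum.
  apply: eq_bigr => f _; rewrite E_sum//; apply: eq_bigr => g _.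
  by rewrite E_indic//; exact: measurable_present.
have -> : joint_prob = (\sum_(f : {ffun ord -> 'I_n}) \sum_(g : {ffun ord -> 'I_m})
   joint_prob) / (n%:R ^+ k * m%:R ^+ k).
  rewrite !sumr_const !card_ffun !card_ord -mulrnA -[joint_prob *+ _]mulr_natr natrM !natrX.
  by rewrite (mulrC (m%:R ^+ k)) mulfK// gt_eqF// mulr_gt0.
rewrite -mulrBl -sumrB normrM [X in _ * X]ger0_norm ?invr_ge0 ?mulr_ge0 ?exprn_ge0//.
rewrite ler_pdivrMr ?mulr_gt0//; apply: le_trans (ler_norm_sum _ _ _) _.
apply: (@le_trans _ _ (\sum_(f : {ffun ord -> 'I_n}) \sum_(g : {ffun ord -> 'I_m}) coll f g)).
  apply: ler_sum => f _; rewrite -sumrB; apply: le_trans (ler_norm_sum _ _ _) _.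
  by apply: ler_sum => g _; exact: coll_bound.
(* [W] bounds the number of pairs [(f, g)] with one given coincidence; there are three kinds, each
   with [k ^ 2] pairs of indices. *)
pose W : R := n%:R ^+ k * m%:R ^+ k / n0%:R.
have sumW (F : ord -> ord -> R) : (forall i j, F i j <= W) ->
    \sum_i \sum_j F i j <= k%:R ^+ 2 * W.
  move=> FW; apply: (@le_trans _ _ (\sum_(i : ord) \sum_(j : ord) W)).
    by apply: ler_sum => i _; apply: ler_sum.
  rewrite !sumr_const card_ord -mulrnA -[leLHS]mulr_natl natrM expr2.
  exact: lexx.
have invle N : (n0 <= N)%N -> N%:R^-1 <= n0%:R^-1 :> R.
  by move=> h; rewrite lef_pV2 ?ler_nat// posrE ltr0n// (leq_trans n0_gt0).
have swap (F : {ffun ord -> 'I_n} -> {ffun ord -> 'I_m} -> ord -> ord -> R) :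
  \sum_f \sum_g \sum_i \sum_j F f g i j = \sum_i \sum_j \sum_f \sum_g F f g i j.
  under eq_bigr do rewrite exchange_big.
  rewrite exchange_big; apply: eq_bigr => i _ /=.
  under eq_bigr do rewrite exchange_big.
  by rewrite exchange_big.
rewrite [leRHS](_ : _ = k%:R ^+ 2 * W + k%:R ^+ 2 * W + k%:R ^+ 2 * W); last first.
  by rewrite /W; field; rewrite pnatr_eq0 -lt0n.
rewrite /coll; under eq_bigr do rewrite !big_split/=.
rewrite !big_split/= !swap; apply: lerD; [apply: lerD|]; apply: sumW => i j.
- under eq_bigr do rewrite sumr_const.
  rewrite sumrMnl -[leLHS]mulr_natr card_ffun !card_ord natrX /W mulrAC ler_pM2r//.
  have := @sum_eq_coord 'I_n i j; rewrite card_ord => /(_ n_gt0)/le_trans; apply.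
  by rewrite ler_pM2l// invle.
- apply: (@le_trans _ _ (\sum_(f : {ffun ord -> 'I_n}) (m%:R ^+ k / m%:R))).
    apply: ler_sum => f _; have := @sum_eq_coord 'I_m i j; rewrite card_ord; exact.
  rewrite sumr_const card_ffun !card_ord -[leLHS]mulr_natl natrX /W -mulrA ler_pM2l//.
  by rewrite ler_pM2l// invle.
- rewrite exchange_big/=.
  apply: (@le_trans _ _ (\sum_(g : {ffun ord -> 'I_m}) (n%:R ^+ k / n%:R))).
    by apply: ler_sum => g _; exact: sum_fixed_coord.
  rewrite sumr_const card_ffun !card_ord -[leLHS]mulr_natr natrX /W mulrAC.
  by rewrite ler_pM2l ?mulr_gt0// invle.
Qed.

End sampling.
End typical_graph.

(** * Ergodicity and almost sure convergence *)

Section ergodic.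
Context {R : realType} (mu : probability borel_graph R).
Hypothesis mu_invariant : perm_invariant mu.
Hypothesis mu_ergodic : perm_ergodic mu.

(* A bounded function invariant up to null sets is almost surely its mean:
   ergodicity is only needed for the event that it lies below its mean. *)
Lemma invariant_constant (L : borel_graph -> R) : bmeas L ->
  (forall s, bijective s -> \forall G \ae mu, L (relabel s G) = L G) ->
  \forall G \ae mu, L G = E mu L.
Proof.
move=> bL Linv; set c := E mu L.
pose A : set borel_graph := [set G | L G < c].
have mA : measurable A.
  have := @measurable_fun_ltr _ _ _ setT L (cst c) bL.1 (@measurable_cst _ _ _ _ _ _).
  move=> /(_ measurableT [set true] I); rewrite setTI.
  by rewrite (_ : _ @^-1` _ = A).
have bLc : bmeas (fun G => L G - c) by apply: bmeasB => //; exact: bmeas_cst.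
have E0 : E mu (fun G => L G - c) = 0.
  by rewrite EB//; [rewrite E_cst subrr|exact: bmeas_cst].
(* If [L - c] almost surely has a constant sign [s], the mean of its absolute value is [s] times its
   own mean, which is 0. *)
have conclude (s : R) : (\forall G \ae mu, `|L G - c| = s * (L G - c)) ->
    \forall G \ae mu, L G = c.
  move=> h; have := @E_eq0_ae _ _ _ mu _ (bmeas_norm bLc) (fun G => normr_ge0 _).
  rewrite (E_ae_eq (bmeas_norm bLc) _ h); last first.
    by apply: bmeasM => //; exact: bmeas_cst.
  rewrite EZ// E0 mulr0 => /(_ erefl); apply: filterS => G /normr0_eq0/eqP.
  by rewrite subr_eq0 => /eqP.
have [s bs|A0|A1] := mu_ergodic mA.
- have mrA : measurable (relabel s @^-1` A : set borel_graph).
    by rewrite -[X in measurable X]setTI; exact: measurable_relabel.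
  have := Linv s bs => -[N [mN N0 sN]].
  apply/eqP; rewrite -measure_le0 -N0; apply: le_measure; rewrite ?inE//.
    by apply: measurableU; exact: measurableD.
  move=> G AG; apply: sN => /= e; move: AG.
  by rewrite /setY /A /= /preimage /= e => -[[]|[]].
- apply: (conclude 1); exists A; split=> // G /= nG.
  by apply: contrapT => /negP; rewrite -leNgt => h; apply: nG; rewrite mul1r ger0_norm ?subr_ge0.
- apply: (conclude (-1)); exists (~` A); split; first exact: measurableC.
    by rewrite probability_setC// A1 subee.
  move=> G /= nG AG; apply: nG; rewrite mulN1r ltr0_norm ?subr_lt0//.
Qed.

Section one_pattern.
Variables (k : nat) (S : seq ('I_k * 'I_k)).

Let dens := @sample_density R k S.

Let bdens n a : bmeas (dens n a : borel_graph -> R).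
Proof. exact: bmeas_sample_density. Qed.

Let C : R := 3 * k%:R ^+ 2.

(** After expanding the square, all three second moments are within [C / n0] of the same joint
    probability, which cancels with coefficients 1, -2, 1; the errors add up to [4 * C / n0]. *)
Lemma E_sample_density_dist n m n0 a b :
  (0 < n0)%N -> (n0 <= n)%N -> (n0 <= m)%N -> injective a -> injective b ->
  E mu (fun G => (dens n a G - dens m b G) ^+ 2) <= 4 * C / n0%:R.
Proof.
move=> n00 n0n n0m ai bi.
have h n' m' a' b' := @E_sample_density_mul R mu mu_invariant k S S n' m' n0 a' b' n00.
have bm n1 a1 n2 a2 : bmeas (fun G : borel_graph => dens n1 a1 G * dens n2 a2 G).
  exact: bmeasM.
have -> : E mu (fun G => (dens n a G - dens m b G) ^+ 2) =
   E mu (fun G => dens n a G * dens n a G) - 2 * E mu (fun G => dens n a G * dens m b G)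
   + E mu (fun G => dens m b G * dens m b G).
  rewrite -EZ// -EB//; last by apply: bmeasM => //; exact: bmeas_cst.
  rewrite -ED//; last by apply: bmeasB => //; apply: bmeasM => //; exact: bmeas_cst.
  congr (E _ _); apply/funext => G; ring.
have /ler_normlP[_ h1] := h _ _ _ _ n0n n0n ai ai.
have /ler_normlP[h2 _] := h _ _ _ _ n0n n0m ai bi.
have /ler_normlP[_ h3] := h _ _ _ _ n0m n0m bi bi.
rewrite -/C -/dens in h1 h2 h3; rewrite -mulrA; move: h1 h2 h3.
set c := joint_prob _ _ _; move: c (C / _) => c e; lra.
Qed.

(** The product estimate with the empty pattern, whose density is 1. *)
Lemma E_sample_density n a : (0 < n)%N -> injective a ->
  `|E mu (dens n a) - prob_present mu (relabel_pairs val S)| <= C / n%:R.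
Proof.
move=> n0 ai.
have := @E_sample_density_mul R mu mu_invariant k S [::] n n n a a n0 (leqnn n) (leqnn n) ai ai.
rewrite -/C -/dens; have -> : (fun G => dens n a G * @sample_density R k [::] n a G) = dens n a.
  apply/funext => G; rewrite /sample_density /hom_density.
  under eq_bigr do rewrite big_nil.
  rewrite sumr_const card_ffun !card_ord natrX divff ?mulr1//.
  by rewrite expf_neq0// pnatr_eq0 -lt0n.
by rewrite /joint_prob /= cats0 /relabel_pairs -map_comp.
Qed.

Let Y j : borel_graph -> R := dens (4 ^ j) id.

Let pow4_inv j : (4 ^ j)%:R^-1 = 4^-1 ^+ j :> R.
Proof. by rewrite natrX exprVn. Qed.

Let p4 j : (0 < 4 ^ j)%N. Proof. by rewrite expn_gt0. Qed.

Lemma sample_density_cvg :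
  \forall G \ae mu, Y j G @[j --> \oo] --> prob_present mu (relabel_pairs val S).
Proof.
have bY j : bmeas (Y j) by exact: bdens.
have Y01 j G : 0 <= Y j G <= 1 by exact: sample_density01.
(* An upper limit is defined everywhere and measurable; it is the limit wherever that exists. *)
pose L G := limn_sup (Y ^~ G).
have mY j : measurable_fun setT (Y j) by case: (bY j).
have bL : bmeas L.
  split; first exact: measurable_limn_sup01.
  by exists 1 => G; have /andP[u v] := limn_sup01 (Y01 ^~ G); rewrite ger0_norm.
have cvY : \forall G \ae mu, cvgn (Y ^~ G).
  apply: (@ae_cvg _ _ _ mu Y (4 * C)) => // j; rewrite -pow4_inv.
  apply: E_sample_density_dist => //; by rewrite leq_exp2l.
have YL : \forall G \ae mu, Y j G @[j --> \oo] --> L G.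
  by apply: filterS cvY => G cY; rewrite /L cvg_limn_supE.
have EYL : E mu (Y j) @[j --> \oo] --> E mu L.
  apply: (@E_cvg _ _ _ mu Y L 1) => // [|j G]; first by case: bL.
  by have /andP[u v] := Y01 j G; rewrite ger0_norm.
(* The constant is identified by its mean, as the means converge at the rate [C / 4 ^ j]. *)
have ELp : E mu L = prob_present mu (relabel_pairs val S).
  apply: (@cvg_unique _ (@Rhausdorff R) _ _ _ _ EYL).
  apply/subr_cvg0/norm_cvg0P.
  apply: (@squeeze_cvgr _ _ _ _ (cst 0) (geometric C 4^-1)).
  - apply: nearW => j /=; rewrite normr_ge0 -pow4_inv.
    by apply: E_sample_density => //; exact: inj_id.
  - exact: cvg_cst.
  - by apply: cvg_geometric; rewrite ger0_norm ?invr_ge0// invf_lt1// ltr1n.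
have Lconst : \forall G \ae mu, L G = E mu L.
  apply: invariant_constant => // s bs.
  have si := bij_inj bs.
  (* Sampling along [s] and along the identity differ by a sequence that tends to 0 almost surely,
     so the limit does not change under relabelling. *)
  have : \forall G \ae mu, (Y j G - dens (4 ^ j) s G) @[j --> \oo] --> 0.
    apply: (@ae_cvg0 _ _ _ mu _ (4 * C)) => [j|j]; first exact: bmeasB.
    rewrite -pow4_inv; apply: E_sample_density_dist => //; exact: inj_id.
  apply: filterS2 YL => G cYL c0.
  have cs : dens (4 ^ j) s G @[j --> \oo] --> L G.
    have -> : (fun j => dens (4 ^ j) s G) = (fun j => Y j G - (Y j G - dens (4 ^ j) s G)).
      by apply/funext => j; rewrite subKr.
    by rewrite -[L G]subr0; exact: cvgB.
  by rewrite /L; apply: (cvg_limn_inf_sup cs).2.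
by apply: filterS2 YL Lconst => G YLG LG; rewrite -ELp -LG.
Qed.

End one_pattern.

(** There are only countably many patterns, so one null set serves them all. *)
Lemma typical_graph : exists G : graph, forall k (S : seq ('I_k * 'I_k)),
  sample_density S (4 ^ j) id G @[j --> \oo] --> prob_present mu (relabel_pairs val S).
Proof.
pose Q (kS : {k : nat & seq ('I_k * 'I_k)}) (G : borel_graph) :=
  sample_density (projT2 kS) (4 ^ j) id G @[j --> \oo] -->
  prob_present mu (relabel_pairs val (projT2 kS)).
have /ae_exists[G QG] : \forall G \ae mu, forall kS, Q kS G.
  by apply: ae_forall_countable => kS; exact: sample_density_cvg.
by exists G => k S; exact: QG (existT _ k S).
Qed.

End ergodic.

(** * The limit of the regular partitions *)

Section limits_along_an_ultrafilter.
Context {R : realType} (U : set_system nat) {UU : UltraFilter U}.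

(** One ultrafilter makes all masses, densities, energies and cut norms converge together, in place
    of diagonal subsequences. *)
Definition ulim (u : nat -> R) : R := lim (u @ U).

(** By compactness of the unit interval the image filter has a cluster point, and a cluster point of
    an ultrafilter is a limit. *)
Lemma ulim_cvg (u : nat -> R) : (forall n, 0 <= u n <= 1) -> u @ U --> ulim u.
Proof.
move=> u01.
have UI : U [set n | `[0, 1]%classic (u n)].
  by apply: filterE => n /=; rewrite in_itv/= u01.
have [] := @segment_compact R 0 1 (u @ U) _ UI.
move=> p [_ clp].
suff up : u @ U --> p by rewrite /ulim (cvg_lim _ up).
move=> B Bp; rewrite nbhs_filterE /fmap /=.
have [//|UnB] := in_ultra_setVsetC (u @^-1` B) UU.
have [] := clp (~` B) B UnB Bp => x [].
by [].
Qed.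

Lemma ulim01 (u : nat -> R) : (forall n, 0 <= u n <= 1) -> 0 <= ulim u <= 1.
Proof.
move=> u01; have cu := ulim_cvg u01.
apply/andP; split.
  by apply: limr_ge; [apply/cvg_ex; exists (ulim u)|apply: nearW => n; case/andP: (u01 n)].
by apply: limr_le; [apply/cvg_ex; exists (ulim u)|apply: nearW => n; case/andP: (u01 n)].
Qed.

Lemma ulim_unique (u : nat -> R) l : u @ U --> l -> ulim u = l.
Proof. by move=> /cvg_lim; apply. Qed.

Lemma cvgr_sum (I : Type) (s : seq I) (f : I -> nat -> R) (l : I -> R) :
  (forall i, f i @ U --> l i) -> (fun n => \sum_(i <- s) f i n) @ U --> \sum_(i <- s) l i.
Proof.
move=> fl; elim: s => [|i s IH].
  by rewrite big_nil; under eq_fun do rewrite big_nil; exact: cvg_cst.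
by rewrite big_cons; under eq_fun do rewrite big_cons; exact: cvgD.
Qed.

Lemma cvgr_prod (I : Type) (s : seq I) (f : I -> nat -> R) (l : I -> R) :
  (forall i, f i @ U --> l i) -> (fun n => \prod_(i <- s) f i n) @ U --> \prod_(i <- s) l i.
Proof.
move=> fl; elim: s => [|i s IH].
  by rewrite big_nil; under eq_fun do rewrite big_nil; exact: cvg_cst.
by rewrite big_cons; under eq_fun do rewrite big_cons; exact: cvgM.
Qed.

End limits_along_an_ultrafilter.

Section grouping_by_labels.
Variables (R : comPzRingType) (V L : finType) (l : V -> L).

Lemma sum_by_label (F : L -> R) :
  \sum_x F (l x) = \sum_a #|[pred x | l x == a]|%:R * F a.
Proof.
rewrite (partition_big l xpredT)//=; apply: eq_bigr => a _.
rewrite (eq_bigr (fun=> F a)); last by move=> x /eqP->.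
by rewrite sumr_const mulr_natl.
Qed.

Lemma sum_ffun_by_label k (F : {ffun 'I_k -> L} -> R) :
  \sum_(f : {ffun 'I_k -> V}) F [ffun i => l (f i)]
  = \sum_(t : {ffun 'I_k -> L}) (\prod_i #|[pred x | l x == t i]|%:R) * F t.
Proof.
rewrite (partition_big (fun f : {ffun 'I_k -> V} => [ffun i => l (f i)]) xpredT)//=.
apply: eq_bigr => t _.
rewrite (eq_bigr (fun=> F t)); last by move=> f /eqP->.
rewrite sumr_const -[LHS]mulr_natl; congr (_ * _).
rewrite -natr_prod; congr (_%:R).
transitivity #|family (fun i => [pred x | l x == t i])|; last first.
  by rewrite card_family foldrE big_map big_enum.
apply: eq_card => f; rewrite -[LHS]/([ffun i => l (f i)] == t); apply/eqP/familyP => [<- i|h].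
  by rewrite inE /= ffunE.
by apply/ffunP => i; rewrite ffunE; apply/eqP; have := h i; rewrite inE.
Qed.

End grouping_by_labels.

Lemma edge_sym (G : graph) i j : edge G i j = edge G j i.
Proof. by case: G => a ha; have := ha; rewrite inE => -[sa _]; exact: sa. Qed.

(** * Limit masses and limit densities *)

Section limit_object.
Context {R : realType} (G : graph).
Variable p : forall k, seq ('I_k * 'I_k) -> R.
Hypothesis G_typical : forall k (S : seq ('I_k * 'I_k)),
  sample_density S (4 ^ j) id G @[j --> \oo] --> p S.

Let V j := 'I_(4 ^ j).
Let A j (x y : V j) : R := (edge G x y)%:R.

Let V_gt0 j : (0 < #|V j|)%N. Proof. by rewrite card_ord expn_gt0. Qed.

Let A01 j x y : 0 <= A (j := j) x y <= 1.
Proof. by rewrite /A; case: edge; rewrite ?lexx ?ler01. Qed.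

Let A_sym j x y : A (j := j) x y = A y x.
Proof.
by rewrite /A edge_sym.
Qed.

Let lab j r : V j -> seq bool := bits (A (j := j)) r.

(** Half rounds [i] and [i.+1], for [i] even, read the two sides of one cut, chosen from the labels
    of the full round [i./2]; the order agrees with that in [bits]. *)
Definition nextbit j (x : V j) i : bool :=
  let q := worst (A (j := j)) (@lab j i./2) in if odd i then x \in q.2 else x \in q.1.

(* [hist] records half rounds as well, so that every node of a binary tree is the
   label of a class. *)
Fixpoint hist j (x : V j) n : seq bool :=
  if n is n'.+1 then nextbit x n' :: hist x n' else [::].

Let hist_bits j (x : V j) r : hist x r.*2 = @lab j r x.
Proof.
by elim: r => //= r IH; rewrite IH /nextbit /= odd_double uphalf_double doubleK.
Qed.

Definition mass_at j (a : seq bool) : R :=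
  #|[pred x : V j | hist x (size a) == a]|%:R / #|V j|%:R.

(** Meant for two labels of the same even length; for other lengths one of the classes is empty and
    the value is 0. *)
Definition density_at j (a b : seq bool) : R :=
  density (A (j := j)) (@lab j (size a)./2) a b.

Let mass_at01 j a : 0 <= mass_at j a <= 1.
Proof.
apply/andP; split; first by rewrite divr_ge0.
rewrite ler_pdivrMr ?ltr0n// mul1r ler_nat; exact: max_card.
Qed.

Let mass_at_nil j : mass_at j [::] = 1.
Proof.
rewrite /mass_at (_ : #|_| = #|V j|); first by rewrite divff// pnatr_eq0 -lt0n.
by apply: eq_card => x; rewrite !inE.
Qed.

Let mass_at_cons j a : mass_at j a = mass_at j (true :: a) + mass_at j (false :: a).
Proof.
rewrite /mass_at -mulrDl -natrD; congr (_%:R / _).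
rewrite -(cardID [pred x | nextbit x (size a)] [pred x | hist x (size a) == a]).
by congr (_ + _)%N; apply: eq_card => x; rewrite !inE /= eqseq_cons; case: nextbit; rewrite ?andbT ?andbF.
Qed.

Let density_at01 j a b : 0 <= density_at j a b <= 1.
Proof. exact: density01. Qed.

Let lab_tuple j r (x : V j) : (r.*2).-tuple bool :=
  Tuple (introT eqP (size_bits (A (j := j)) r x)).

Let mass_atE j r (a : (r.*2).-tuple bool) :
  mass_at j a = #|[pred x : V j | lab_tuple r x == a]|%:R / #|V j|%:R.
Proof.
rewrite /mass_at size_tuple; congr (_%:R / _); apply: eq_card => x.
by rewrite !inE hist_bits -val_eqE.
Qed.

Let density_atE j r (x y : V j) :
  density_at j (lab_tuple r x) (lab_tuple r y) = step (A (j := j)) r x y.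
Proof. by rewrite /density_at size_tuple doubleK. Qed.

(** The sum over vertices becomes one over finitely many labels, their number independent of [j], so
    that it can pass to the limit. *)
Let mean2_lab j r (h : (r.*2).-tuple bool -> (r.*2).-tuple bool -> R) :
  mean2 (fun x y : V j => h (@lab_tuple j r x) (@lab_tuple j r y)) =
  \sum_(a : (r.*2).-tuple bool) \sum_(b : (r.*2).-tuple bool) mass_at j a * mass_at j b * h a b.
Proof.
rewrite /mean2 (eq_bigr (fun x : V j => \sum_(b : (r.*2).-tuple bool) #|[pred y : V j | @lab_tuple j r y == b]|%:R * h (@lab_tuple j r x) b)); last first.
  by move=> x _; rewrite (sum_by_label (@lab_tuple j r) (h (@lab_tuple j r x))).
rewrite (sum_by_label (@lab_tuple j r) (fun a => \sum_(b : (r.*2).-tuple bool) #|[pred y : V j | @lab_tuple j r y == b]|%:R * h a b)).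
rewrite mulr_suml; apply: eq_bigr => a _; rewrite mulr_sumr mulr_suml; apply: eq_bigr => b _.
by rewrite !mass_atE; field; rewrite pnatr_eq0 -lt0n.
Qed.

Let hom_density_lab j r k (S : seq ('I_k * 'I_k)) :
  hom_density (step (A (j := j)) r) S =
  \sum_(t : {ffun 'I_k -> (r.*2).-tuple bool}) (\prod_i mass_at j (t i)) *
     \prod_(q <- S) density_at j (t q.1) (t q.2).
Proof.
pose F (t : {ffun 'I_k -> (r.*2).-tuple bool}) := \prod_(q <- S) density_at j (t q.1) (t q.2).
rewrite /hom_density (eq_bigr (fun f : {ffun 'I_k -> V j} => F [ffun i => lab_tuple r (f i)])); last first.
  by move=> f _; apply: eq_bigr => q _; rewrite !ffunE density_atE.
rewrite (sum_ffun_by_label (@lab_tuple j r) F) mulr_suml; apply: eq_bigr => t _.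
rewrite mulrAC; congr (_ * _).
rewrite [RHS](eq_bigr (fun i => #|[pred x : V j | lab_tuple r x == t i]|%:R / #|V j|%:R)); last first.
  by move=> i _; rewrite mass_atE.
by rewrite big_split/= prodr_const (_ : #|_| = k) ?exprVn//; exact: card_ord.
Qed.

(** Every clause is an identity or a weak inequality between finitely many masses, densities,
    energies and cut norms. It holds for each [j], hence for the limits along the ultrafilter. *)
Theorem limit_object_exists :
  exists (m : seq bool -> R) (w : seq bool -> seq bool -> R) (e c : nat -> R),
  [/\ [/\ forall a, 0 <= m a, m [::] = 1 & forall a, m a = m (true :: a) + m (false :: a)],
      forall a b, size a = size b -> w a b = w b a, forall a b, 0 <= w a b <= 1 &
  [/\ forall r, 0 <= e r <= 1,
      forall r s, (r <= s)%N ->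
        \sum_(a : (s.*2).-tuple bool) \sum_(b : (s.*2).-tuple bool)
          m a * m b * (w a b - w (drop (s - r).*2 a) (drop (s - r).*2 b)) ^+ 2 = e s - e r,
      (forall r, 0 <= c r), (forall K, \sum_(r < K) c r ^+ 2 <= 1) &
      forall k (S : seq ('I_k * 'I_k)) r, simple_edges S ->
        `|\sum_(t : {ffun 'I_k -> (r.*2).-tuple bool}) (\prod_i m (t i)) *
           \prod_(q <- S) w (t q.1) (t q.2) - p S| <= (size S)%:R * c r]].
Proof.
have [U [UU subU]] := @ultraFilterLemma nat \oo _.
pose u := @ulim R U.
pose m a := u (fun j => mass_at j a); pose w a b := u (fun j => density_at j a b).
have mc a : (fun j => mass_at j a) @ U --> m a by apply: ulim_cvg => j.
have wc a b : (fun j => density_at j a b) @ U --> w a b by apply: ulim_cvg => j.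
have E01 j r : 0 <= energy (A (j := j)) r <= 1.
  rewrite (energy_ge0 (A (j := j)) (V_gt0 j)).
  by rewrite (energy_le1 (V_gt0 j) (A01 (j := j))).

have N0 j r := cutnorm_ge0 (A (j := j)) r.
have N1 j r := cutnorm_le1 (V_gt0 j) (A01 (j := j)) r.
pose e r := u (fun j => energy (A (j := j)) r).
pose c r := u (fun j => cutnorm (A (j := j)) r).
have ec r : (fun j => energy (A (j := j)) r) @ U --> e r by apply: ulim_cvg => j.
have cc r : (fun j => cutnorm (A (j := j)) r) @ U --> c r.
  by apply: ulim_cvg => j; rewrite N0 N1.
have Rh := @Rhausdorff R.
exists m, w, e, c; split.
- split=> [a||a].
  + by have /andP[] := @ulim01 R U UU (fun j => mass_at j a) (fun j => mass_at01 j a).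
  + apply: ulim_unique; rewrite (_ : (fun j => _) = cst 1); first exact: cvg_cst.
    by apply/funext => j; exact: mass_at_nil.
  + apply: ulim_unique; rewrite (_ : (fun j => mass_at j a) = (fun j => mass_at j (true :: a) + mass_at j (false :: a))).
      exact: cvgD.
    by apply/funext => j; exact: mass_at_cons.
- move=> a b ab; rewrite /w; congr (u _); apply/funext => j.
  by rewrite /density_at ab density_sym.
- by move=> a b; exact: ulim01.
split.
- by move=> r; exact: ulim01.
- move=> r s rs.
  have hE : (fun j => energy (A (j := j)) s - energy (A (j := j)) r) @ U --> e s - e r.
    exact: cvgB.
  apply: (cvg_unique Rh (y := e s - e r) _ hE).
  rewrite (_ : (fun j => _) = fun j => \sum_(a : (s.*2).-tuple bool) \sum_(b : (s.*2).-tuple bool)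
     mass_at j a * mass_at j b * (density_at j a b - density_at j (drop (s - r).*2 a) (drop (s - r).*2 b)) ^+ 2).
    apply: cvgr_sum => a; apply: cvgr_sum => b.
    apply: cvgM; first exact: cvgM.
    by under eq_fun do rewrite expr2; rewrite expr2; apply: cvgM; exact: cvgB.
  apply/funext => j; rewrite /= -(mean2_step (A (j := j)) rs).
  rewrite -(@mean2_lab j s (fun a b => (density_at j a b - density_at j (drop (s - r).*2 a) (drop (s - r).*2 b)) ^+ 2)).
  rewrite /mean2; congr (_ / _); apply: eq_bigr => x _; apply: eq_bigr => y _.
  rewrite density_atE; congr ((_ - _) ^+ 2).
  have db z : drop (s - r).*2 (lab_tuple s z) = @lab j r z.
    by rewrite -[RHS](drop_bits _ _ (s - r)) subnK.
  by rewrite !db /density_at /lab size_bits doubleK.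
- move=> r; have cr01 j : 0 <= cutnorm (A (j := j)) r <= 1 by rewrite N0 N1.
  by have /andP[] := @ulim01 R U UU _ cr01.
- move=> K; apply: (@ler_cvg_to _ U _ R (fun j => \sum_(r < K) cutnorm (A (j := j)) r ^+ 2) (cst 1)).
  + by apply: cvgr_sum => r; under eq_fun do rewrite expr2; rewrite expr2; exact: cvgM.
  + exact: cvg_cst.
  + by apply: nearW => j; exact: sum_cutnorm.
- move=> k S r sS.
  (* The ultrafilter refines the filter at infinity, so the ordinary limit persists along it. *)
  have hS : (fun j => sample_density S (4 ^ j) id G) @ U --> p S.
    by move=> B /G_typical BS; exact: subU.
  have cS : (fun j => hom_density (step (A (j := j)) r) S) @ U -->
      \sum_(t : {ffun 'I_k -> (r.*2).-tuple bool}) (\prod_i m (t i)) * \prod_(q <- S) w (t q.1) (t q.2).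
    under eq_fun do rewrite hom_density_lab.
    by apply: cvgr_sum => t; apply: cvgM; exact: cvgr_prod.
  apply: (@ler_cvg_to _ U _ R (fun j => `|hom_density (step (A (j := j)) r) S - sample_density S (4 ^ j) id G|)
     (fun j => (size S)%:R * cutnorm (A (j := j)) r)).
  + by apply: cvg_norm; exact: cvgB.
  + by apply: cvgM => //; exact: cvg_cst.
  + apply: nearW => j; rewrite distrC; apply: (counting_lemma (V_gt0 j) (A01 (j := j)) _ _ sS).
      by move=> x y; exact: (step01 (A01 (j := j))).
    by move=> f g f01 g01; exact: (cut_step (A (j := j)) (V_gt0 j)).
Qed.

End limit_object.

(** * A sequence of independent uniform variables *)

(** In [A], both sides are finite measures that agree on the intersection-closed family [G], hence
    on the sigma-algebra it generates. *)
Lemma independent_generated {R : realType} d (T : measurableType d) (P : probability T R)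
    (G : set (set T)) (D : set T) :
  G `<=` measurable -> setI_closed G -> G setT -> measurable D ->
  (forall A, G A -> P (A `&` D) = P A * P D)%E ->
  forall A, <<s G >> A -> (P (A `&` D) = P A * P D)%E.
Proof.
move=> Gm GI GT mD GP A sA.
have PDfin : P D \is a fin_num by exact: fin_num_measure.
have PD0 : 0 <= fine (P D) by rewrite fine_ge0.
pose m2 := mscale (NngNum PD0) P.
have m2E B : m2 B = (P B * P D)%E.
  by rewrite /m2 /mscale /= fineK// muleC.
rewrite -m2E -[LHS]/(mrestr P mD A).
apply: (g_sigma_algebra_measure_unique G Gm (fun=> setT)) sA => //.
- by rewrite bigcup_const.
- by move=> B GB; exact: etrans (GP _ GB) (esym (m2E B)).
- move=> _; apply: (@le_lt_trans _ _ 1%E); last by rewrite ltry.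
  by rewrite -[leLHS]/(P (setT `&` D)) setTI; exact: probability_le1.
Qed.

(** * Cells of the unit interval *)

Section interval_splitting.
Context {R : realType}.
Variable m : seq bool -> R.
Hypothesis m_ge0 : forall a, 0 <= m a.
Hypothesis m_nil : m [::] = 1.
Hypothesis m_cons : forall a, m a = m (true :: a) + m (false :: a).

(** The left end of the cell of [a]; within a cell, the part of [false] lies to the left of the part
    of [true]. *)
Fixpoint start (a : seq bool) : R :=
  if a is b :: a' then start a' + (if b then m (false :: a') else 0) else 0.

(* The [n] digits of [u], last one first, in the expansion that cuts the unit
   interval into consecutive intervals of lengths [m]. *)
Fixpoint code (u : R) (n : nat) : seq bool :=
  if n is n'.+1 then
    let a := code u n' in (start a + m (false :: a) <= u) :: a
  else [::].

Lemma size_code u n : size (code u n) = n.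
Proof. by elim: n => //= n ->. Qed.

Lemma drop_code u n k : drop k (code u (k + n)) = code u n.
Proof. by elim: k => [|k IH]; rewrite ?drop0. Qed.

(** The two children divide the half-open cell of their parent at [start a + m (false :: a)], and a
    point outside that cell lies in neither of them. *)
Lemma code_cell u a : 0 <= u < 1 ->
  (code u (size a) == a) = (start a <= u < start a + m a).
Proof.
move=> u01; elim: a => [|b a IH] /=; first by rewrite add0r m_nil u01.
rewrite eqseq_cons andbC; case: (eqVneq (code u (size a)) a) IH => [e|ne] IH /=.
  rewrite e; move: IH; rewrite (m_cons a) => /esym/andP[h1 h2].
  case: b; rewrite ?addr0 ?h1 //=.
    by rewrite eqb_id -addrA (addrC (m (false :: a))) h2 andbT.
  by rewrite eqbF_neg -ltNge.
have f0 := m_ge0 (false :: a); have t0 := m_ge0 (true :: a).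
apply/esym/negbTE; move: IH; rewrite (m_cons a) => /esym/negbT; apply: contra => /andP[].
case: b; rewrite ?addr0 => h1 h2; apply/andP; split; lra.
Qed.

Lemma cell_sub a : 0 <= start a /\ start a + m a <= 1.
Proof.
elim: a => [|b a [s0 s1]] /=; first by rewrite m_nil add0r lexx.
have f0 := m_ge0 (false :: a); have t0 := m_ge0 (true :: a); have := m_cons a.
by case: b; rewrite ?addr0 => e; split; lra.
Qed.

Lemma measurable_code n (a : seq bool) : measurable [set u : measurableTypeR R | code u n = a].
Proof.
elim: n a => [|n IH] [|b a] /=.
- by rewrite (_ : [set _ | _] = setT) -?subTset.
- by rewrite (_ : [set _ | _] = set0) -?subset0.
- by rewrite (_ : [set _ | _] = set0) -?subset0.
rewrite (_ : [set _ | _] = [set u | code u n = a] `&`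
   (if b then [set` `[start a + m (false :: a), +oo[] else [set` `]-oo, start a + m (false :: a)[])).
  by apply: measurableI; [exact: IH|case: b; exact: measurable_itv].
apply/seteqP; split=> u /=.
  move=> [bE ua]; split=> //; rewrite ua in bE.
  by case: b bE => bE /=; rewrite in_itv/= ?bE// ltNge bE.
move=> [ua]; rewrite ua; case: b => /=; rewrite in_itv/= ?andbT.
  by move=> ->.
by rewrite ltNge => /negbTE ->.
Qed.

End interval_splitting.

Section uniform_measure.
Context {R : realType}.

Definition unif : probability (measurableTypeR R) R := uniform_prob (@ltr01 R).

Lemma unifE (A : set (measurableTypeR R)) : measurable A ->
  unif A = lebesgue_measure (A `&` `[0, 1]%classic).
Proof.
move=> mA; rewrite /unif /= /uniform_prob integral_uniform_pdf.
rewrite (eq_integral (fun=> 1%E)) => [|x]; last first.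
  by rewrite inE => -[_] /=; rewrite in_itv/= /uniform_pdf => ->; rewrite subr0 invr1.
by rewrite (integral_cst _ (measurableI _ _ mA (measurable_itv _))) mul1e.
Qed.

Lemma unif_itvco a b : 0 <= a -> a <= b -> b <= 1 -> unif `[a, b[%classic = (b - a)%:E.
Proof.
move=> a0 ab b1; rewrite unifE//.
rewrite setIidl => [|x /=]; last first.
  by rewrite !in_itv/= => /andP[h1 h2]; rewrite (le_trans a0 h1) (ltW (lt_le_trans h2 b1)).
rewrite lebesgue_measure_itv/= lte_fin; case: ltP => //.
by move=> ba; rewrite (@le_anti _ _ a b) ?subrr// ab.
Qed.

Lemma unif_unit : unif `[0, 1[%classic = 1%E.
Proof. by rewrite unif_itvco// subr0. Qed.

Let mI : measurable (`[0, 1[%classic : set (measurableTypeR R)).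
Proof. exact: measurable_itv. Qed.

Lemma unif_unit_ae : \forall u \ae unif, 0 <= u < 1.
Proof.
exists (~` `[0, 1[%classic); split; first exact: measurableC.
  by rewrite [LHS]probability_setC// unif_unit subee.
by move=> u /= nu; rewrite in_itv.
Qed.

(** The cells describe points of the half-open unit interval only; its complement is null, so the
    digits may be arbitrary there. *)
Lemma unif_eq_on_unit (A B : set (measurableTypeR R)) : measurable A -> measurable B ->
  (forall u, 0 <= u < 1 -> A u <-> B u) -> unif A = unif B.
Proof.
move=> mA mB AB; have iA := @integral_indic _ _ _ unif setT measurableT _ mA.
have iB := @integral_indic _ _ _ unif setT measurableT _ mB.
rewrite -(setIT A) -(setIT B) -iA -iB; apply: ae_eq_integral => //.
- exact/measurable_EFinP/measurable_indic.
- exact/measurable_EFinP/measurable_indic.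
have [N [mN N0 sN]] := unif_unit_ae; exists N; split=> // u /= nAB; apply: sN => u01.
apply: nAB => _; rewrite !indicE (_ : (u \in A) = (u \in B))//.
by apply/idP/idP; rewrite !inE; case: (AB u u01).
Qed.

Lemma unif_code (m : seq bool -> R) : (forall a, 0 <= m a) -> m [::] = 1 ->
  (forall a, m a = m (true :: a) + m (false :: a)) ->
  forall a, unif [set u | code m u (size a) = a] = (m a)%:E.
Proof.
move=> m0 m1 mc a; have [s0 s1] := cell_sub m0 m1 mc a.
rewrite (@unif_eq_on_unit _ `[start m a, start m a + m a[%classic).
- by rewrite unif_itvco// ?lerDl// addrAC subrr add0r.
- exact: measurable_code.
- exact: measurable_itv.
move=> u u01 /=; rewrite in_itv/= -(code_cell m0 m1 mc _ u01).
by split=> [->|/eqP].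
Qed.

Lemma probability_unique_rays (P Q : probability (measurableTypeR R) R) :
  (forall x, P `]x, +oo[%classic = Q `]x, +oo[%classic) ->
  forall A, measurable A -> P A = Q A.
Proof.
move=> PQ A mA.
have h := @measure_unique _ R (measurableTypeR R) (@RGenOInfty.G R)
  (fun n : nat => `](- n%:R), +oo[%classic) (@RGenOInfty.measurableE R) _ _ _ P Q.
apply: h => //.
- move=> _ _ [x ->] [y ->]; exists (Num.max x y); apply/seteqP; split=> z /=;
  by rewrite !in_itv/= !andbT gt_max => /andP.
- by move=> n; exists (- n%:R).
- apply/seteqP; split=> // x _; exists (Num.bound `|x|) => //=.
  rewrite in_itv/= andbT ltrNl; apply: le_lt_trans (archi_boundP (normr_ge0 x)).
  by rewrite -normrN ler_norm.
- by move=> _ [x ->]; exact: PQ.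
- move=> n; apply: (@le_lt_trans _ _ 1%E); last by rewrite ltry.
  by apply: probability_le1; exact: measurable_itv.
Qed.

End uniform_measure.

(** * Even and odd binary digits of a uniform variable *)

Section deinterleaving.

Fixpoint evens (a : seq bool) := if a is x :: _ :: a' then x :: evens a' else [::].
Fixpoint odds (a : seq bool) := if a is _ :: y :: a' then y :: odds a' else [::].
Fixpoint interleave (a b : seq bool) :=
  if a is x :: a' then if b is y :: b' then x :: y :: interleave a' b' else [::] else [::].

Lemma deinterleave_eq r a b l : size a = r -> size b = r -> size l = r.*2 ->
  (evens l = a /\ odds l = b) <-> l = interleave a b.
Proof.
elim: r a b l => [|r IH] [|x a] [|y b] [|u [|v l]]//= [sa] [sb] [sl].
have [IH1 IH2] := IH a b l sa sb sl; split.
  by move=> [[-> ea] [-> ob]]; rewrite IH1.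
by move=> [-> -> /IH2[-> ->]].
Qed.

Lemma size_interleave r a b : size a = r -> size b = r -> size (interleave a b) = r.*2.
Proof. by elim: r a b => [|r IH] [|x a] [|y b]//= [sa] [sb]; rewrite IH. Qed.

Lemma size_evens r l : size l = r.*2 -> size (evens l) = r.
Proof. by elim: r l => [|r IH] [|u [|v l]]//= [sl]; rewrite IH. Qed.

Lemma size_odds r l : size l = r.*2 -> size (odds l) = r.
Proof. by elim: r l => [|r IH] [|u [|v l]]//= [sl]; rewrite IH. Qed.

End deinterleaving.

Section splitting_a_uniform_variable.
Context {R : realType}.
Local Notation unif := (@unif R).
Local Notation T := (measurableTypeR R).

(** With these masses [code] is the binary expansion and [start fair a] is the dyadic number with
    the digits [a], last one first. *)
Definition fair (a : seq bool) : R := 2^-1 ^+ size a.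

Let fair_ge0 a : 0 <= fair a. Proof. by rewrite exprn_ge0// invr_ge0. Qed.
Let fair_nil : fair [::] = 1. Proof. by []. Qed.
Let fair_cons a : fair a = fair (true :: a) + fair (false :: a).
Proof. by rewrite /fair /= exprS; field. Qed.

Local Notation digits := (code fair).

Let size_digits u r : size (digits u r) = r. Proof. exact: size_code. Qed.

Let start_cons b a : start fair a <= start fair (b :: a).
Proof. by rewrite /= lerDl; case: b. Qed.

Let start01 a : 0 <= start fair a <= 1.
Proof.
have [s0 s1] := cell_sub fair_ge0 fair_nil fair_cons a.
by rewrite s0 (le_trans _ s1)// lerDl.
Qed.

(* [sel] reads a binary expansion off the digits; it will pick every other digit. *)
Definition subexpansion (sel : seq bool -> seq bool) (u : R) : R :=
  sup (range (fun r => start fair (sel (digits u r.*2)))).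

Definition even_part := subexpansion evens.
Definition odd_part := subexpansion odds.

(** A strict lower bound on a supremum is reached at a finite stage. Preimages of open rays thus
    become unions of events about finitely many digits. *)
Let gt_subexpansion sel u s :
  s < subexpansion sel u <-> exists r, s < start fair (sel (digits u r.*2)).
Proof.
have hs : has_sup (range (fun r => start fair (sel (digits u r.*2)))).
  split; first by exists (start fair (sel (digits u 0))); exists 0.
  by exists 1 => _ [r _ <-]; case/andP: (start01 (sel (digits u r.*2))).
split.
  by move=> /(sup_gt hs.1)[_ [r _ <-] h]; exists r.
by move=> [r /lt_le_trans]; apply; apply: ub_le_sup; [exact: hs.2|exists r].
Qed.

Let ray s : set T := `]s, +oo[%classic.

Let measurable_ray s : measurable (ray s). Proof. exact: measurable_itv. Qed.

Let prefix (sel : seq bool -> seq bool) s r : set T :=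
  [set u | s < start fair (sel (digits u r.*2))].

Let measurable_digits n (Q : seq bool -> bool) : measurable [set u : T | Q (digits u n)].
Proof.
rewrite (_ : [set _ | _] = \bigcup_a [set u : T | Q a /\ digits u n = a]).
  apply: countable_bigcupT_measurable => // a; case Qa: (Q a).
    rewrite (_ : [set _ | _] = [set u : T | digits u n = a]); first exact: measurable_code.
    by apply/seteqP; split=> u /= => [[]|].
  by rewrite (_ : [set _ | _] = set0)//; apply/seteqP; split=> u // [].
by apply/seteqP; split=> u /= => [h|[a _ [Qa ->]]//]; exists (digits u n).
Qed.

Let measurable_prefix sel s r : measurable (prefix sel s r).
Proof. exact: (measurable_digits _ (fun a => s < start fair (sel a))). Qed.

Let preimage_ray sel s : subexpansion sel @^-1` (ray s) = \bigcup_r prefix sel s r.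
Proof.
apply/seteqP; split=> u; rewrite /ray /preimage /= in_itv/= andbT.
  by move=> /gt_subexpansion[r h]; exists r.
by move=> [r _ h]; apply/gt_subexpansion; exists r.
Qed.

Lemma measurable_subexpansion sel : measurable_fun setT (subexpansion sel : T -> T).
Proof.
apply: measurability (@RGenOInfty.measurableE R) _ => _ [_ [x ->] <-].
rewrite setTI -[X in measurable X]/(subexpansion sel @^-1` (ray x)) preimage_ray.
by apply: bigcupT_measurable => r; exact: measurable_prefix.
Qed.

Let digits_prob r (Q : seq bool -> bool) :
  fine (unif [set u | Q (digits u r)]) = \sum_(a : r.-tuple bool) (Q a)%:R * fair a.
Proof.
rewrite -E_indic; last exact: measurable_digits.
have -> : (\1_[set u | Q (digits u r)] : T -> R) =
    fun u => \sum_(a : r.-tuple bool) (Q a)%:R * \1_[set u : T | digits u r = a] u.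
  apply/funext => u; rewrite (bigD1 (Tuple (introT eqP (size_digits u r))))//=.
  rewrite big1 ?addr0 => [|a na]; last first.
    rewrite [X in _ * X]indicE memNset ?mulr0//= => e.
    by move/eqP: na; apply; exact/val_inj.
  rewrite !indicE (_ : (u \in [set u0 | digits u0 r = _]) = true) ?mulr1; last exact: mem_set.
  by rewrite (_ : (u \in _) = Q (digits u r))//; apply/idP/idP; rewrite inE.
have bd a : bmeas (fun u : T => (Q a)%:R * \1_[set u : T | digits u r = a] u : R).
  by apply: bmeasM; [exact: bmeas_cst|apply: bmeas_indic; exact: measurable_code].
rewrite E_sum; last by move=> a; exact: bd.
apply: eq_bigr => a _; rewrite EZ; last by apply: bmeas_indic; exact: measurable_code.
rewrite E_indic; last exact: measurable_code.
congr (_ * _); have := unif_code fair_ge0 fair_nil fair_cons a.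
by rewrite size_tuple => ->.
Qed.

(** Interleaving is a bijection from pairs of words of length [r] to words of length [r.*2], and the
    weight [fair] of the result is the product of the two weights. *)
Let prefix_indep s t r :
  fine (unif (prefix evens s r `&` prefix odds t r)) =
  fine (unif [set u | s < start fair (digits u r)]) *
  fine (unif [set u | t < start fair (digits u r)]).
Proof.
rewrite (digits_prob r (fun a => s < start fair a)) (digits_prob r (fun a => t < start fair a)).
pose Q l := (s < start fair (evens l)) && (t < start fair (odds l)).
rewrite (_ : prefix _ _ _ `&` _ = [set u | Q (digits u r.*2)]); last first.
  by apply/seteqP; split=> u /= /andP.
rewrite digits_prob mulr_suml.
pose h (p : r.-tuple bool * r.-tuple bool) : (r.*2).-tuple bool :=
  Tuple (introT eqP (size_interleave (size_tuple p.1) (size_tuple p.2))).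
pose g (l : (r.*2).-tuple bool) : r.-tuple bool * r.-tuple bool :=
  (Tuple (introT eqP (size_evens (size_tuple l))), Tuple (introT eqP (size_odds (size_tuple l)))).
have hg : cancel h g.
  case=> a b; rewrite /h /g; congr (_, _); apply/val_inj => /=.
    by have [_ /(_ erefl)[]] := deinterleave_eq (size_tuple a) (size_tuple b)
      (size_interleave (size_tuple a) (size_tuple b)).
  by have [_ /(_ erefl)[]] := deinterleave_eq (size_tuple a) (size_tuple b)
      (size_interleave (size_tuple a) (size_tuple b)).
have gh : cancel g h.
  move=> l; apply/val_inj => /=; apply/esym.
  by apply/(deinterleave_eq (size_evens (size_tuple l)) (size_odds (size_tuple l)) (size_tuple l)).
rewrite (reindex h) /=; last by exists g => ? _; [exact: hg|exact: gh].
under [RHS]eq_bigr do rewrite mulr_sumr.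
rewrite pair_big /=; apply: eq_bigr => -[a b] _ /=.
have := hg (a, b); rewrite /h /g /= => -[] /(congr1 val) /= ea /(congr1 val) /= ob.
rewrite /Q ea ob /fair (size_interleave (size_tuple a) (size_tuple b)) !size_tuple.
rewrite -addnn exprD -mulnb natrM; ring.
Qed.

(** On the unit interval [u] exceeds its truncation to [r] digits by less than [2 ^- r], so [s < u]
    holds exactly when some truncation exceeds [s]. *)
Let digits_ray s : unif [set u | exists r, s < start fair (digits u r)] = unif (ray s).
Proof.
apply: unif_eq_on_unit => //.
  rewrite (_ : [set u | _] = \bigcup_r [set u : T | s < start fair (digits u r)]).
    by apply: bigcupT_measurable => r; exact: (measurable_digits _ (fun a => s < start fair a)).
  by apply/seteqP; split=> u /= => [[r h]|[r _ h]]; exists r.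
move=> u u01; rewrite /ray /= in_itv/= andbT.
have cell r : start fair (digits u r) <= u < start fair (digits u r) + 2^-1 ^+ r.
  have := code_cell fair_ge0 fair_nil fair_cons (digits u r) u01.
  by rewrite size_digits eqxx /fair size_digits => <-.
split.
  by move=> [r /lt_le_trans]; apply; case/andP: (cell r).
move=> su.
have : geometric 1 2^-1 r @[r --> \oo] --> (0 : R).
  by apply: cvg_geometric; rewrite ger0_norm ?invr_ge0// invf_lt1// ltr1n.
have us : 0 < u - s by rewrite subr_gt0.
move=> /cvgrPdist_lt/(_ _ us)[r _ /(_ r (leqnn r))] /=.
rewrite sub0r normrN mul1r ger0_norm ?exprn_ge0// ?invr_ge0// => h.
by exists r; have /andP[h1 h2] := cell r; lra.
Qed.

Let nondecreasing_prefix_evens s : nondecreasing_seq (prefix evens s).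
Proof.
apply/nondecreasing_seqP => r; apply/subsetPset => u; rewrite /prefix /=.
by move=> /lt_le_trans; apply; exact: start_cons.
Qed.

Let nondecreasing_prefix_odds s : nondecreasing_seq (prefix odds s).
Proof.
apply/nondecreasing_seqP => r; apply/subsetPset => u; rewrite /prefix /=.
by move=> /lt_le_trans; apply; exact: start_cons.
Qed.

(** The events about [r] digits increase with [r], so independence at each finite stage passes to
    the limit by continuity from below. *)
Let split_rays s t :
  unif (even_part @^-1` ray s `&` odd_part @^-1` ray t) = (unif (ray s) * unif (ray t))%E.
Proof.
have fin (A : set T) : measurable A -> unif A \is a fin_num by move=> mA; exact: fin_num_measure.
have c1 : fine (unif (prefix evens s r `&` prefix odds t r)) @[r --> \oo] -->
    fine (unif (even_part @^-1` ray s `&` odd_part @^-1` ray t)).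
  apply: fine_cvg; rewrite fineK; last first.
    apply: fin; apply: measurableI; rewrite preimage_ray;
    by apply: bigcupT_measurable => r; exact: measurable_prefix.
  rewrite (_ : _ `&` _ = \bigcup_r (prefix evens s r `&` prefix odds t r)).
    apply: nondecreasing_cvg_mu.
    - by move=> r; apply: measurableI; exact: measurable_prefix.
    - by apply: bigcupT_measurable => r; apply: measurableI; exact: measurable_prefix.
    - move=> r r' rr'; apply/subsetPset; apply: setISS; apply/subsetPset.
        exact: nondecreasing_prefix_evens.
      exact: nondecreasing_prefix_odds.
  rewrite !preimage_ray; apply/seteqP; split=> u.
    move=> [[r _ h] [r' _ h']]; exists (maxn r r') => //; split.
      by move/subsetPset : (nondecreasing_prefix_evens s (leq_maxl r r')); apply.
    by move/subsetPset : (nondecreasing_prefix_odds t (leq_maxr r r')); apply.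
  by move=> [r _ [h h']]; split; exists r.
have c2 x : fine (unif [set u | x < start fair (digits u r)]) @[r --> \oo] --> fine (unif (ray x)).
  rewrite -digits_ray; apply: fine_cvg.
  have mx r : measurable [set u : T | x < start fair (digits u r)].
    exact: (measurable_digits _ (fun a => x < start fair a)).
  rewrite (_ : [set u | exists _, _] = \bigcup_r [set u : T | x < start fair (digits u r)]); last first.
    by apply/seteqP; split=> u /= => [[r h]|[r _ h]]; exists r.
  have mU : measurable (\bigcup_r [set u : T | x < start fair (digits u r)]).
    exact: bigcupT_measurable.
  rewrite fineK; last exact: fin.
  apply: nondecreasing_cvg_mu => //.
  apply/nondecreasing_seqP => r; apply/subsetPset => u /=.
  by move=> /lt_le_trans; apply; exact: (start_cons _ (digits u r)).
have mI : measurable (even_part @^-1` ray s `&` odd_part @^-1` ray t).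
  by apply: measurableI; rewrite preimage_ray;
    apply: bigcupT_measurable => r; exact: measurable_prefix.
rewrite -[LHS]fineK; last exact: fin.
rewrite -[unif (ray s)]fineK; last exact: fin.
rewrite -[unif (ray t)]fineK; last exact: fin.
rewrite -EFinM; congr EFin; rewrite (funext (prefix_indep s t)) in c1.
by apply: (cvg_unique (@Rhausdorff R) c1); exact: cvgM.
Qed.

Let rays (f : T -> T) := [set f @^-1` ray s | s in [set: R]].

Let setI_closed_rays f : setI_closed (rays f).
Proof.
move=> _ _ [x _ <-] [y _ <-]; exists (Num.max x y) => //; apply/seteqP; split=> z;
  rewrite /ray /preimage /= !in_itv/= !andbT gt_max.
  by move=> /andP.
by move=> [-> ->].
Qed.

Let sigma_rays f (A : set T) : measurable A -> <<s rays f >> (f @^-1` A).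
Proof.
have -> : rays f = preimage_set_system setT f (@RGenOInfty.G R).
  apply/seteqP; split=> C [].
    by move=> s _ <-; exists (ray s); [exists s|rewrite setTI].
  by move=> D [s ->] <-; exists s => //; rewrite setTI.
rewrite g_sigma_preimageE => mA; exists A; last by rewrite setTI.
by rewrite -[X in X A](@RGenOInfty.measurableE R).
Qed.

(** The ray from -1 plays the part of the whole space: it puts [setT] into the generating family and
    extracts the two marginal laws from the joint one. *)
Let subexpansion_rayT sel : subexpansion sel @^-1` ray (-1) = setT.
Proof.
rewrite -subTset => u _; rewrite preimage_ray; exists 0 => //; rewrite /prefix /=.
by apply: (@lt_le_trans _ _ 0); [rewrite ltrN10|case/andP: (start01 (sel [::]))].
Qed.

Let rayN1 : unif (ray (-1)) = 1%E.
Proof.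
rewrite -(@unif_unit R); apply: unif_eq_on_unit => //.
move=> u /andP[u0 u1]; rewrite /ray /= !in_itv/= u0 u1 andbT; split=> // _.
by apply: lt_le_trans u0; rewrite ltrN10.
Qed.

Let preserves_rays s :
  unif (even_part @^-1` ray s) = unif (ray s) /\ unif (odd_part @^-1` ray s) = unif (ray s).
Proof.
have e := split_rays s (-1); have o := split_rays (-1) s.
by split; [move: e|move: o];
  rewrite /even_part /odd_part subexpansion_rayT ?setIT ?setTI rayN1 ?mule1 ?mul1e.
Qed.

(** Independence is extended from rays to Borel sets in one coordinate, then in the other. *)
Lemma even_odd_independent (A B : set T) : measurable A -> measurable B ->
  unif (even_part @^-1` A `&` odd_part @^-1` B) = (unif A * unif B)%E.
Proof.
move=> mA mB.
have me : measurable_fun setT even_part by exact: measurable_subexpansion.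
have mo : measurable_fun setT odd_part by exact: measurable_subexpansion.
have mpre (f : T -> T) (C : set T) : measurable_fun setT f -> measurable C ->
    measurable (f @^-1` C).
  by move=> mf mC; rewrite -[X in measurable X]setTI; exact: mf.
have raysm f : measurable_fun setT f -> rays f `<=` measurable.
  by move=> mf _ [s _ <-]; exact: mpre.
have law f (mf : measurable_fun setT f) : (forall s, unif (f @^-1` ray s) = unif (ray s)) ->
    forall C, measurable C -> unif (f @^-1` C) = unif C.
  move=> fr C mC; pose F := HB.pack f (isMeasurableFun.Build _ _ _ _ f mf) : {RV unif >-> T}.
  exact: (@probability_unique_rays R (distribution unif F) unif fr C mC).
have le := law _ me (fun s => (preserves_rays s).1).
have lo := law _ mo (fun s => (preserves_rays s).2).
have evT : rays even_part setT by exists (-1) => //; exact: subexpansion_rayT.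
have odT : rays odd_part setT by exists (-1) => //; exact: subexpansion_rayT.
have h1 t : unif (even_part @^-1` A `&` odd_part @^-1` ray t) = (unif A * unif (ray t))%E.
  rewrite (independent_generated (raysm _ me) (setI_closed_rays (f := _)) evT (mpre _ _ mo (measurable_ray t)))
    ?le ?lo//; last exact: sigma_rays.
  by move=> _ [s _ <-]; rewrite split_rays le ?lo.
have h2 : unif (odd_part @^-1` B `&` even_part @^-1` A) =
    (unif (odd_part @^-1` B) * unif (even_part @^-1` A))%E.
  have h := @independent_generated R _ T unif (rays odd_part) (even_part @^-1` A)
    (raysm _ mo) (@setI_closed_rays odd_part) odT (mpre _ _ me mA).
  apply: h; last exact: sigma_rays.
  by move=> _ [s _ <-]; rewrite setIC h1 (le _ mA) (lo _ (measurable_ray s)) muleC.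
by rewrite setIC h2 (le _ mA) (lo _ mB) muleC.
Qed.

End splitting_a_uniform_variable.

Lemma measure_eq_off_null {R : realType} d (T : measurableType d)
    (P : probability T R) (A B N : set T) :
  measurable A -> measurable B -> measurable N -> P N = 0%E ->
  (forall x, ~ N x -> A x <-> B x) -> P A = P B.
Proof.
move=> mA mB mN N0 AB; have iA := @integral_indic _ _ _ P setT measurableT _ mA.
have iB := @integral_indic _ _ _ P setT measurableT _ mB.
rewrite -(setIT A) -(setIT B) -iA -iB; apply: ae_eq_integral => //.
- exact/measurable_EFinP/measurable_indic.
- exact/measurable_EFinP/measurable_indic.
exists N; split=> // x /= nAB; apply: contrapT => nN.
apply: nAB => _; rewrite !indicE (_ : (x \in A) = (x \in B))//.
by apply/idP/idP; rewrite !inE; case: (AB x nN).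
Qed.

(** * Completion of a probability measure *)

Section completion.
Context {R : realType} d (T : measurableType d) (nu : probability T R).

Definition completion : measurableType _ := caratheodory_type (nu^*)%mu.

Let completionT : @completed_measure_extension _ T _ nu setT = 1%E.
Proof.
by rewrite -(@probability_setT _ _ _ nu); exact: measurable_mu_extE.
Qed.

HB.instance Definition _ := Measure_isProbability.Build _ completion _
  (@completed_measure_extension _ _ _ nu) completionT.

Definition completed : probability completion R := @completed_measure_extension _ _ _ nu.

Lemma completedE (A : set T) : measurable A -> completed A = nu A.
Proof. exact: measurable_mu_extE. Qed.

Lemma measurable_completion (A : set T) : measurable A -> measurable (A : set completion).
Proof. by move=> mA; apply: sub_caratheodory; exact: sub_sigma_algebra. Qed.

Lemma complete_completed : measure_is_complete completed.
Proof. exact: measure_is_complete_caratheodory. Qed.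

(** The intersection over [n] of the unions of covers whose total mass exceeds the outer measure by
    less than [n.+1%:R^-1]. *)
Let outer_hull (A : set T) : exists B : set T,
  [/\ measurable B, A `<=` B & (nu B <= mu_ext nu A)%E].
Proof.
have fin : mu_ext nu A \is a fin_num.
  rewrite ge0_fin_numE; last exact: mu_ext_ge0.
  apply: (@le_lt_trans _ _ (mu_ext nu setT)); first exact: le_mu_ext.
  by rewrite measurable_mu_extE//= [X in (X < _)%E]probability_setT ltry.
have cover n : exists F : (set T)^nat, measurable_cover A F /\
    (\sum_(k <oo) nu (F k) < mu_ext nu A + n.+1%:R^-1%:E)%E.
  have n0 : (0 < n.+1%:R^-1 :> R) by rewrite invr_gt0.
  have [_ [F cF <-] h] := lb_ereal_inf_adherent n0 fin.
  by exists F.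
have [F FP] := choice cover.
have mF n k : measurable (F n k) := cover_measurable (FP n).1 k.
have mUF n : measurable (\bigcup_k F n k) by exact: bigcupT_measurable.
exists (\bigcap_n \bigcup_k F n k); split.
- exact: bigcapT_measurable.
- by move=> x Ax n _; exact: cover_subset (FP n).1 _ Ax.
apply/lee_addgt0Pr => /= e e0.
have [n _ /(_ n (leqnn n)) hn] := near_infty_natSinv_lt (PosNum e0).
apply: (@le_trans _ _ (nu (\bigcup_k F n k))).
  apply: le_measure; rewrite ?inE//; first exact: bigcapT_measurable.
  by move=> x; apply.
apply: (@le_trans _ _ (\sum_(k <oo) nu (F n k))%E).
  exact: measure_sigma_subadditive.
apply: (le_trans (ltW (FP n).2)); rewrite leeD2l// lee_fin; exact: ltW.
Qed.

(** [B] is a hull of [A] and has the same measure, so the difference is null; [C] is a hull of that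
    difference. *)
Lemma completion_measurableP (A : set completion) : measurable A ->
  exists B C : set T, [/\ measurable B, measurable C, nu C = 0%E,
    A `<=` B & forall x, B x -> ~ C x -> A x].
Proof.
move=> mA; have [B [mB AB nB]] := outer_hull A.
have mBc := measurable_completion mB.
have BA : completed B = completed A.
  apply/eqP; rewrite eq_le; apply/andP; split; first by rewrite completedE.
  by apply: le_measure; rewrite ?inE.
have BA0 : completed (B `\` A) = 0%E.
  have -> : completed (B `\` A) = (completed B - completed A)%E.
    rewrite [LHS]measureD ?setIidr//.
    by apply: (le_lt_trans (probability_le1 completed mBc)); rewrite ltry.
  rewrite BA subee//; exact: fin_num_measure.
have [C [mC BAC nC]] := outer_hull (B `\` A).
exists B, C; split=> //.
  by apply/eqP; rewrite -measure_le0 (le_trans nC)// -BA0.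
by move=> x Bx nCx; apply: contrapT => nAx; apply: nCx; exact: BAC.
Qed.

Variable f : T -> T.
Hypotheses (mf : measurable_fun setT f)
  (f_preserves : forall B, measurable B -> nu (f @^-1` B) = nu B).

Let mpre (B : set T) : measurable B -> measurable (f @^-1` B).
Proof. by move=> mB; rewrite -[X in measurable X]setTI; exact: mf. Qed.

(** The set [A] is Borel up to a subset of a null Borel set [C]. Since [f] preserves the measure,
    the preimage of [C] is null, and completeness absorbs what lies inside it. *)
Lemma measurable_fun_completion : measurable_fun setT (f : completion -> completion).
Proof.
move=> _ A mA; rewrite setTI.
have [B [C [mB mC C0 AB BCA]]] := completion_measurableP mA.
rewrite (_ : f @^-1` A = f @^-1` (B `\` C) `|` (f @^-1` A `&` f @^-1` C)).
  apply: measurableU; first by apply/measurable_completion/mpre; exact: measurableD.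
  apply: complete_completed; exists (f @^-1` C); split.
  - exact/measurable_completion/mpre.
  - by rewrite [LHS]completedE ?f_preserves//; exact: mpre.
  - by move=> x [].
apply/seteqP; split=> x.
  move=> fA; have [fC|nfC] := pselect (C (f x)); first by right.
  by left; split=> //; exact: AB.
by move=> [[fB nfC]|[]//]; exact: BCA.
Qed.

End completion.

(** * The completed interval and its independent variables *)

Section independent_uniform_variables.
Context {R : realType}.

(** A standard Lebesgue space has to be complete, hence the completion. The underlying set is the
    whole line, with all its mass on the unit interval. *)
Definition interval_space : measurableType _ := completion (@unif R).
Local Notation X := interval_space.
Definition leb : probability X R := completed (@unif R).

Lemma lebE (A : set (measurableTypeR R)) : measurable A -> leb A = unif A.
Proof. exact: completedE. Qed.

Lemma measurable_funX d (T : measurableType d) (f : measurableTypeR R -> T) :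
  measurable_fun setT f -> measurable_fun setT (f : X -> T).
Proof.
by move=> mf _ A mA; apply: measurable_completion; exact: mf.
Qed.

Let me_ : measurable_fun setT (even_part : measurableTypeR R -> measurableTypeR R).
Proof. exact: measurable_subexpansion. Qed.
Let mo_ : measurable_fun setT (odd_part : measurableTypeR R -> measurableTypeR R).
Proof. exact: measurable_subexpansion. Qed.

Let even_preserves (B : set (measurableTypeR R)) : measurable B ->
  unif (even_part @^-1` B) = unif B.
Proof.
move=> mB; have := even_odd_independent mB measurableT.
by rewrite preimage_setT setIT [X in (_ * X)%E]probability_setT mule1.
Qed.

Let odd_preserves (B : set (measurableTypeR R)) : measurable B ->
  unif (odd_part @^-1` B) = unif B.
Proof.
move=> mB; have := even_odd_independent measurableT mB.
by rewrite preimage_setT setTI [X in (X * _)%E]probability_setT mul1e.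
Qed.

Lemma measurable_even_part : measurable_fun setT (even_part : X -> X).
Proof. exact: measurable_fun_completion me_ even_preserves. Qed.

Lemma measurable_odd_part : measurable_fun setT (odd_part : X -> X).
Proof. exact: measurable_fun_completion mo_ odd_preserves. Qed.

Let preX (f : X -> X) (A : set X) : measurable_fun setT f -> measurable A -> measurable (f @^-1` A).
Proof. by move=> mf mA; rewrite -[X in measurable X]setTI; exact: mf. Qed.

(** Each set is replaced by a Borel hull; the preimages of the two null sets of error are null
    because both parts preserve the measure. *)
Lemma even_odd_leb (A B : set X) : measurable A -> measurable B ->
  leb (even_part @^-1` A `&` odd_part @^-1` B) = (leb A * leb B)%E.
Proof.
move=> mA mB.
have [A0 [C [mA0 mC C0 AA0 A0A]]] := completion_measurableP mA.
have [B0 [D [mB0 mD D0 BB0 B0B]]] := completion_measurableP mB.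
have approx (E : set X) (E0 C' : set (measurableTypeR R)) : measurable E -> measurable E0 ->
    measurable C' -> unif C' = 0%E -> E `<=` E0 -> (forall x, E0 x -> ~ C' x -> E x) ->
    leb E = unif E0.
  move=> mE mE0 mC' C'0 EE0 E0E; rewrite -lebE//.
  apply: (@measure_eq_off_null _ _ _ leb _ _ C' mE (measurable_completion _ mE0)
    (measurable_completion _ mC')); first by rewrite [LHS]lebE.
  by move=> x nC; split=> [/EE0//|Ex]; exact: E0E.
have eqA : leb A = unif A0 by exact: approx mC C0 AA0 A0A.
have eqB : leb B = unif B0 by exact: approx mD D0 BB0 B0B.
have bpre (f : measurableTypeR R -> measurableTypeR R) (E : set (measurableTypeR R)) :
    measurable_fun setT f -> measurable E -> measurable (f @^-1` E).
  by move=> mf mE; rewrite -[X in measurable X]setTI; exact: mf.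
rewrite eqA eqB -even_odd_independent// -[RHS]lebE; last first.
  by apply: measurableI; exact: bpre.
have mN : measurable (even_part @^-1` C `|` odd_part @^-1` D : set (measurableTypeR R)).
  by apply: measurableU; exact: bpre.
apply: (@measure_eq_off_null _ _ _ leb _ _ _ _ _ (measurable_completion _ mN)).
- exact: measurableI (preX measurable_even_part mA) (preX measurable_odd_part mB).
- by apply: measurable_completion; apply: measurableI; exact: bpre.
- rewrite [LHS]lebE//; apply/eqP; rewrite -measure_le0.
  apply: (@le_trans _ _ (unif (even_part @^-1` C) + unif (odd_part @^-1` D))%E).
    by apply: measureU2; exact: bpre.
  by rewrite even_preserves// odd_preserves// C0 D0 adde0.
move=> x /not_orP[nC nD]; split=> -[h1 h2]; split.
- exact: AA0.
- exact: BB0.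
- exact: A0A.
- exact: B0B.
Qed.

Definition unif_seq (i : nat) : X -> X := even_part \o iter i odd_part.

Lemma measurable_unif_seq i : measurable_fun setT (unif_seq i).
Proof.
elim: i => [|i IH]; first exact: measurable_even_part.
rewrite (_ : unif_seq i.+1 = unif_seq i \o odd_part).
  exact: measurableT_comp IH measurable_odd_part.
by apply/funext => u; rewrite /unif_seq /= -iterS iterSr.
Qed.

HB.instance Definition _ i := isMeasurableFun.Build _ _ _ _ (unif_seq i) (measurable_unif_seq i).

Definition box (n : nat) (A : nat -> set X) : set X :=
  [set u | forall i, (i < n)%N -> A i (unif_seq i u)].

Lemma measurable_box n A : (forall i, measurable (A i)) -> measurable (box n A).
Proof.
move=> mA; rewrite (_ : box n A = \bigcap_(i in `I_n) (unif_seq i @^-1` A i)).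
  by apply: bigcap_measurableType => i _; exact: preX (measurable_unif_seq i) (mA i).
by apply/seteqP; split=> u h i; exact: h.
Qed.

(** Peeling off the first coordinate: it is the even part, and the remaining coordinates form the
    same sequence evaluated at the odd part. *)
Lemma leb_box n A : (forall i, measurable (A i)) ->
  leb (box n A) = (\prod_(i < n) fine (leb (A i)))%:E.
Proof.
elim: n A => [|n IH] A mA.
  rewrite big_ord0 (_ : box 0 A = setT) ?probability_setT//.
  by rewrite -subTset => u _ i.
rewrite (_ : box n.+1 A = even_part @^-1` A 0 `&` odd_part @^-1` (box n (A \o succn))).
  have mA' i : measurable ((A \o succn) i) := mA i.+1.
  rewrite (even_odd_leb (mA 0) (measurable_box n mA')) (IH _ mA') big_ord_recl EFinM fineK//.
  exact: fin_num_measure.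
apply/seteqP; split=> u.
  move=> h; split; first exact: (h 0).
  by move=> i ni; have := h i.+1 ni; rewrite /unif_seq /= -iterS iterSr.
move=> [h0 h] [|i] ni; first exact: h0.
by have := h i ni; rewrite /unif_seq /= -iterSr iterS.
Qed.

Lemma leb_unif_seq i A : measurable A -> leb (unif_seq i @^-1` A) = leb A.
Proof.
move=> mA; pose A' j := if j == i then A else setT.
have mA' j : measurable (A' j) by rewrite /A'; case: ifP.
rewrite (_ : _ @^-1` _ = box i.+1 A').
  rewrite leb_box// (bigD1 ord_max)//= big1 ?mulr1 => [|j ji].
    by rewrite /A' eqxx fineK//; exact: fin_num_measure.
  rewrite /A' (_ : (_ == i) = false); first by rewrite [X in fine X]probability_setT.
  by apply/negbTE; apply: contra ji => /eqP ji; apply/eqP/val_inj.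
apply/seteqP; split=> u.
  by move=> h j _; rewrite /A'; case: eqP => [->|].
by move/(_ i (leqnn _)); rewrite /A' eqxx.
Qed.

(** Boxes that constrain only coordinates in [I]: an intersection-closed family that generates
    [sigma_seq I]. *)
Definition boxes (I : set nat) : set (set X) :=
  [set S | exists n A, [/\ forall i, measurable (A i),
     forall i, ~ ((i < n)%N /\ I i) -> A i = setT & S = box n A]].

Lemma boxes_measurable I : boxes I `<=` measurable.
Proof. by move=> _ [n [A [mA _ ->]]]; exact: measurable_box. Qed.

Lemma boxes_setT I : boxes I setT.
Proof.
exists 0, (fun=> setT); split=> //.
by apply/seteqP; split=> u.
Qed.

Lemma setI_closed_boxes I : setI_closed (boxes I).
Proof.
move=> _ _ [n [A [mA AT ->]]] [n' [A' [mA' AT' ->]]].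
exists (maxn n n'), (fun i => A i `&` A' i); split=> [i|i nI|].
- exact: measurableI.
- by rewrite AT ?AT' ?setIT// => -[h Ii]; apply: nI; rewrite leq_max h ?orbT.
apply/seteqP; split=> u.
  move=> [h h'] i _; split.
    have [ni|ni] := ltnP i n; first exact: h.
    by rewrite AT// => -[]; rewrite ltnNge ni.
  have [ni|ni] := ltnP i n'; first exact: h'.
  by rewrite AT'// => -[]; rewrite ltnNge ni.
move=> h; split=> i ni.
  by have [] := h i; rewrite ?leq_max ?ni.
by have [] := h i; rewrite ?leq_max ?ni ?orbT.
Qed.

Definition sigma_seq (I : set nat) : set (set X) :=
  <<s \bigcup_(i in I) preimage_set_system setT (unif_seq i) measurable >>.

Lemma boxes_preimage (I : set nat) i A : I i -> measurable A -> boxes I (unif_seq i @^-1` A).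
Proof.
move=> Ii mA; exists i.+1, (fun j => if j == i then A else setT); split=> [j|j|].
- by case: ifP.
- by case: eqP => // -> []; split.
apply/seteqP; split=> u.
  by move=> h j _; case: eqP => [->|].
by move/(_ i (leqnn _)); rewrite eqxx.
Qed.

Lemma sigma_seq_boxes I : sigma_seq I `<=` <<s boxes I >>.
Proof.
apply: smallest_sub; first exact: smallest_sigma_algebra.
move=> _ [i Ii [A mA <-]]; rewrite setTI; apply: sub_sigma_algebra.
exact: boxes_preimage.
Qed.

Let box_widen n n' A : (n <= n')%N -> (forall i, (n <= i)%N -> A i = setT) -> box n A = box n' A.
Proof.
move=> nn' AT; apply/seteqP; split=> u h i ni; last by apply: h; exact: leq_trans nn'.
by have [ni'|ni'] := ltnP i n; [exact: h|rewrite AT].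
Qed.

Let boxes_independent (I J : set nat) S S' : I `&` J = set0 -> boxes I S -> boxes J S' ->
  leb (S `&` S') = (leb S * leb S')%E.
Proof.
move=> IJ [n [A [mA AT ->]]] [n' [A' [mA' AT' ->]]].
rewrite (@box_widen n (maxn n n') A) ?leq_maxl//; last first.
  by move=> i ni; apply: AT => -[]; rewrite ltnNge ni.
rewrite (@box_widen n' (maxn n n') A') ?leq_maxr//; last first.
  by move=> i ni; apply: AT' => -[]; rewrite ltnNge ni.
rewrite (_ : box _ A `&` box _ A' = box (maxn n n') (fun i => A i `&` A' i)); last first.
  by apply/seteqP; split=> u; [move=> [h h'] i ni; split; [exact: h|exact: h']
    |move=> h; split=> i ni; have [] := h i ni].
have lT : fine (leb setT) = 1 by rewrite [X in fine X]probability_setT.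
rewrite !leb_box// -?EFinM ?big_split/=; last by move=> i; exact: measurableI.
rewrite -big_split; congr (_%:E); apply: eq_bigr => i _ /=.
have [Ii|nIi] := pselect (I i).
  rewrite (AT' i) ?setIT ?lT ?mulr1// => -[_ Ji].
  by have : (I `&` J) i by []; rewrite IJ.
by rewrite (AT i) ?setTI ?lT ?mul1r// => -[].
Qed.

(** Two boxes over disjoint index sets constrain different coordinates of a common box, so their
    masses multiply. The passage to generated sigma-algebras is made on one side at a time. *)
Lemma sigma_seq_independent (I J : set nat) (D D' : set X) : I `&` J = set0 ->
  sigma_seq I D -> sigma_seq J D' -> leb (D `&` D') = (leb D * leb D')%E.
Proof.
move=> IJ /sigma_seq_boxes sD /sigma_seq_boxes sD'.
have mD : measurable D.
  by apply: smallest_sub sD; [exact: sigma_algebra_measurable|exact: boxes_measurable].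
have h S' : boxes J S' -> leb (D `&` S') = (leb D * leb S')%E.
  move=> JS'; have h := @independent_generated R _ X leb (boxes I) S'
    (@boxes_measurable I) (@setI_closed_boxes I) (boxes_setT I) (boxes_measurable JS').
  by apply: h; [move=> S IS; exact: boxes_independent IJ IS JS'|exact: sD].
have h' := @independent_generated R _ X leb (boxes J) D
  (@boxes_measurable J) (@setI_closed_boxes J) (boxes_setT J) mD.
by rewrite setIC muleC; apply: h'; [move=> S JS; rewrite setIC h// muleC|exact: sD'].
Qed.

Lemma sigma_seq_preimage (I : set nat) i A : I i -> measurable A ->
  sigma_seq I (unif_seq i @^-1` A).
Proof.
by move=> Ii mA; apply: sub_sigma_algebra; exists i => //; exists A; rewrite ?setTI.
Qed.

End independent_uniform_variables.

(** * The graph and the random graph it generates *)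

Section integration_over_independent_variables.
Context {R : realType} d0 (T : measurableType d0) (P : probability T R)
  d1 (Y1 : measurableType d1) d2 (Y2 : measurableType d2) (Q : probability Y2 R).
Variables (Z1 : T -> Y1) (Z2 : T -> Y2).
Hypotheses (mZ1 : measurable_fun setT Z1) (mZ2 : measurable_fun setT Z2).
Hypothesis indep : forall A B, measurable A -> measurable B ->
  (P (Z1 @^-1` A `&` Z2 @^-1` B) = P (Z1 @^-1` A) * Q B)%E.
Variable F : Y1 * Y2 -> R.
Hypotheses (mF : measurable_fun setT F) (F01 : forall y, 0 <= F y <= 1).

Lemma bmeas01 d (T' : measurableType d) (g : T' -> R) :
  measurable_fun setT g -> (forall x, 0 <= g x <= 1) -> bmeas g.
Proof.
by move=> mg g01; split=> //; exists 1 => x; have /andP[? ?] := g01 x; rewrite ger0_norm.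
Qed.

(** The joint law of [Z1] and [Z2] is a product measure, so Tonelli applies. [Y1] may be the sample
    space itself with a smaller sigma-algebra and [Z1] the identity; in this form the lemma
    expresses conditioning. *)
Lemma E_independent :
  E P (fun t => F (Z1 t, Z2 t)) = E P (fun t => E Q (fun v => F (Z1 t, v))).
Proof.
have mZ : measurable_fun setT (fun t => (Z1 t, Z2 t)) by exact: measurable_fun_pair.
pose Z := HB.pack (fun t => (Z1 t, Z2 t)) (isMeasurableFun.Build _ _ _ _ _ mZ) : {RV P >-> (Y1 * Y2)%type}.
pose W := HB.pack Z1 (isMeasurableFun.Build _ _ _ _ _ mZ1) : {RV P >-> Y1}.
have mFE : measurable_fun setT (EFin \o F) by exact/measurable_EFinP.
have F0 y : (0 <= (EFin \o F) y)%E by rewrite lee_fin; case/andP: (F01 y).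
have mF2 y : measurable_fun setT (fun v => F (y, v)).
  exact: (measurableT_comp mF (pair1_measurable y)).
have bF2 y : bmeas (fun v => F (y, v)) by apply: bmeas01.
have inner y : (\int[Q]_v (EFin \o F) (y, v) = (E Q (fun v => F (y, v)))%:E)%E.
  exact: E_EFin.
have bFZ : bmeas (fun t => F (Z1 t, Z2 t)).
  by apply: bmeas01 => //; exact: (measurableT_comp mF mZ).
have law A : measurable A -> distribution P Z A = (distribution P W \x Q)%E A.
  move=> mA; apply/esym; apply: product_measure_unique => // B C mB mC.
apply: EFin_inj; rewrite -E_EFin//.
transitivity (\int[distribution P Z]_z (EFin \o F) z)%E.
  by rewrite ge0_integral_distribution.
rewrite (eq_measure_integral (distribution P W \x Q)%E) => [|A mA _]; last exact: law.
rewrite fubini_tonelli1// ge0_integral_distribution//; last 2 first.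
- exact: measurable_fun_fubini_tonelli_F.
- by move=> y; apply: integral_ge0.
under eq_integral do rewrite /= /fubini_F inner.
apply: E_EFin; apply: bmeas01.
  have mG0 : measurable_fun setT (fubini_F Q (EFin \o F)).
    exact: measurable_fun_fubini_tonelli_F.
  exact: (measurableT_comp (@fine_measurable R _ measurableT) (measurableT_comp mG0 mZ1)).
move=> t; apply/andP; split; first by apply: E_ge0 => v; case/andP: (F01 (Z1 t, v)).
rewrite -[leRHS](E_cst Q); apply: E_le => //; first exact: bmeas_cst.
by move=> v; case/andP: (F01 (Z1 t, v)).
Qed.

End integration_over_independent_variables.

(** * Averaging out a coin *)

Section conditional_bernoulli.
Context {R : realType}.
Local Notation X := (interval_space (R := R)).

(** The sample space with a smaller sigma-algebra: measurability over this type says that a function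
    depends only on the variables with index in [I]. *)
Definition sigma_type (I : set nat) : measurableType _ :=
  g_sigma_algebraType (\bigcup_(i in I) preimage_set_system setT (@unif_seq R i) measurable).

Lemma sigma_seq_measurable (I : set nat) : sigma_seq I `<=` @measurable _ X.
Proof.
apply: smallest_sub; first exact: sigma_algebra_measurable.
by move=> _ [i Ii [A mA <-]]; exact: measurable_unif_seq.
Qed.

Lemma measurable_from_sigma_type (I : set nat) d (T : measurableType d) (f : X -> T) :
  measurable_fun setT (f : sigma_type I -> T) -> measurable_fun setT f.
Proof. by move=> mf _ A mA; apply: (@sigma_seq_measurable I); exact: mf. Qed.

Let ray_indic (c : R) : (fun v : X => ((v : R) < c)%R%:R) = \1_([set` `]-oo, c[] : set X) :> (X -> R).
Proof.
apply/funext => v; rewrite indicE; congr (_%:R)%R; congr nat_of_bool.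
by apply/idP/idP; rewrite inE /= in_itv.
Qed.

Let measurable_rayX (c : R) : measurable ([set` `]-oo, c[] : set X).
Proof.
have mU : measurable ([set` `]-oo, c[] : set (measurableTypeR R)) by exact: measurable_itv.
exact: measurable_completion _ mU.
Qed.

Let bmeas_lt (c : R) : bmeas (fun v : X => ((v : R) < c)%R%:R : R).
Proof. by rewrite ray_indic; apply: bmeas_indic; exact: measurable_rayX. Qed.

Lemma leb_lt (c : R) : 0 <= c <= 1 ->
  E (@leb R) (fun v : X => ((v : R) < c)%R%:R) = c.
Proof.
move=> /andP[c0 c1]; rewrite ray_indic E_indic; last exact: measurable_rayX.
rewrite [leb _]lebE// (@unif_eq_on_unit _ _ `[0, c[%classic)//.
  by rewrite unif_itvco// subr0.
move=> u /andP[u0 _] /=; rewrite !in_itv/= u0; by [].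
Qed.

(** The variable [j] is uniform and independent of everything measurable over [I]; with the rest
    fixed, it falls below the threshold [h u] with probability [h u]. *)
Lemma E_bernoulli (I : set nat) j (f h : X -> R) : ~ I j ->
  measurable_fun setT (f : sigma_type I -> R) -> measurable_fun setT (h : sigma_type I -> R) ->
  (forall u, 0 <= f u <= 1) -> (forall u, 0 <= h u <= 1) ->
  E (@leb R) (fun u => f u * ((unif_seq j u : R) < h u)%R%:R) = E (@leb R) (fun u => f u * h u).
Proof.
move=> nIj mf mh f01 h01.
pose F (y : sigma_type I * X) : R := f y.1 * ((y.2 : R) < h y.1)%R%:R.
have mi : measurable_fun setT (id : X -> measurableTypeR R).
  by apply: measurable_funX; exact: measurable_id.
have mF : measurable_fun setT F.
  apply: measurable_funM; first exact: (measurableT_comp mf measurable_fst).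
  have mb : measurable_fun setT (fun y : sigma_type I * X => (y.2 : R) < h y.1).
    apply: measurable_fun_ltr; last exact: (measurableT_comp mh measurable_fst).
    exact: (measurableT_comp mi measurable_snd).
  rewrite (_ : (fun y => _) = \1_[set y : sigma_type I * X | (y.2 : R) < h y.1]).
    apply: measurable_indic; have := mb measurableT [set true] Logic.I; rewrite setTI; exact.
  apply/funext => y; rewrite indicE; congr (_%:R)%R; congr nat_of_bool.
  by apply/idP/idP; rewrite inE.
have mid : measurable_fun setT (id : X -> sigma_type I).
  by move=> _ A mA; rewrite setTI; exact: (@sigma_seq_measurable I).
have := @E_independent R _ X (@leb R) _ (sigma_type I) _ X (@leb R) id (unif_seq j)
  mid (measurable_unif_seq j) _ F mF _.
rewrite /F /= => ->.
- congr (E _ _); apply/funext => t; rewrite EZ ?leb_lt//.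
- move=> A B mA mB; rewrite (@sigma_seq_independent R I [set j])//.
  + by congr (_ * _)%E; exact: leb_unif_seq.
  + by apply/seteqP; split=> // i [/= Ii ij]; apply: nIj; rewrite -ij.
  + exact: sigma_seq_preimage.
move=> y; have /andP[a b] := f01 y.1; case: (_ < _); by rewrite ?mulr1 ?mulr0 ?lexx ?ler01 ?a.
Qed.

End conditional_bernoulli.

Section vertex_variables.
Context {R : realType}.
Local Notation X := (interval_space (R := R)).
Local Notation leb := (@leb R).

Definition vertex (i : nat) : {RV leb >-> X} := unif_seq i.*2.

Lemma measurable_unif_seq_sigma (I : set nat) i : I i ->
  measurable_fun setT (unif_seq i : sigma_type I -> X).
Proof.
move=> Ii _ A mA; apply: sub_sigma_algebra; exists i => //; exists A => //.
Qed.

Lemma vertex_independent (s : seq nat) (A : nat -> set X) : uniq s ->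
  (forall i, measurable (A i)) ->
  leb [set u | forall i, i \in s -> A i (vertex i u)] = (\prod_(i <- s) fine (leb (A i)))%:E.
Proof.
move=> us mA; elim: s us => [|i s IH] /=.
  by rewrite big_nil (_ : [set _ | _] = setT) ?probability_setT// -subTset.
move=> /andP[si us]; rewrite big_cons EFinM -(IH us) fineK; last exact: fin_num_measure.
pose I : set nat := [set j.*2 | j in [set j | j \in s]].
set D := [set u | forall j, j \in s -> A j (vertex j u)].
have sD : sigma_seq I D.
  rewrite -[sigma_seq I D]/(measurable (D : set (sigma_type I))).
  rewrite (_ : D = \bigcap_(j in [set j | j \in s]) (vertex j @^-1` A j)) //.
  apply: bigcap_measurableType => j js.
  have := @measurable_unif_seq_sigma I j.*2; rewrite -[X in measurable X]setTI; apply => //.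
  by exists j.
rewrite muleC -(leb_unif_seq i.*2 (mA i)) -(@sigma_seq_independent R I [set i.*2])//; last 2 first.
- apply/seteqP; split=> // _ [[j js <-] /double_inj ji]; move: js.
  by rewrite /= ji (negbTE si).
- exact: sigma_seq_preimage.
congr (leb _); apply/seteqP; split=> u.
  move=> h; split; last by apply: h; rewrite inE eqxx.
  by move=> j js; apply: h; rewrite inE js orbT.
by move=> [h hi] j; rewrite inE => /orP[/eqP->//|]; exact: h.
Qed.

Lemma vertex_law i A : measurable A -> leb (vertex i @^-1` A) = leb A.
Proof. exact: leb_unif_seq. Qed.

End vertex_variables.

(** * Labels of random vertices *)

Section cell_labels.
Context {R : realType}.
Local Notation X := (interval_space (R := R)).
Local Notation leb := (@leb R).
Variable m : seq bool -> R.
Hypotheses (m_ge0 : forall a, 0 <= m a) (m_nil : m [::] = 1)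
  (m_cons : forall a, m a = m (true :: a) + m (false :: a)).

Definition label (n : nat) (u : X) : n.-tuple bool :=
  Tuple (introT eqP (size_code m (u : R) n)).

Let labelE n a : [set u | label n u = a] = [set u : X | code m (u : R) n = a].
Proof.
by apply/seteqP; split=> u /= => [<-//|h]; apply/val_inj.
Qed.

Lemma measurable_label n a : measurable [set u : X | label n u = a].
Proof.
rewrite labelE; exact: measurable_completion (measurable_code m n a).
Qed.

Lemma leb_label n a : leb [set u : X | label n u = a] = (m a)%:E.
Proof.
rewrite labelE [LHS]lebE; last exact: measurable_code.
by have := unif_code m_ge0 m_nil m_cons a; rewrite size_tuple => ->.
Qed.

(** Distinct vertices have independent labels with law [m]. The right-hand side is the kind of sum
    that the counting estimate for the limit object compares with [p S]. *)
Lemma E_labels k n (F : {ffun 'I_k -> n.-tuple bool} -> R) :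
  E leb (fun u => F [ffun i : 'I_k => label n (vertex i u)]) =
  \sum_(t : {ffun 'I_k -> n.-tuple bool}) (\prod_i m (t i)) * F t.
Proof.
pose A (t : {ffun 'I_k -> n.-tuple bool}) (i : nat) : set X :=
  if insub i is Some j then [set u : X | label n u = t j] else setT.
have mA t i : measurable (A t i).
  by rewrite /A; case: insub => // j; exact: measurable_label.
pose S t := [set u | forall i, i \in iota 0 k -> A t i (vertex i u)].
have mS t : measurable (S t).
  rewrite (_ : S t = \bigcap_(i in [set i | i \in iota 0 k]) (vertex i @^-1` A t i)) //.
  apply: bigcap_measurableType => i _; rewrite -[X in measurable X]setTI.
  exact: measurable_unif_seq.
have ->: (fun u => F [ffun i : 'I_k => label n (vertex i u)]) =
   (fun u => \sum_(t : {ffun 'I_k -> n.-tuple bool}) F t * \1_(S t) u).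
  apply/funext => u; set t0 := [ffun i => _].
  have St t : S t u <-> t = t0.
    split.
      move=> h; apply/ffunP => i; rewrite /t0 ffunE; apply/esym.
      by have := h i; rewrite mem_iota ltn_ord /A valK; apply.
    move=> -> i; rewrite mem_iota add0n => /= ik; rewrite /A insubT /=.
    by rewrite /t0 ffunE.
  rewrite (bigD1 t0)//= big1 ?addr0 => [|t tt0]; last first.
    by rewrite indicE memNset ?mulr0// => /St; apply/eqP.
  by rewrite indicE mem_set ?mulr1//; apply/St.
have bS t : bmeas (fun u : X => F t * \1_(S t) u).
  by apply: bmeasM; [exact: bmeas_cst|exact: bmeas_indic].
rewrite E_sum; last by move=> t; exact: bS.
apply: eq_bigr => t _; rewrite EZ; last exact: bmeas_indic.
rewrite E_indic// [leb _](vertex_independent (iota_uniq 0 k) (mA t)) mulrC; congr (_ * _).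
rewrite /= (_ : iota 0 k = index_iota 0 k); last by rewrite /index_iota subn0.
rewrite big_mkord.
by apply: eq_bigr => i _; rewrite /A valK leb_label.
Qed.

(** The case of two vertices, for the sums that express differences of energies. *)
Lemma E_label_pair i j n (F : n.-tuple bool -> n.-tuple bool -> R) : i != j ->
  E leb (fun u => F (label n (vertex i u)) (label n (vertex j u))) =
  \sum_(a : n.-tuple bool) \sum_(b : n.-tuple bool) m a * m b * F a b.
Proof.
move=> ij; pose S a b := [set u | label n (vertex i u) = a /\ label n (vertex j u) = b].
pose A a b (i' : nat) := [set u : X | label n u = if i' == i then a else b].
have mA a b i' : measurable (A a b i') by exact: measurable_label.
have SE a b : S a b = [set u | forall i', i' \in [:: i; j] -> A a b i' (vertex i' u)].
  apply/seteqP; split=> u.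
    move=> [h1 h2] i'; rewrite !inE => /orP[]/eqP ->; rewrite /A /= ?eqxx//.
    by rewrite eq_sym (negbTE ij).
  move=> h; split; first by have := h i; rewrite inE eqxx /A /= eqxx; exact.
  by have := h j; rewrite !inE eqxx orbT /A /= eq_sym (negbTE ij); exact.
have mp i' (C : set X) : measurable C -> measurable (vertex i' @^-1` C).
  by move=> mC; rewrite -[X in measurable X]setTI; exact: measurable_unif_seq.
have mS a b : measurable (S a b).
  exact: measurableI (mp i _ (measurable_label a)) (mp j _ (measurable_label b)).
have lS a b : fine (leb (S a b)) = m a * m b.
  rewrite SE vertex_independent//=; last by rewrite inE ij.
  by rewrite !big_cons big_nil mulr1 /A eqxx [j == i]eq_sym (negbTE ij) /= !leb_label.
have -> : (fun u => F (label n (vertex i u)) (label n (vertex j u))) =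
   (fun u => \sum_(a : n.-tuple bool) \sum_(b : n.-tuple bool) F a b * \1_(S a b) u).
  apply/funext => u; rewrite (bigD1 (label n (vertex i u)))//= (bigD1 (label n (vertex j u)))//=.
  rewrite !big1 ?addr0 => [|a na|b nb].
  - by rewrite indicE mem_set ?mulr1.
  - by rewrite big1// => b _; rewrite indicE memNset ?mulr0// => -[h _]; rewrite h eqxx in na.
  - by rewrite indicE memNset ?mulr0// => -[_ h]; rewrite h eqxx in nb.
have bS a b : bmeas (fun u : X => F a b * \1_(S a b) u).
  by apply: bmeasM; [exact: bmeas_cst|exact: bmeas_indic].
rewrite E_sum; last by move=> a; apply: bmeas_sum => b; exact: bS.
apply: eq_bigr => a _; rewrite E_sum; last by move=> b; exact: bS.
apply: eq_bigr => b _; rewrite EZ; last exact: bmeas_indic.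
by rewrite E_indic// lS mulrC.
Qed.

End cell_labels.

(** * Convergence of the step functions *)

Section graphon.
Context {R : realType}.
Local Notation X := (interval_space (R := R)).
Local Notation leb := (@leb R).
Variables (m : seq bool -> R) (w : seq bool -> seq bool -> R) (e c : nat -> R).
Variable p : forall k, seq ('I_k * 'I_k) -> R.
Hypotheses (m_ge0 : forall a, 0 <= m a) (m_nil : m [::] = 1)
  (m_cons : forall a, m a = m (true :: a) + m (false :: a)).
Hypotheses (w_sym : forall a b, size a = size b -> w a b = w b a)
  (w01 : forall a b, 0 <= w a b <= 1).
Hypotheses (e01 : forall r, 0 <= e r <= 1)
  (e_dist : forall r s, (r <= s)%N ->
     \sum_(a : (s.*2).-tuple bool) \sum_(b : (s.*2).-tuple bool)
       m a * m b * (w a b - w (drop (s - r).*2 a) (drop (s - r).*2 b)) ^+ 2 = e s - e r)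
  (c_ge0 : forall r, 0 <= c r) (c_sum : forall K, \sum_(r < K) c r ^+ 2 <= 1).
Hypothesis w_density : forall k (S : seq ('I_k * 'I_k)) r, simple_edges S ->
  `|\sum_(t : {ffun 'I_k -> (r.*2).-tuple bool}) (\prod_i m (t i)) *
      \prod_(q <- S) w (t q.1) (t q.2) - p S| <= (size S)%:R * c r.

Local Notation label := (label m).

Definition step_graphon r (q : X * X) : R := w (label r.*2 q.1) (label r.*2 q.2).

Lemma step_graphon01 r q : 0 <= step_graphon r q <= 1.
Proof. exact: w01. Qed.

Lemma step_graphon_sym r x y : step_graphon r (x, y) = step_graphon r (y, x).
Proof. by rewrite /step_graphon w_sym// !size_tuple. Qed.

Lemma measurable_step_graphon r : measurable_fun setT (step_graphon r).
Proof.
pose A a : set (X * X) := fst @^-1` [set u : X | label r.*2 u = a].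
pose B a : set (X * X) := snd @^-1` [set u : X | label r.*2 u = a].
have mA a : measurable (A a).
  rewrite -[X in measurable X]setTI.
  by apply: measurable_fst => //; exact: measurable_label.
have mB a : measurable (B a).
  rewrite -[X in measurable X]setTI.
  by apply: measurable_snd => //; exact: measurable_label.
have -> : step_graphon r = fun q => \sum_(a : (r.*2).-tuple bool) \sum_(b : (r.*2).-tuple bool)
    w a b * (\1_(A a) q * \1_(B b) q).
  apply/funext => -[x y]; rewrite (bigD1 (label r.*2 x))//= (bigD1 (label r.*2 y))//=.
  rewrite !big1 ?addr0 => [|a na|b nb].
  - by rewrite !indicE !mem_set ?mulr1.
  - rewrite big1// => b _; rewrite [\1_(A a) _]indicE memNset ?mul0r ?mulr0// => h.
    by rewrite -h eqxx in na.
  - rewrite [\1_(B b) _]indicE memNset ?mulr0// => h.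
    by rewrite -h eqxx in nb.
have [] // := @bmeas_sum R _ (X * X)%type _ (index_enum ((r.*2).-tuple bool))
   (fun a q => \sum_(b : (r.*2).-tuple bool) w a b * (\1_(A a) q * \1_(B b) q)).
move=> a; apply: bmeas_sum => b; apply: bmeasM; first exact: bmeas_cst.
by apply: bmeasM; apply: bmeas_indic.
Qed.

Let e_mono r s : (r <= s)%N -> e r <= e s.
Proof.
move=> rs; rewrite -subr_ge0 -(e_dist rs); apply: sumr_ge0 => a _; apply: sumr_ge0 => b _.
by rewrite mulr_ge0 ?sqr_ge0// mulr_ge0.
Qed.

Lemma E_step_graphon_dist i j r s : i != j -> (r <= s)%N ->
  E leb (fun u => (step_graphon s (vertex i u, vertex j u) -
    step_graphon r (vertex i u, vertex j u)) ^+ 2) = e s - e r.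
Proof.
move=> ij rs; rewrite -(e_dist rs).
rewrite -(E_label_pair m_ge0 m_nil m_cons
  (fun a b => (w a b - w (drop (s - r).*2 a) (drop (s - r).*2 b)) ^+ 2) ij).
congr (E _ _); apply/funext => u; rewrite /step_graphon /=.
have d v : drop (s - r).*2 (code m v s.*2) = code m v r.*2.
  by rewrite -(drop_code m v r.*2 (s - r).*2) -doubleD subnK.
by rewrite !d.
Qed.

(* Along a subsequence on which the energy converges geometrically, the step
   functions converge almost surely and not only in mean square. *)
Let rates_exist : exists rr : nat -> nat, forall j,
  [/\ (j <= rr j)%N, (rr j <= rr j.+1)%N & forall s, (rr j <= s)%N -> e s - e (rr j) <= 4^-1 ^+ j].
Proof.
have hs : has_sup (range e).
  split; first by exists (e 0); exists 0.
  by exists 1 => _ [r _ <-]; case/andP: (e01 r).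
have near_sup j : exists k, sup (range e) - 4^-1 ^+ j < e k.
  have /(sup_gt hs.1)[_ [k _ <-] h] : sup (range e) - 4^-1 ^+ j < sup (range e).
    by rewrite ltrBlDr ltrDl exprn_gt0// invr_gt0.
  by exists k.
have [k kP] := choice near_sup.
(* The sum dominates [k j] and makes the index monotone; the summand [j] makes it at least [j]. *)
exists (fun j => (\sum_(i < j.+1) k i + j)%N) => j; split=> [||s rs].
- exact: leq_addl.
- by rewrite [in leqRHS]big_ord_recr/=; lia.
have kr : (k j <= \sum_(i < j.+1) k i + j)%N by rewrite big_ord_recr/=; lia.
have := e_mono kr; have := kP j.
have : e s <= sup (range e) by apply: ub_le_sup; [exact: hs.2|exists s].
lra.
Qed.

Let rr : nat -> nat := projT1 (cid rates_exist).
Let rrP := projT2 (cid rates_exist).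

(** With an upper limit, symmetry and the bounds hold at every point, while convergence is only
    almost sure. *)
Definition graphon (q : X * X) : R := limn_sup (fun j => step_graphon (rr j) q).

Lemma graphon01 q : 0 <= graphon q <= 1.
Proof. by apply: limn_sup01 => j; exact: step_graphon01. Qed.

Lemma graphon_sym x y : graphon (x, y) = graphon (y, x).
Proof.
by rewrite /graphon; congr (limn_sup _); apply/funext => j; exact: step_graphon_sym.
Qed.

Lemma measurable_graphon : measurable_fun setT graphon.
Proof.
apply: measurable_limn_sup01 => [j|j q]; [exact: measurable_step_graphon|exact: step_graphon01].
Qed.

Let measurable_pair_vertex i j : measurable_fun setT (fun u : X => (vertex i u, vertex j u)).
Proof. by apply: measurable_fun_pair; exact: measurable_unif_seq. Qed.

Let measurable_comp_pair (F : X * X -> R) i j : measurable_fun setT F ->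
  measurable_fun setT (fun u : X => F (vertex i u, vertex j u)).
Proof.
move=> mF _ A mA; rewrite setTI.
have mFA : measurable (F @^-1` A) by rewrite -[X in measurable X]setTI; exact: mF.
by have := measurable_pair_vertex i j measurableT mFA; rewrite setTI.
Qed.

Let bmeas_step r i j : bmeas (fun u => step_graphon r (vertex i u, vertex j u)).
Proof.
apply: bmeas01 => [|u]; last exact: step_graphon01.
by apply: measurable_comp_pair; exact: measurable_step_graphon.
Qed.

Let bmeas_graphon i j : bmeas (fun u => graphon (vertex i u, vertex j u)).
Proof.
apply: bmeas01 => [|u]; last exact: graphon01.
by apply: measurable_comp_pair; exact: measurable_graphon.
Qed.

(** For distinct vertices the mean square of a step is a difference of energies, which is at most
    [4 ^- t] along [rr]. *)
Let step_graphon_cvg i j : i != j -> \forall u \ae leb,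
  step_graphon (rr t) (vertex i u, vertex j u) @[t --> \oo] --> graphon (vertex i u, vertex j u).
Proof.
move=> ij.
have := @ae_cvg _ _ _ leb (fun t u => step_graphon (rr t) (vertex i u, vertex j u)) 1.
case=> [t|t|N [mN N0 sN]].
- exact: bmeas_step.
- have [_ r1 r2] := rrP t; rewrite mul1r E_step_graphon_dist//; exact: r2.
exists N; split=> // u /= nc; apply: sN => /= cu; apply: nc.
by rewrite /graphon cvg_limn_supE.
Qed.

(** The squares of [c] are summable, so [c] tends to 0, also along [rr] because [rr t] is at least
    [t]. *)
Let c_cvg : c (rr t) @[t --> \oo] --> 0.
Proof.
have c2 : (c t ^+ 2) @[t --> \oo] --> 0.
  apply: cvg_series_cvg_0; apply: nondecreasing_is_cvgn.
    by apply: nondecreasing_series => n _ _; exact: sqr_ge0.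
  by exists 1 => _ [K _ <-]; rewrite /series /= big_mkord; exact: c_sum.
have cc : c t @[t --> \oo] --> 0.
  apply/cvgrPdist_lt => eps eps0; have ee : 0 < eps ^+ 2 by rewrite exprn_gt0.
  move/cvgrPdist_lt : c2 => /(_ _ ee); apply: filterS => t.
  rewrite !sub0r !normrN !ger0_norm ?sqr_ge0// => h.
  by rewrite -(ltr_pXn2r (n := 2)) ?nnegrE// ltW.
move/cvgrPdist_lt : cc => cc; apply/cvgrPdist_lt => eps /cc[n _ hn].
by exists n => // t /= nt; apply: hn => /=; rewrite (leq_trans nt)//; case: (rrP t).
Qed.

(** The means of the products of step functions along [rr] have two limits: the mean for the graph,
    by bounded convergence, and [p S], since the counting error is at most [size S] times
    [c (rr t)]. *)
Lemma E_graphon_product k (S : seq ('I_k * 'I_k)) : simple_edges S ->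
  E leb (fun u => \prod_(q <- S) graphon (vertex q.1 u, vertex q.2 u)) = p S.
Proof.
move=> sS; have := sS => /andP[_ /allP oS].
pose F t u := \prod_(q <- S) step_graphon (rr t) (vertex q.1 u, vertex q.2 u).
have c1 : E leb (F t) @[t --> \oo] --> E leb (fun u => \prod_(q <- S) graphon (vertex q.1 u, vertex q.2 u)).
  apply: (@E_cvg _ _ _ leb F _ 1) => [t||t u|].
  - by have [] := @bmeas_prod R _ X _ S (fun q u => step_graphon (rr t) (vertex q.1 u, vertex q.2 u))
      (fun q => bmeas_step (rr t) q.1 q.2).
  - by have [] := @bmeas_prod R _ X _ S (fun q u => graphon (vertex q.1 u, vertex q.2 u))
      (fun q => bmeas_graphon q.1 q.2).
  - have /andP[a b] := prod01 S (g := fun q => step_graphon (rr t) (vertex q.1 u, vertex q.2 u))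
      (fun q => step_graphon01 _ _).
    by rewrite ger0_norm.
  have : \forall u \ae leb, forall q : 'I_k * 'I_k, (q.1 != q.2 :> nat) ->
      step_graphon (rr t) (vertex q.1 u, vertex q.2 u) @[t --> \oo] --> graphon (vertex q.1 u, vertex q.2 u).
    apply: ae_forall_countable => q.
    have [qq|nq] := eqVneq (q.1 : nat) q.2; first exact: aeW.
    have [N [mN N0 sN]] := step_graphon_cvg nq.
    by exists N; split=> // u /= nc; apply: sN => /= cu; apply: nc.
  move=> [N [mN N0 sN]]; exists N; split=> // u /= nc; apply: sN => /= h; apply: nc.
  rewrite /F; elim: S oS {sS F} => [|q S' IH] oS.
    by rewrite big_nil; under eq_fun do rewrite big_nil; exact: cvg_cst.
  rewrite big_cons; under eq_fun do rewrite big_cons; apply: cvgM.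
    by apply: h; rewrite ltn_eqF// oS// inE eqxx.
  by apply: IH => q' q'S; apply: oS; rewrite inE q'S orbT.
apply: (cvg_unique (@Rhausdorff R) c1).
apply/subr_cvg0/norm_cvg0P.
apply: (@squeeze_cvgr _ _ _ _ (cst 0) (fun t => (size S)%:R * c (rr t))).
- apply: nearW => t /=; rewrite normr_ge0 /=.
  apply: le_trans (w_density (rr t) sS).
  rewrite -(E_labels m_ge0 m_nil m_cons (fun t => \prod_(q <- S) w (t q.1) (t q.2))).
  rewrite le_eqVlt; apply/orP; left; apply/eqP; congr (`|E _ _ - _|).
  by apply/funext => u; rewrite /F; apply: eq_bigr => q _; rewrite !ffunE.
- exact: cvg_cst.
- by rewrite -[X in _ --> X](mulr0 (size S)%:R); apply: cvgM => //; exact: cvg_cst.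
Qed.

End graphon.

(** * Sampling the edges *)

Section sampled_graph.
Context {R : realType}.
Local Notation X := (interval_space (R := R)).
Local Notation leb := (@leb R).
Variable W : X * X -> R.
Hypotheses (mW : measurable_fun setT W) (W01 : forall q, 0 <= W q <= 1).

Definition coin (q : nat * nat) : X -> X := unif_seq (choice.pickle q).*2.+1.

Definition edge_prob (q : nat * nat) (u : X) : R := W (vertex q.1 u, vertex q.2 u).

Definition hit (q : nat * nat) (u : X) : bool := (coin q u : R) < edge_prob q u.

Definition sampled_adjacency (u : X) (q : nat * nat) : bool :=
  if (q.1 < q.2)%N then hit q u else if (q.2 < q.1)%N then hit (q.2, q.1) u else false.

Lemma sampled_subproof u : sampled_adjacency u \in is_adjacency.
Proof.
rewrite inE; split=> [i j|i]; rewrite /sampled_adjacency /=; last by rewrite ltnn.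
by case: ltngtP.
Qed.

Definition sampled_graph (u : X) : borel_graph := SigSub (sampled_subproof u).

Lemma edge_sampled u i j : (i < j)%N -> edge (sampled_graph u) i j = hit (i, j) u.
Proof. by move=> ij; rewrite /edge set_valE /= /sampled_adjacency /= ij. Qed.

(** The indices of all vertices and of the coins of the pairs in [S]; [support [::]] belongs to the
    vertices alone. *)
Definition support (S : seq (nat * nat)) : set nat :=
  [set i | (exists k, i = k.*2) \/ (exists2 q, q \in S & i = (choice.pickle q).*2.+1)].

Lemma measurable_sigma_type_sub (I J : set nat) d (T : measurableType d) (f : X -> T) : I `<=` J ->
  measurable_fun setT (f : sigma_type I -> T) -> measurable_fun setT (f : sigma_type J -> T).
Proof.
move=> IJ mf _ A mA; have := mf measurableT A mA; apply: smallest_sub.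
  exact: smallest_sigma_algebra.
by move=> C [i Ii h]; apply: sub_sigma_algebra; exists i => //; exact: IJ.
Qed.

Lemma measurable_edge_prob_sigma S q :
  measurable_fun setT (edge_prob q : sigma_type (support S) -> R).
Proof.
have mv i : measurable_fun setT (vertex i : sigma_type (support S) -> X).
  by apply: measurable_unif_seq_sigma; left; exists i.
have mp := measurable_fun_pair (mv q.1) (mv q.2).
move=> _ A mA; rewrite setTI.
have mWA : measurable (W @^-1` A) by rewrite -[X in measurable X]setTI; exact: mW.
by have := mp measurableT _ mWA; rewrite setTI.
Qed.

Lemma measurable_hit_sigma S q : q \in S ->
  measurable_fun setT (hit q : sigma_type (support S) -> bool).
Proof.
move=> qS; apply: measurable_fun_ltr; last exact: measurable_edge_prob_sigma.
have mc : measurable_fun setT (coin q : sigma_type (support S) -> X).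
  by apply: measurable_unif_seq_sigma; right; exists q.
have mi : measurable_fun setT (id : X -> measurableTypeR R).
  by apply: measurable_funX; exact: measurable_id.
exact: (measurableT_comp mi mc).
Qed.

Lemma measurable_hit q : measurable_fun setT (hit q).
Proof.
apply: (@measurable_from_sigma_type R (support [:: q])).
by apply: measurable_hit_sigma; rewrite inE.
Qed.

Lemma measurable_sampled_graph : measurable_fun setT sampled_graph.
Proof.
apply: measurable_to_borel_graph => i j.
have mh q : measurable [set u | hit q u].
  by have := measurable_hit q measurableT (Y := [set true]) Logic.I; rewrite setTI.
rewrite (_ : [set u | _] = [set u | sampled_adjacency u (i, j)]) //.
rewrite /sampled_adjacency /=; case: ltngtP => // _.
by rewrite (_ : [set u | _] = set0)//; apply/seteqP; split.
Qed.

Definition outcome (b : nat * nat -> bool) q (u : X) : R := (hit q u == b q)%:R.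

Definition outcome_prob (b : nat * nat -> bool) q (u : X) : R :=
  if b q then edge_prob q u else 1 - edge_prob q u.

Lemma outcome01 b q u : 0 <= outcome b q u <= 1.
Proof. by rewrite /outcome; case: (_ == _); rewrite ?lexx ?ler01. Qed.

Lemma outcome_prob01 b q u : 0 <= outcome_prob b q u <= 1.
Proof.
by rewrite /outcome_prob; case: ifP => _; [exact: W01|apply: onem01; exact: W01].
Qed.

Lemma measurable_outcome_prob_sigma S b q :
  measurable_fun setT (outcome_prob b q : sigma_type (support S) -> R).
Proof.
rewrite /outcome_prob; case: (b q); first exact: measurable_edge_prob_sigma.
apply: measurable_funB; [exact: measurable_cst|exact: measurable_edge_prob_sigma].
Qed.

Lemma measurable_outcome_sigma S b q : q \in S ->
  measurable_fun setT (outcome b q : sigma_type (support S) -> R).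
Proof.
move=> qS; rewrite (_ : outcome b q = \1_[set u : sigma_type (support S) | hit q u = b q]).
  apply: measurable_indic; have := measurable_hit_sigma qS measurableT (Y := [set b q]) Logic.I.
  by rewrite setTI.
apply/funext => u; rewrite indicE /outcome; congr (_%:R)%R; congr nat_of_bool.
by apply/eqP/idP; rewrite inE.
Qed.

(** The coins are averaged out one at a time. The coin of [q] has an index outside [support S], so
    its outcome may be replaced by the conditional probability, a function of the vertices that
    joins [f] for the induction. *)
Lemma E_edges (S : seq (nat * nat)) (b : nat * nat -> bool) (f : X -> R) : uniq S ->
  measurable_fun setT (f : sigma_type (support [::]) -> R) -> (forall u, 0 <= f u <= 1) ->
  E leb (fun u => f u * \prod_(q <- S) outcome b q u) =
  E leb (fun u => f u * \prod_(q <- S) outcome_prob b q u).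
Proof.
elim: S f => [|q S IH] f /=; first by move=> _ _ _; congr (E _ _); apply/funext => u; rewrite !big_nil.
move=> /andP[qS uS] mf f01.
have supS : support [::] `<=` support S by move=> i [|[]//]; left.
have mfS := measurable_sigma_type_sub supS mf.
pose F u := f u * \prod_(q <- S) outcome b q u.
have mF : measurable_fun setT (F : sigma_type (support S) -> R).
  apply: measurable_funM => //; rewrite (_ : (fun u => _) = (fun u : sigma_type (support S) =>
      (* The guard makes every factor measurable over [support S], whatever the index. *)
      \prod_(q <- S) (if q \in S then outcome b q u else 0))).
    have [] := @bmeas_prod R _ (sigma_type (support S)) _ S
      (fun q u => if q \in S then outcome b q u else 0) => // q'.
    case q'S : (q' \in S); last exact: bmeas_cst.
    exact: bmeas01 (measurable_outcome_sigma b q'S) (outcome01 b q').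
  by apply/funext => u; apply: eq_big_seq => q' ->.
have F01 u : 0 <= F u <= 1 by apply: mul01 => //; apply: prod01 => q'; exact: outcome01.
have nq : ~ support S (choice.pickle q).*2.+1.
  case=> [[k ek]|[q' q'S]].
    by have := congr1 odd ek; rewrite /= !odd_double.
  by move=> [] /double_inj /(pcan_inj choice.pickleK) e; rewrite e q'S in qS.
have mep : measurable_fun setT (edge_prob q : sigma_type (support S) -> R).
  exact: measurable_edge_prob_sigma.
have ep01 u : 0 <= edge_prob q u <= 1 by exact: W01.
have hq := E_bernoulli nq mF mep F01 ep01.
have mFX := measurable_from_sigma_type mF.
have bF : bmeas F by exact: bmeas01.
have bep : bmeas (edge_prob q) := bmeas01 (measurable_from_sigma_type mep) ep01.
have bh : bmeas (fun u => (hit q u)%:R : R).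
  apply: bmeas01 => [|u]; last by case: hit; rewrite ?lexx ?ler01.
  have := @measurable_outcome_sigma [:: q] (fun=> true) q; rewrite inE eqxx => /(_ isT).
  move/measurable_from_sigma_type; rewrite /outcome.
  by under eq_fun do rewrite eqb_id.
(* The statement for a present edge is [hq]; that for an absent edge follows by subtraction from
   [F]. *)
have key : E leb (fun u => F u * outcome b q u) = E leb (fun u => F u * outcome_prob b q u).
  rewrite /outcome /outcome_prob; case: (b q).
    by under eq_fun do rewrite eqb_id; exact: hq.
  under eq_fun do rewrite eqbF_neg -[(~~ _)%:R]/((~~ hit q _)%:R) .
  have -> : (fun u => F u * (~~ hit q u)%:R) = (fun u => F u - F u * (hit q u)%:R).
    by apply/funext => u; case: hit; rewrite /= ?mulr1 ?mulr0 ?subrr ?subr0.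
  have -> : (fun u => F u * (1 - edge_prob q u)) = (fun u => F u - F u * edge_prob q u).
    by apply/funext => u; rewrite mulrBr mulr1.
  have b1 : bmeas (fun u => F u * (hit q u)%:R) by exact: bmeasM.
  have b2 : bmeas (fun u => F u * edge_prob q u) by exact: bmeasM.
  by rewrite (EB _ bF b1) (EB _ bF b2) -hq.
transitivity (E leb (fun u => F u * outcome b q u)).
  by congr (E _ _); apply/funext => u; rewrite big_cons /F; ring.
rewrite key.
transitivity (E leb (fun u => (f u * outcome_prob b q u) * \prod_(q <- S) outcome b q u)).
  by congr (E _ _); apply/funext => u; rewrite /F; ring.
rewrite IH//.
- by congr (E _ _); apply/funext => u; rewrite big_cons; ring.
- by apply: measurable_funM => //; exact: measurable_outcome_prob_sigma.
- by move=> u; apply: mul01 => //; exact: outcome_prob01.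
Qed.

End sampled_graph.

Section vertices_and_edges.
Context {R : realType}.
Local Notation X := (interval_space (R := R)).
Local Notation leb := (@leb R).

Lemma sigma_of_vertex : sigma_of_sequence vertex = sigma_seq (support [::]) :> set (set X).
Proof.
apply/seteqP; split; apply: smallest_sub; try exact: smallest_sigma_algebra.
  by move=> A [i _ h]; apply: sub_sigma_algebra; exists i.*2 => //; left; exists i.
move=> A [j [[i ->]|[//]] h]; apply: sub_sigma_algebra; by exists i.
Qed.

Lemma vertex_mutually_independent : mutually_independent (vertex : nat -> {RV leb >-> X}).
Proof.
move=> J A mA; rewrite (_ : \bigcap_(i in _) _ = [set u | forall i, i \in (J : seq nat) -> A i (vertex i u)]).
  rewrite vertex_independent ?fset_uniq//; congr (_%:E).
  by apply: eq_bigr => i _; rewrite vertex_law.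
by apply/seteqP; split=> u h i Ji; exact: h.
Qed.

Variable W : X * X -> R.
Hypotheses (mW : measurable_fun setT W) (W01 : forall q, 0 <= W q <= 1).
Local Notation G := (sampled_graph W).

Let indic01 (A : set X) u : 0 <= (\1_A u : R) <= 1.
Proof. by rewrite indicE; case: (_ \in _); rewrite ?lexx ?ler01. Qed.

Lemma prod_outcome (S : seq (nat * nat)) b u :
  \prod_(q <- S) outcome W b q u = (all (fun q => hit W q u == b q) S)%:R.
Proof.
elim: S => [|q S IH]; first by rewrite big_nil.
by rewrite big_cons IH /= /outcome -natrM mulnb.
Qed.

Let bmeas_prod_outcome_prob S b : bmeas (fun u => \prod_(q <- S) outcome_prob W b q u).
Proof.
apply: bmeas_prod => q; apply: bmeas01; last exact: outcome_prob01.
by apply: (@measurable_from_sigma_type R (support [::])); exact: measurable_outcome_prob_sigma.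
Qed.

Definition sampledRV : {RV leb >-> borel_graph} :=
  HB.pack G (isMeasurableFun.Build _ _ _ _ G (measurable_sampled_graph mW)).

(** Testing against an event [B] of the vertices amounts to [E_edges] with the indicator of [B] as
    [f]. *)
Lemma sampled_cond_independent_edges : cond_independent_edges W vertex sampledRV.
Proof.
move=> S b oS; pose f u := \prod_(q <- (S : seq _)) outcome_prob W b q u.
have bf : bmeas f := bmeas_prod_outcome_prob (S : seq _) b.
have f0 u : 0 <= f u.
  by rewrite /f prodr_ge0// => q _; case/andP: (outcome_prob01 W01 b q u).
exists f; split.
- rewrite sigma_of_vertex => _ [A mA <-].
  have := @bmeas_prod R _ (sigma_type (support [::])) _ (S : seq _) (outcome_prob W b).
  case=> [q|mf _]; last exact: mf.
  exact: bmeas01 (measurable_outcome_prob_sigma mW (S := [::]) b q) (outcome_prob01 W01 b q).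
- exact: bmeas_integrable.
- exact: aeW.
- move=> B; rewrite sigma_of_vertex => sB; have mB := sigma_seq_measurable sB.
  set D := [set t | _].
  have DE u : D u <-> all (fun q => hit W q u == b q) (S : seq _).
    have hE q : q \in (S : seq _) -> edge (G u) q.1 q.2 = hit W q u.
      by move=> qS; rewrite edge_sampled ?oS// -surjective_pairing.
    split=> [h|/allP h q qS]; last by apply/eqP; rewrite hE//; exact: h.
    by apply/allP => q qS; rewrite -hE//; apply/eqP; exact: h.
  have mD : measurable D.
    rewrite (_ : D = \bigcap_(q in [set q | q \in (S : seq _)]) [set u | edge (G u) q.1 q.2 = b q]) //.
    apply: fin_bigcap_measurable; first exact: finite_seq.
    move=> q _; by have := measurable_sampled_graph mW measurableT (measurable_edge q.1 q.2 (b q)); rewrite setTI.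
  have e : E leb (\1_(D `&` B)) = E leb (fun u => \1_B u * f u).
    have mI : measurable_fun setT (\1_B : sigma_type (support [::]) -> R).
      by apply: measurable_indic; exact: sB.
    rewrite -(@E_edges R W mW W01 (S : seq _) b \1_B (fset_uniq S) mI (indic01 B)).
    congr (E _ _); apply/funext => u; rewrite prod_outcome indicI /= mulrC; congr (_ * _).
    rewrite indicE; congr (_%:R)%R; congr nat_of_bool.
    by apply/idP/idP; rewrite inE; move/DE.
  rewrite E_indic in e; last exact: measurableI.
  rewrite -[LHS]fineK; last by apply: fin_num_measure; exact: measurableI.
  rewrite [X in X%:E]e -E_EFin; last by apply: bmeasM => //; exact: bmeas_indic.
  rewrite [RHS]integral_mkcond; apply: eq_integral => u _.
  rewrite patchE indicE; case: (_ \in _); by rewrite ?mul1r ?mul0r.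
Qed.

End vertices_and_edges.

(** * Identification of the law *)

Section law_of_sampled_graph.
Context {R : realType}.
Local Notation X := (interval_space (R := R)).
Local Notation leb := (@leb R).

Lemma edge_irrefl (G : graph) i : edge G i i = false.
Proof. by case: G => a ha; have := ha; rewrite inE => -[_ ia]; exact: ia. Qed.

(** A pattern with a loop is impossible in a graph; any other can be oriented increasingly and freed
    of repetitions, as the counting estimates require. *)
Lemma present_ordered (S : seq (nat * nat)) : present S = set0 \/
  exists2 S', present S = present S' & uniq S' /\ {in S', forall q, (q.1 < q.2)%N}.
Proof.
have [/hasP[q qS /eqP qq]|/hasPn nq] := boolP (has (fun q => q.1 == q.2) S).
  left; apply/seteqP; split=> // G /allP/(_ _ qS).
  by rewrite qq edge_irrefl.
right; pose o (q : nat * nat) := (minn q.1 q.2, maxn q.1 q.2).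
exists (undup (map o S)); last first.
  split; first exact: undup_uniq.
  move=> q'; rewrite mem_undup => /mapP[q qS ->] /=; have := nq _ qS.
  by rewrite /= /minn /maxn; case: (ltngtP q.1 q.2).
have edge_o G q : edge G (o q).1 (o q).2 = edge G q.1 q.2.
  rewrite /o /minn /maxn /=; case: ltnP => // _; exact: edge_sym.
apply/funext => G; apply/propext; rewrite /present /=; split=> /allP h; apply/allP => q.
  by rewrite mem_undup => /mapP[q' qS ->]; rewrite edge_o; exact: h.
by move=> qS; rewrite -edge_o; apply: h; rewrite mem_undup map_f.
Qed.

Lemma relabel_ordinals (S : seq (nat * nat)) : uniq S -> {in S, forall q, (q.1 < q.2)%N} ->
  exists k (S' : seq ('I_k * 'I_k)), simple_edges S' /\ relabel_pairs val S' = S.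
Proof.
move=> uS oS; pose k := \max_(q <- S) q.2.
have le q : q \in S -> (q.2 < k.+1)%N.
  by move=> qS; rewrite ltnS /k; exact: (@leq_bigmax_seq _ S xpredT (fun q => q.2) q qS isT).
have le1 q : q \in S -> (q.1 < k.+1)%N by move=> qS; rewrite (ltn_trans (oS _ qS)) ?le.
pose S' : seq ('I_k.+1 * 'I_k.+1) := [seq (inord q.1, inord q.2) | q <- S].
have eS : relabel_pairs val S' = S.
  rewrite /relabel_pairs -map_comp -[RHS]map_id; apply/eq_in_map => q qS /=.
  by rewrite !inordK ?le ?le1// -surjective_pairing.
exists k.+1, S'; split=> //; rewrite /simple_edges; apply/andP; split.
  by apply: (@map_uniq _ _ (fun p => (val p.1, val p.2))); rewrite [X in uniq X]eS.
by apply/allP => _ /mapP[q qS ->] /=; rewrite !inordK ?le ?le1//; exact: oS.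
Qed.

Variable W : X * X -> R.
Hypotheses (mW : measurable_fun setT W) (W01 : forall q, 0 <= W q <= 1).
Variable mu : probability borel_graph R.
Hypothesis W_mu : forall k (S : seq ('I_k * 'I_k)), simple_edges S ->
  E leb (fun u => \prod_(q <- S) W (vertex q.1 u, vertex q.2 u)) =
  prob_present mu (relabel_pairs val S).

(** Only the events [present S] have to be compared. For an increasing pattern without repetitions
    [E_edges] with [f = 1] averages out the coins, and [W_mu] evaluates what is left. *)
Lemma sampled_law A : measurable A -> mu A = distribution leb (sampledRV mW) A.
Proof.
apply: borel_graph_measure_unique => S.
have [->|[{}S' -> [uS oS]]] := present_ordered S; first by rewrite !measure0.
have [k [S2 [sS2 eS2]]] := relabel_ordinals uS oS.
have mG : measurable (sampled_graph W @^-1` present S').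
  by have := measurable_sampled_graph mW measurableT (measurable_present S'); rewrite setTI.
rewrite -[LHS]fineK; last by apply: fin_num_measure; exact: measurable_present.
rewrite -[RHS]fineK; last by apply: fin_num_measure; exact: measurable_present.
congr (_%:E); apply: etrans (E_indic leb mG).
transitivity (E leb (fun u => 1 * \prod_(q <- S') outcome_prob W (fun=> true) q u)).
  rewrite -[LHS]/(prob_present mu S') -[in LHS]eS2 -W_mu//.
  by congr (E _ _); apply/funext => u; rewrite mul1r -eS2 big_map.
rewrite -E_edges//; last by move=> u; rewrite ler01 lexx.
congr (E _ _); apply/funext => u; rewrite mul1r.
rewrite prod_outcome indicE; congr (_%:R)%R; congr nat_of_bool.
have e : all (fun q => hit W q u == true) S' = all (fun p => edge (sampled_graph W u) p.1 p.2) S'.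
  by apply: eq_in_all => q qS; rewrite edge_sampled ?oS// -surjective_pairing eqb_id.
by rewrite e; apply/idP/idP; rewrite inE.
Qed.

End law_of_sampled_graph.

(** * The interval as an atomless Lebesgue space *)

Section standard_space.
Context {R : realType}.
Local Notation X := (interval_space (R := R)).
Local Notation leb := (@leb R).

Lemma standard_lebesgue_leb : standard_lebesgue leb.
Proof.
split; first exact: complete_completed.
exists (@unif R), setT, setT, id, id; split; split=> //.
- by rewrite setCT measure0.
- by rewrite setCT measure0.
- by move=> B mB; rewrite setTI.
Qed.

(** For large [k] an interval of length [k.+1%:R^-1] has less mass than [A]. Since [k.+1] of them
    cover the half-open unit interval, one meets [A] in a set of positive mass. *)
Lemma atomless_leb : atomless leb.
Proof.
move=> A mA A0; have fA : leb A \is a fin_num by exact: fin_num_measure.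
have /ltr_add_invr[k] : 0 < fine (leb A) by apply: fine_gt0; rewrite A0 ltey_eq fA.
rewrite add0r => kA; have k0 : (0 : R) < k.+1%:R by [].
pose C (i : nat) : set (measurableTypeR R) := `[i%:R / k.+1%:R, i.+1%:R / k.+1%:R[%classic.
have mC i : measurable (C i : set X) by apply: measurable_completion; exact: measurable_itv.
have lC i : (i < k.+1)%N -> leb (C i) = k.+1%:R^-1%:E.
  move=> ik; rewrite [LHS]lebE; last exact: measurable_itv.
  rewrite unif_itvco.
  - by congr (_%:E); rewrite -mulrBl -natrB// subSnn mul1r.
  - by rewrite divr_ge0.
  - by rewrite ler_pM2r ?invr_gt0// ler_nat.
  - by rewrite ler_pdivrMr// mul1r ler_nat.
have [[i ik /eqP Ci]|none] := pselect (exists2 i, (i < k.+1)%N & leb (A `&` C i) <> 0%E).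
  exists (A `&` C i); split; [exact: measurableI|exact: subIsetl|by rewrite measure_gt0|].
  apply: (@le_lt_trans _ _ (leb (C i))); last by rewrite lC// -[ltRHS]fineK// lte_fin.
  by apply: le_measure; rewrite ?inE//; exact: measurableI.
have nF (i : nat) : leb.-negligible (if (i < k.+1)%N then A `&` C i else set0).
  case: ifP => ik; last exact: negligible_set0.
  exists (A `&` C i); split=> //; first exact: measurableI.
  by apply: contrapT => h; apply: none; exists i.
have nU : leb.-negligible (~` `[0, 1[%classic : set X).
  have mU : measurable (`[0, 1[%classic : set (measurableTypeR R)) by exact: measurable_itv.
  exists (~` `[0, 1[%classic); split=> //.
    by apply: measurableC; exact: measurable_completion.
  by rewrite [LHS]probability_setC ?lebE ?unif_unit ?subee//; exact: measurable_completion.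
have : leb.-negligible A.
  apply: negligibleS (negligibleU nU (negligible_bigcup nF)) => x Ax.
  have [x01|nx] := pselect ((`[0, 1[%classic : set X) x); last by left.
  right; move: x01; rewrite /= in_itv/= => /andP[x0 x1].
  have /truncn_itv/andP[t1 t2] : 0 <= (x : R) * k.+1%:R by rewrite mulr_ge0.
  exists (Num.truncn ((x : R) * k.+1%:R)) => //.
  have tk : (Num.truncn ((x : R) * k.+1%:R) < k.+1)%N.
    rewrite -(ltr_nat R) (le_lt_trans t1)// -[ltRHS]mul1r ltr_pM2r//.
  rewrite tk; split=> //; rewrite /C /= in_itv/= ler_pdivrMr// t1 ltr_pdivlMr//.
by move/(measure_negligible mA) => lA0; rewrite lA0 ltxx in A0.
Qed.

Lemma generalized_measurable_graph_leb (W : X * X -> R) :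
  measurable_fun setT W -> (forall q, 0 <= W q <= 1) ->
  (forall x y, W (x, y) = W (y, x)) -> generalized_measurable_graph leb W.
Proof.
move=> mW W01 sW; split=> //.
- exact: standard_lebesgue_leb.
- exact: atomless_leb.
- move=> _ A mA; rewrite setTI; apply: caratheodory_measurable_mu_ext.
  by rewrite -[X in measurable X]setTI; exact: mW.
Qed.

End standard_space.

(** * Universality *)

(** By universality [G] contains a copy of its first [n + l] vertices together with one new vertex,
    [None], joined as required. Homogeneity carries the copy back to the initial segment, and [k] is
    where the new vertex goes. *)
Lemma universal_extension (G : graph) n l : universal_homogeneous G ->
  exists2 k, (n + l <= k)%N & forall i, (i < n + l)%N -> edge G i k = (i < n)%N.
Proof.
move=> [univ hom]; pose e (s t : option 'I_(n + l)) := match s, t with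
  | Some i, Some j => edge G i j
  | Some i, None => (i < n)%N | None, Some i => (i < n)%N
  | None, None => false end.
have [|[i|]|f fI fe] := univ _ e.
- by move=> [i|] [j|] //=; exact: edge_sym.
- exact: edge_irrefl.
- by [].
(* The inverse of [f \o Some] on its image; the value 0 elsewhere is arbitrary. *)
pose g x : nat := if [pick i | f (Some i) == x] is Some i then val i else 0%N.
have gf i : g (f (Some i)) = i.
  rewrite /g; case: pickP => [j /eqP /fI [->]//|/(_ i)]; by rewrite eqxx.
have [||x y|h [hb he hg]] := hom (range (f \o Some)) `I_(n + l) g.
- exact: finite_image.
- split.
  + by move=> _ [i _ <-] /=; rewrite gf; exact: ltn_ord.
  + move=> _ _ /set_mem[i _ <-] /set_mem[j _ <-] /=; rewrite !gf => ij.
    by rewrite (val_inj ij).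
  + by move=> i /= il; exists (f (Some (Ordinal il))); [exists (Ordinal il)|rewrite gf].
- by move=> [i _ <-] [j _ <-] /=; rewrite !gf fe.
have hf (i : 'I_(n + l)) : h (f (Some i)) = i by rewrite hg ?gf//; exists i.
exists (h (f None)) => [|i il]; last by have := fe (Some (Ordinal il)) None; rewrite -he hf.
rewrite leqNgt; apply/negP => kl.
by have := hf (Ordinal kl); rewrite /= => /(bij_inj hb)/fI.
Qed.

Lemma independent_pair_law {R : realType} d0 (T : measurableType d0) (P : probability T R)
    d1 (Y1 : measurableType d1) (Q1 : probability Y1 R)
    d2 (Y2 : measurableType d2) (Q2 : probability Y2 R) (Z1 : T -> Y1) (Z2 : T -> Y2) :
  measurable_fun setT Z1 -> measurable_fun setT Z2 ->
  (forall A B, measurable A -> measurable B ->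
     P (Z1 @^-1` A `&` Z2 @^-1` B) = (Q1 A * Q2 B)%E) ->
  forall C, measurable C -> P ((fun t => (Z1 t, Z2 t)) @^-1` C) = (Q1 \x Q2)%E C.
Proof.
move=> mZ1 mZ2 indep.
have mZ : measurable_fun setT (fun t => (Z1 t, Z2 t)) by exact: measurable_fun_pair.
pose Z := HB.pack (fun t => (Z1 t, Z2 t)) (isMeasurableFun.Build _ _ _ _ _ mZ) : {RV P >-> (Y1 * Y2)%type}.
move=> C mC; rewrite -[LHS]/(distribution P Z C); apply/esym.
by apply: product_measure_unique => // A B mA mB; exact: indep.
Qed.

(** * Joint laws of blocks of vertices *)

Section vertex_tuples.
Context {R : realType}.
Local Notation X := (interval_space (R := R)).
Local Notation leb := (@leb R).

(** The recursion follows that of [power_measure]; the offset [o] provides disjoint blocks for the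
    two tuples. *)
Fixpoint vertices (o n : nat) (u : X) : n.-tuple X :=
  match n with
  | 0 => [tuple]
  | n.+1 => tuple_cons (vertex o u, vertices o.+1 n u)
  end.

Lemma tnth_vertices o n u (i : 'I_n) : tnth (vertices o n u) i = vertex (o + i) u.
Proof.
elim: n o i => [|n IH] o i; first by case: i.
have [->|[j ->]] : i = ord0 \/ exists j, i = lift ord0 j.
  by case: (unliftP ord0 i) => [j ->|->]; [right; exists j|left].
  by rewrite addn0 (tnth_nth (vertex o u)).
rewrite /= /tuple_cons /= tnthS.
by rewrite IH addSnnS.
Qed.

Definition even_between (o n : nat) : set nat := [set i.*2 | i in [set i | (o <= i < o + n)%N]].

Lemma measurable_vertices o n (I : set nat) : even_between o n `<=` I ->
  measurable_fun setT (vertices o n : sigma_type I -> n.-tuple X).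
Proof.
elim: n o => [|n IH] o oI; first exact: measurable_cst.
have m1 : measurable_fun setT (vertex o : sigma_type I -> X).
  by apply: measurable_unif_seq_sigma; apply: oI; exists o => //=; rewrite leqnn addnS ltnS leq_addr.
have m2 : measurable_fun setT (vertices o.+1 n : sigma_type I -> n.-tuple X).
  apply: IH => _ [i /= oi <-]; apply: oI; exists i => //=; lia.
have mp := measurable_fun_pair m1 m2.
move=> _ A mA; rewrite setTI.
have mA' : measurable (@tuple_cons _ X n @^-1` A).
  by rewrite -[X in measurable X]setTI; exact: measurable_tuple_cons.
by have := mp measurableT _ mA'; rewrite setTI.
Qed.

Lemma measurable_verticesX o n : measurable_fun setT (vertices o n).
Proof.
exact: measurable_from_sigma_type (measurable_vertices (@subset_refl _ (even_between o n))).
Qed.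

Lemma sigma_seq_vertices o n A : measurable A ->
  sigma_seq (even_between o n) (vertices o n @^-1` A).
Proof.
move=> mA; have := measurable_vertices (@subset_refl _ (even_between o n)) measurableT mA.
by rewrite setTI.
Qed.

Lemma vertices_law o n A : measurable A ->
  leb (vertices o n @^-1` A) = power_measure leb n A.
Proof.
elim: n o A => [|n IH] o A mA.
  rewrite /= diracE; have [A0|nA0] := pselect (A [tuple]).
    rewrite mem_set// (_ : _ @^-1` _ = setT) ?probability_setT//.
    by rewrite -subTset.
  by rewrite memNset// (_ : _ @^-1` _ = set0) ?measure0// -subset0.
have mA' : measurable (@tuple_cons _ X n @^-1` A).
  by rewrite -[X in measurable X]setTI; exact: measurable_tuple_cons.
have indep B C : measurable B -> measurable C ->
    (leb (vertex o @^-1` B `&` vertices o.+1 n @^-1` C) = leb B * power_measure leb n C)%E.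
  move=> mB mC; rewrite (@sigma_seq_independent R [set o.*2] (even_between o.+1 n)).
  - by rewrite [X in (X * _)%E]leb_unif_seq// IH.
  - by apply/seteqP; split=> // _ [/= -> [j /= oj /double_inj jo]]; move: oj; rewrite jo; lia.
  - exact: sigma_seq_preimage.
  - exact: sigma_seq_vertices.
have mo : measurable_fun setT (vertex o : X -> X) := measurable_unif_seq o.*2.
have h := @independent_pair_law R _ X leb _ X leb _ _ (power_measure leb n) (vertex o)
  (vertices o.+1 n) mo (@measurable_verticesX o.+1 n) indep.
exact: (h _ mA').
Qed.

End vertex_tuples.

(** * Exceptional tuples have probability zero *)

Section universality.
Context {R : realType}.
Local Notation X := (interval_space (R := R)).
Local Notation leb := (@leb R).
Variable W : X * X -> R.
Hypotheses (mW : measurable_fun setT W) (W01 : forall q, 0 <= W q <= 1).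
Variable mu : probability borel_graph R.
Hypothesis mu_universal : \forall G \ae mu, universal_homogeneous G.
Hypothesis mu_law : forall A, measurable A -> mu A = distribution leb (sampledRV mW) A.

Section tuples.
Variables n l : nat.
Local Notation Y := (n.-tuple X * l.-tuple X)%type.

(** The conditional probability that a new vertex at [q.2] is joined to all points of the first
    tuple and to none of the second. *)
Let pattern_prob (q : Y * X) : R :=
  (\prod_(i < n) W (tnth q.1.1 i, q.2)) * \prod_(j < l) (1 - W (tnth q.1.2 j, q.2)).

Let pattern_set : set (Y * X) :=
  [set q | 0 < \prod_(i < n) \prod_(j < l) (W (tnth q.1.1 i, q.2) * (1 - W (tnth q.1.2 j, q.2)))].

Let tuples (u : X) : Y := (vertices 0 n u, vertices n l u).

Let pattern (k : nat) : seq (nat * nat) := [seq (val i, k) | i <- index_enum 'I_(n + l)].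

Let b (q : nat * nat) : bool := (q.1 < n)%N.

Let W10 q : 0 <= 1 - W q <= 1. Proof. exact: onem01. Qed.

Let mfst i : measurable_fun setT (fun q : Y * X => W (tnth q.1.1 i, q.2)).
Proof.
have m1 : measurable_fun setT (fun q : Y * X => tnth q.1.1 i).
  apply: (measurableT_comp (@measurable_tnth _ X n i)).
  exact: (measurableT_comp measurable_fst measurable_fst).
have mp := measurable_fun_pair m1 (@measurable_snd _ _ Y X).
move=> _ A mA; rewrite setTI.
have mWA : measurable (W @^-1` A) by rewrite -[X in measurable X]setTI; exact: mW.
by have := mp measurableT _ mWA; rewrite setTI.
Qed.

Let msnd j : measurable_fun setT (fun q : Y * X => 1 - W (tnth q.1.2 j, q.2)).
Proof.
apply: measurable_funB; first exact: measurable_cst.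
have m1 : measurable_fun setT (fun q : Y * X => tnth q.1.2 j).
  apply: (measurableT_comp (@measurable_tnth _ X l j)).
  exact: (measurableT_comp measurable_snd measurable_fst).
have mp := measurable_fun_pair m1 (@measurable_snd _ _ Y X).
move=> _ A mA; rewrite setTI.
have mWA : measurable (W @^-1` A) by rewrite -[X in measurable X]setTI; exact: mW.
by have := mp measurableT _ mWA; rewrite setTI.
Qed.

Let bfst i := bmeas01 (mfst i) (fun q => W01 _).
Let bsnd j := bmeas01 (msnd j) (fun q => W10 _).

Let pattern_prob01 q : 0 <= pattern_prob q <= 1.
Proof.
by apply: mul01; apply: prod01 => i; [exact: W01|exact: W10].
Qed.

Let measurable_pattern_prob : measurable_fun setT pattern_prob.
Proof.
apply: measurable_funM; apply: (bmeas_prod _ _).1 => i; [exact: bfst|exact: bsnd].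
Qed.

Let measurable_pattern_set : measurable pattern_set.
Proof.
have h : measurable_fun setT (fun q : Y * X =>
    \prod_(i < n) \prod_(j < l) (W (tnth q.1.1 i, q.2) * (1 - W (tnth q.1.2 j, q.2)))).
  by apply: (bmeas_prod _ _).1 => i; apply: bmeas_prod => j; exact: bmeasM (bfst i) (bsnd j).
have := h measurableT [set` `]0, +oo[] (measurable_itv _).
rewrite setTI (_ : _ @^-1` _ = pattern_set)//.
by apply/seteqP; split=> q /=; rewrite in_itv/= andbT.
Qed.

(** Every factor of the double product in the definition of universality occurs in [pattern_prob];
    if the latter is nonzero, all of them are positive. *)
Let pattern_prob_eq0 q : ~ pattern_set q -> pattern_prob q = 0.
Proof.
move=> nq; apply: contrapT => /eqP; rewrite mulf_eq0 negb_or => /andP[h1 h2]; apply: nq.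
rewrite /pattern_set /=; apply: prodr_gt0 => i _; apply: prodr_gt0 => j _.
have /andP[w0 _] := W01 (tnth q.1.1 i, q.2); have /andP[v0 _] := W10 (tnth q.1.2 j, q.2).
rewrite mulr_gt0// lt_neqAle ?w0 ?v0 andbT eq_sym.
  by move/prodf_neq0 : h1; apply.
by move/prodf_neq0 : h2; apply.
Qed.

Let pattern_outcome_prob k u :
  \prod_(q <- pattern k) outcome_prob W b q u = pattern_prob (tuples u, vertex k u).
Proof.
rewrite big_map big_split_ord /= /pattern_prob /=; congr (_ * _); apply: eq_bigr => i _.
  by rewrite /outcome_prob /b /edge_prob /= ltn_ord tnth_vertices.
by rewrite /outcome_prob /b /edge_prob /= ltnNge leq_addr tnth_vertices.
Qed.

Let exceptional : set Y := [set p | leb (xsection pattern_set p) = 0%E].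

Let measurable_exceptional : measurable exceptional.
Proof.
have := measurable_fun_xsection leb measurable_pattern_set measurableT (Y := [set 0%E]).
by rewrite setTI; apply.
Qed.

Let event : set X := tuples @^-1` exceptional.

Let sigma_event I : even_between 0 n `|` even_between n l `<=` I -> sigma_seq I event.
Proof.
rewrite subUset => -[nI lI].
have mp := measurable_fun_pair (measurable_vertices (R := R) nI) (measurable_vertices (R := R) lI).
by have := mp measurableT _ measurable_exceptional; rewrite setTI.
Qed.

Let evens_sub o m : even_between o m `<=` support [::].
Proof. by move=> _ [i _ <-]; left; exists i. Qed.

Let measurable_event : measurable event.
Proof. exact: sigma_seq_measurable (sigma_event (@subset_refl _ _)). Qed.

Let measurable_tuples : measurable_fun setT tuples.
Proof. exact: measurable_fun_pair (@measurable_verticesX R 0 n) (@measurable_verticesX R n l). Qed.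

Let F (q : Y * X) : R := \1_exceptional q.1 * pattern_prob q.

Let F01 q : 0 <= F q <= 1.
Proof.
have /andP[h1 h2] := pattern_prob01 q.
by rewrite /F indicE; case: (_ \in _); rewrite ?mul1r ?mul0r ?lexx ?ler01 ?h1.
Qed.

Let measurable_F : measurable_fun setT F.
Proof.
apply: measurable_funM => //.
exact: (measurableT_comp (measurable_indic measurable_exceptional) measurable_fst).
Qed.

(** For an exceptional [p] the section of [pattern_set] is null, and off it [pattern_prob] vanishes;
    for other [p] the indicator is 0. *)
Let E_exceptional p : E leb (fun v => F (p, v)) = 0.
Proof.
rewrite /F /= indicE; have [pN|pN] := boolP (p \in exceptional); last first.
  by under eq_fun do rewrite mul0r; exact: E_cst.
rewrite -[RHS](E_cst leb 0); apply: E_ae_eq; last 1 first.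
- exists (xsection pattern_set p); split; [exact: measurable_xsection|exact: set_mem pN|].
  move=> z /= nz; apply: contrapT => zs; apply: nz; rewrite mul1r pattern_prob_eq0//.
  by move=> ps; apply: zs; rewrite /xsection /= inE.
- apply: bmeas01 => [|v]; last by rewrite mul1r.
  under eq_fun do rewrite mul1r.
  exact: (measurableT_comp measurable_pattern_prob (pair1_measurable p)).
- exact: bmeas_cst.
Qed.

Let disjoint_even (I J : set nat) : (forall i, I i -> ~ J i) -> I `&` J = set0.
Proof. by move=> IJ; apply/seteqP; split=> // i [/IJ]. Qed.

Let tuples_independent k A B : (n + l <= k)%N -> measurable A -> measurable B ->
  (leb (tuples @^-1` A `&` vertex k @^-1` B) = leb (tuples @^-1` A) * leb B)%E.
Proof.
move=> nlk mA mB.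
pose I := even_between 0 n `|` even_between n l.
have sA : sigma_seq I (tuples @^-1` A).
  have mp := measurable_fun_pair (measurable_vertices (R := R) (@subsetUl _ (even_between 0 n) (even_between n l)))
    (measurable_vertices (R := R) (@subsetUr _ (even_between 0 n) (even_between n l))).
  by have := mp measurableT _ mA; rewrite setTI.
rewrite (@sigma_seq_independent R I [set k.*2])//.
- by congr (_ * _)%E; exact: leb_unif_seq.
- by apply: disjoint_even => _ [] [j /= jn <-] /= /double_inj jk; lia.
- exact: sigma_seq_preimage.
Qed.

(** After the coins are averaged out, vertex [k] is still independent of the tuples, since
    [n + l <= k]; integrating over it first gives 0. *)
Let event_pattern k : (n + l <= k)%N ->
  leb.-negligible (event `&` [set u | all (fun q => hit W q u == b q) (pattern k)]).
Proof.
move=> nlk; set D := [set u | _].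
have bO : bmeas (fun u => \prod_(q <- pattern k) outcome W b q u).
  apply: bmeas_prod => q; apply: bmeas01 (outcome01 W b q).
  apply: (@measurable_from_sigma_type R (support [:: q])).
  by apply: measurable_outcome_sigma => //; rewrite inE.
have mD : measurable D.
  have := bO.1 measurableT _ (measurable_set1 1); rewrite setTI.
  rewrite (_ : _ @^-1` _ = D)//; apply/seteqP; split=> u /=; rewrite prod_outcome /D /=.
    by case: all => // /eqP; rewrite eq_sym oner_eq0.
  by move=> ->.
have mED : measurable (event `&` D) by exact: measurableI.
exists (event `&` D); split=> //.
rewrite -[LHS]fineK; last exact: fin_num_measure.
congr (_%:E); rewrite -(E_indic leb mED).
have mI : measurable_fun setT (\1_event : sigma_type (support [::]) -> R).
  by apply: measurable_indic; apply: sigma_event; rewrite subUset; split; exact: evens_sub.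
have I01 u : 0 <= (\1_event u : R) <= 1.
  by rewrite indicE; case: (_ \in _); rewrite ?lexx ?ler01.
have up : uniq (pattern k).
  rewrite map_inj_uniq ?index_enum_uniq// => i j [ij]; exact: val_inj.
transitivity (E leb (fun u => \1_event u * \prod_(q <- pattern k) outcome W b q u)).
  congr (E _ _); apply/funext => u; rewrite prod_outcome indicI /=; congr (_ * _).
  by rewrite indicE; congr (_%:R)%R; congr nat_of_bool; apply/idP/idP; rewrite inE.
rewrite (E_edges mW W01 b up mI I01).
transitivity (E leb (fun u => F (tuples u, vertex k u))).
  congr (E _ _); apply/funext => u; rewrite pattern_outcome_prob /F /=; congr (_ * _).
have ind := fun A B => @tuples_independent k A B nlk.
rewrite (E_independent measurable_tuples (measurable_unif_seq k.*2) ind measurable_F F01).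
by under eq_fun do rewrite E_exceptional; exact: E_cst.
Qed.

(** On [event] a universal homogeneous sample realizes the pattern at some [k]. Hence [event] is
    covered by countably many null events and the null set of the other samples. *)
Let leb_event : leb event = 0%E.
Proof.
apply: (measure_negligible measurable_event).
have [M [mM M0 sM]] := mu_universal.
have nM : leb.-negligible (sampled_graph W @^-1` M).
  exists (sampled_graph W @^-1` M); split=> //.
    by have := measurable_sampled_graph mW measurableT mM; rewrite setTI.
  by rewrite -M0 mu_law.
pose C k : set X := if (n + l <= k)%N then
  event `&` [set u | all (fun q => hit W q u == b q) (pattern k)] else set0.
have nC k : leb.-negligible (C k).
  by rewrite /C; case: ifP => nlk; [exact: event_pattern|exact: negligible_set0].
apply: negligibleS (negligibleU nM (negligible_bigcup nC)) => u eu.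
have [uh|nuh] := pselect (universal_homogeneous (sampled_graph W u)); last by left; exact: sM.
right; have [k nlk hk] := universal_extension n l uh; exists k => //.
rewrite /C nlk; split=> //=; apply/allP => _ /mapP[i _ ->]; rewrite /b /= -edge_sampled ?hk//.
exact: leq_trans nlk.
Qed.

Lemma universal_tuples : \forall p \ae (power_measure leb n \x power_measure leb l)%E,
  (0 < leb [set z | (0 < \prod_(i < n) \prod_(j < l)
     (W (tnth p.1 i, z) * (1 - W (tnth p.2 j, z))))%R])%E.
Proof.
exists exceptional; split=> //.
- have indep A B : measurable A -> measurable B ->
    (leb (vertices 0 n @^-1` A `&` vertices n l @^-1` B) =
     power_measure leb n A * power_measure leb l B)%E.
    move=> mA mB; rewrite (@sigma_seq_independent R (even_between 0 n) (even_between n l)).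
    + by rewrite !vertices_law.
    + by apply: disjoint_even => _ [i /= i1 <-] [j /= j1] /double_inj ij; lia.
    + exact: sigma_seq_vertices.
    + exact: sigma_seq_vertices.
  have h := @independent_pair_law R _ X leb _ _ (power_measure leb n) _ _ (power_measure leb l)
    (vertices 0 n) (vertices n l) (@measurable_verticesX R 0 n) (@measurable_verticesX R n l) indep.
  exact: etrans (esym (h _ measurable_exceptional)) leb_event.
- move=> p /= np; rewrite /exceptional /=.
  have -> : xsection pattern_set p = [set z | (0 < \prod_(i < n) \prod_(j < l)
     (W (tnth p.1 i, z) * (1 - W (tnth p.2 j, z))))%R].
    by apply/seteqP; split=> z; rewrite /xsection /= inE.
  by apply/eqP; rewrite -measure_le0 leNgt; apply/negP.
Qed.

End tuples.

Lemma universal_sampled : universal_measurable_graph leb W.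
Proof. by move=> n l _ _; exact: universal_tuples. Qed.

End universality.

Theorem theorem9 (R : realType) (mu : probability borel_graph R)
    (mu_invariant : perm_invariant mu)
    (mu_ergodic : perm_ergodic mu)
    (mu_universal : \forall G \ae mu, universal_homogeneous G) :
  exists (d : measure_display) (X : measurableType d) (m : probability X R)
    (w : X * X -> R),
    [/\ generalized_measurable_graph m w,
        universal_measurable_graph m w &
        generated_measure m w mu].
Proof.
have [G G_typical] := typical_graph mu_invariant mu_ergodic.
have [m [w [e [c [[m0 m1 mc] ws w01 [e01 ed c0 cs wd]]]]]] := limit_object_exists G_typical.
pose W : interval_space (R := R) * interval_space (R := R) -> R := graphon m0 e01 ed.
have mW : measurable_fun setT W by exact: measurable_graphon.
have W01 q : 0 <= W q <= 1 by exact: graphon01.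
have W_mu k (S : seq ('I_k * 'I_k)) : simple_edges S ->
    E (@leb R) (fun u => \prod_(q <- S) W (vertex q.1 u, vertex q.2 u)) =
    prob_present mu (relabel_pairs val S).
  exact: (E_graphon_product m0 m1 mc w01 e01 ed c0 cs wd).
have law := sampled_law mW W01 W_mu.
exists _, interval_space, (@leb R), W; split.
- apply: generalized_measurable_graph_leb => // x y; exact: (graphon_sym m0 ws).
- exact: universal_sampled mW W01 mu mu_universal law.
exists _, interval_space, (@leb R), vertex, (sampledRV mW); split=> //.
- by move=> i A mA; exact: vertex_law.
- exact: vertex_mutually_independent.
- exact: sampled_cond_independent_edges.
Qed.
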